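(* Let $p$ be a monic hyperbolic polynomial of degree $d\ge 2$ with connected Julia set $J_p$. Fix $r$ sufficiently large as described in the context, and let $\epsilon>0$ be the constant (independent of $a$) from the context, with associated model map $\psi:J_p\times\mathbb{D}_r\to J_p\times\mathbb{D}_r$ and inductive limit $(\check{J}_p,\check{\psi})$. There exists $a_0>0$ such that if $0<|a|<a_0$ then there exists a homeomorphism $\Phi^+:\check{J}_p\to J^+$ with $$H_{p,a}\circ\Phi^+=\Phi^+\circ\check{\psi}\quad\text{on }\check{J}_p,$$ where $J^+$ is the forward Julia set of the Hénon map $H_{p,a}$.
   Context: For $a\in\mathbb{C}\setminus\{0\}$ the Hénon map is $H_{p,a}:\mathbb{C}^2\to\mathbb{C}^2$, $H_{p,a}(x,y)=(p(x)+ay,\,ax)$, a biholomorphism. $K^{+}$ is the set of points of $\mathbb{C}^2$ with bounded forward orbit under $H_{p,a}$ and $J^+=\partial K^+$ (with the subspace topology). $p$ is hyperbolic if it is expanding on a neighborhood of $J_p$; then $p'\neq 0$ on $J_p$. $\mathbb{D}_r=\{z\in\mathbb{C}:|z|<r\}$, where $r>3$ is fixed, depending only on $p$, and so large that $J_p\subset\mathbb{D}_r$ and that for all sufficiently small $|a|>0$ the set of points of $\mathbb{C}^2$ with bounded forward and backward orbits is contained in $\{|x|\le r,|y|\le r\}$ and the set of points with unbounded forward orbit is $\bigcup_{k\ge0}H_{p,a}^{-k}(W^+)$, $W^+=\{|x|\ge\max(|y|,r)\}$. Model map: for some (small enough) $\epsilon>0$ independent of $a$, $$\psi(\zeta,z)=\left(p(\zeta),\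 \epsilon\zeta-\frac{\epsilon^2 z}{p'(\zeta)}\right),\qquad (\zeta,z)\in J_p\times\mathbb{D}_r,$$ which is an injective map of $J_p\times\mathbb{D}_r$ into itself. Inductive limit: $\check{J}_p=\big((J_p\times\mathbb{D}_r)\times\mathbb{N}\big)/\!\sim$, where $\sim$ is the equivalence relation generated by $(x,n)\sim(\psi(x),n+1)$, with the quotient (inductive limit) topology. The bijection $\check{\psi}:\check{J}_p\to\check{J}_p$ is induced by $(x,n)\mapsto(\psi(x),n)$. *)

(* Defs.v *)
From HB Require Import structures.
From Stdlib Require Import Relation_Operators.
From mathcomp Require Import all_boot all_order all_algebra complex.
From mathcomp Require Import all_classical all_reals all_analysis.

Set Implicit Arguments.
Unset Strict Implicit.
Unset Printing Implicit Defensive.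

Import Order.TTheory GRing.Theory Num.Theory.
Import numFieldNormedType.Exports.

Local Open Scope classical_set_scope.
Local Open Scope ring_scope.

(* The concrete type R[i] carries no canonical topology; typed as an abstract
   numClosedFieldType it inherits the norm topology of num fields, and products
   of it are normed modules. Norms take values in the field itself, hence the
   casts t%:C of real constants below. *)
Definition Cplx (R : realType) : numClosedFieldType := R[i].

Definition rC (R : realType) (t : R) : Cplx R := (t%:C)%C.

Section Topology.

Definition boundary (T : topologicalType) (A : set T) : set T :=
  closure A `\` interior A.

Definition is_homeomorphism (X Y : topologicalType) (f : X -> Y) : Prop :=
  continuous f /\
  exists g : Y -> X, [/\ continuous g, cancel f g & cancel g f].

End Topology.

Section InductiveLimit.
Local Open Scope quotient_scope.
Context (T : topologicalType) (f : T -> T).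

Definition indlim_step (u v : T * nat) : Prop := v = (f u.1, u.2.+1).

Definition indlim_eqv (u v : T * nat) : bool :=
  `[< clos_refl_sym_trans _ indlim_step u v >].

Lemma indlim_eqv_refl : reflexive indlim_eqv.
Proof. by move=> u; apply/asboolP; exact: rst_refl. Qed.

Lemma indlim_eqv_sym : symmetric indlim_eqv.
Proof. by move=> u v; apply/asboolP/asboolP; exact: rst_sym. Qed.

Lemma indlim_eqv_trans : transitive indlim_eqv.
Proof.
by move=> v u w /asboolP uv /asboolP vw; apply/asboolP; apply: rst_trans uv vw.
Qed.

Definition indlim_rel :=
  EquivRel indlim_eqv indlim_eqv_refl indlim_eqv_sym indlim_eqv_trans.

Definition indlim := quotient_topology {eq_quot indlim_rel}.

HB.instance Definition _ := Topological.on indlim.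
HB.instance Definition _ := Quotient.on indlim.

Definition indlim_in (u : T * nat) : indlim := \pi_indlim u.

Definition indlim_map (q : indlim) : indlim :=
  indlim_in (f (repr q).1, (repr q).2).

Lemma indlim_inP (u v : T * nat) :
  indlim_in u = indlim_in v <-> clos_refl_sym_trans _ indlim_step u v.
Proof.
split=> [/eqquotP/asboolP //|uv].
by apply/eqquotP/asboolP.
Qed.

Lemma indlim_in_succ (x : T) (n : nat) :
  indlim_in (f x, n.+1) = indlim_in (x, n).
Proof. by apply/indlim_inP/rst_sym/rst_step. Qed.

Lemma indlim_mapE (x : T) (n : nat) :
  indlim_map (indlim_in (x, n)) = indlim_in (f x, n).
Proof.
have inv u v : clos_refl_sym_trans _ indlim_step u v ->
    indlim_in (f u.1, u.2) = indlim_in (f v.1, v.2).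
  elim=> {u v} [u _ ->|//|//|u v w _ -> _ //] /=.
  by rewrite indlim_in_succ.
rewrite /indlim_map; have /inv // : clos_refl_sym_trans _ indlim_step
  (repr (indlim_in (x, n))) (x, n).
by apply/indlim_inP; rewrite [LHS]reprK.
Qed.

Lemma indlim_map_bij : bijective indlim_map.
Proof.
have inv u v : clos_refl_sym_trans _ indlim_step u v ->
    indlim_in (u.1, u.2.+1) = indlim_in (v.1, v.2.+1).
  elim=> {u v} [u _ ->|//|//|u v w _ -> _ //] /=.
  by rewrite indlim_in_succ.
pose g (q : indlim) := indlim_in ((repr q).1, (repr q).2.+1).
have gE x n : g (indlim_in (x, n)) = indlim_in (x, n.+1).
  rewrite /g; have /inv // : clos_refl_sym_trans _ indlim_step
    (repr (indlim_in (x, n))) (x, n).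
  by apply/indlim_inP; rewrite [LHS]reprK.
have indlimP q : exists x n, q = indlim_in (x, n).
  by exists (repr q).1, (repr q).2; rewrite -surjective_pairing [RHS]reprK.
exists g => q; have [x [n ->]] := indlimP q.
  by rewrite indlim_mapE gE indlim_in_succ.
by rewrite gE indlim_mapE indlim_in_succ.
Qed.

End InductiveLimit.

Section Restriction.
Context (T : Type) (A : set T) (f : T -> T) (fA : set_fun A A f).

Definition restrict_self (x : set_type A) : set_type A :=
  SigSub (mem_set (fA (set_mem (valP x)))).

End Restriction.

Section Dynamics.
Variable R : realType.
Local Notation C := (Cplx R).

Definition bounded_orbit (V : normedModType C) (f : V -> V) (z : V) : Prop :=
  bounded_fun (fun n : nat => iter n f z).

Section Polynomial.
Variable p : {poly C}.

Definition filled_julia : set C := [set z | bounded_orbit (horner p) z].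

Definition julia : set C := boundary filled_julia.

(* p strictly expands some continuous conformal metric rho(z)|dz| defined on an
   open neighborhood U of the Julia set. *)
Definition hyperbolic : Prop :=
  exists (U : set C) (rho : C -> R) (lambda : R),
    [/\ open U, julia `<=` U & 1 < lambda] /\
    [/\ {within U, continuous rho}, forall z, U z -> 0 < rho z &
        forall z, U z -> U p.[z] ->
          rC (lambda * rho z) <= `|p^`().[z]| * rC (rho p.[z])].

End Polynomial.

Section Henon.
Variables (p : {poly C}) (a : C).

Definition henon (w : C * C) : C * C := (p.[w.1] + a * w.2, a * w.1).

Definition henon_inv (w : C * C) : C * C :=
  (w.2 / a, (w.1 - p.[w.2 / a]) / a).

Lemma henonK : a != 0 -> cancel henon henon_inv.
Proof.
by move=> a0 [x y]; rewrite /henon_inv /= ![a * _]mulrC mulfK// addrAC subrr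
  add0r mulfK.
Qed.

Lemma henon_invK : a != 0 -> cancel henon_inv henon.
Proof.
by move=> a0 [x y]; rewrite /henon /= ![a * _]mulrC !divfK// addrC subrK.
Qed.

Definition Kplus : set (C * C) := [set w | bounded_orbit henon w].

Definition Kminus : set (C * C) := [set w | bounded_orbit henon_inv w].

Definition Jplus : set (C * C) := boundary Kplus.

End Henon.

Definition Wplus (r : R) : set (C * C) :=
  [set w | `|w.2| <= `|w.1| /\ rC r <= `|w.1|].

Definition disk (r : R) : set C := [set z | `|z| < rC r].

Definition closed_bidisk (r : R) : set (C * C) :=
  [set w | `|w.1| <= rC r /\ `|w.2| <= rC r].

Definition admissible_radius (p : {poly C}) (r : R) : Prop :=
  [/\ 3 < r, julia p `<=` disk r &
   exists2 delta : R, 0 < delta &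
     forall a : C, 0 < `|a| < rC delta ->
       Kplus p a `&` Kminus p a `<=` closed_bidisk r /\
       ~` Kplus p a = \bigcup_k (iter k (henon p a) @^-1` Wplus r)].

Definition model_domain (p : {poly C}) (r : R) : set (C * C) :=
  julia p `*` disk r.

Definition model_map (p : {poly C}) (eps : R) (w : C * C) : C * C :=
  (p.[w.1], rC eps * w.1 - rC eps ^+ 2 * w.2 / p^`().[w.1]).

End Dynamics.

(* Main.v *)
Require Import Defs.
From HB Require Import structures.
From mathcomp Require Import all_boot all_order all_algebra complex ring lra.
From mathcomp Require Import all_classical all_reals all_analysis.

(** Write [x_n] for the first coordinates of a forward orbit of the Hénon map [H]. Since the second coordinate of the image is [a x_n], the sequence [x_n] is a pseudo-orbit of [p] with errors of order [a], and all of the dynamics is obtained from the expansion of [p] near [J], without complex analysis.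

A neighbourhood of [J] has its preimage strictly inside itself, so a pseudo-orbit that leaves it either stays in the filled Julia set forever or escapes, both in a stable way. Hence a point of [J^+] in the bidisk has all its [x_n] near [J], and it is shadowed by the orbit of a unique [z] in [J]. Conversely, the points shadowing [z] form the graph of a Lipschitz function [x = graph z y], and the orbits that follow [z] for a long time and then jump to an escaping point show that this graph is in the boundary of [K^+]. So, near [J], [J^+] is [J x D], on which [H] acts as [(z, y) |-> (p z, a * graph z y)], close to [(p z, a z - a^2 y / p' z)].

In the coordinate [v = eps y / a] this reads [(z, v) |-> (p z, eps * graph z (a v / eps))], whose images are discs centred near those of the model map [psi] but smaller and rotated by [(a / eps)^2]. It coincides on [|v| <= r] with [psi \o T], where [T] is a fibrewise homeomorphism supported in [|v| < 2 r]. As [psi] is injective on [|v| <= 3 r], a conjugacy [h] between [psi] and [psi \o T], equal to the identity for [|v| >= r], is the limit of the iteration [h := psi T h psi^-1] on the image of [psi] and [h := id] elsewhere. Finally [Phi] maps the class of [(u, n)] to [H^-n (graph embedding of h u)]. *)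

Set Implicit Arguments.
Unset Strict Implicit.
Unset Printing Implicit Defensive.

Import Order.TTheory GRing.Theory Num.Theory.
Import numFieldNormedType.Exports.

Local Open Scope classical_set_scope.
Local Open Scope ring_scope.

(** * The complex norm with real values *)

Section ComplexNorm.
Variable R : realType.
Local Notation C := (Cplx R).
Implicit Types (x y z w : C) (t s e : R).

(** The obstacle is that the fibre maps of [H] and [psi] are not close: [T] is nearly the
    multiplication by [q ^+ 2] with [q = a / eps], which tends to 0 with [a] while [eps] stays
    fixed, so a small perturbation argument cannot apply. But [T] may be any fibrewise homeomorphism
    supported in a disc, provided that its deviation from [q ^+ 2 * v] is small relative to
    [q ^+ 2]. So [graph z] must be known up to errors of order [a ^+ 2]: its slope comes from
    subtracting the invariance equation at two points, its value at 0 from the fact that all second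
    coordinates of that orbit are already of order [a].

    The three radii have separate tasks. The conjugacy moves only [nm v < r], [T] moves only
    [nm v < 2 * r], and the sheets of [psi] over a base point are disjoint up to [3 * r]. The shell
    between [2 * r] and [3 * r], where [T] is the identity, makes the transported maps continuous
    across the edges of the sheets. *)

Definition nm z : R := complex.Re `|z|.

Lemma rC_nm z : rC (nm z) = `|z|.
Proof.
by rewrite /rC /nm; apply: (@RRe_real R); apply: normr_real.
Qed.

Lemma rC_le s t : (rC s <= rC t) = (s <= t).
Proof. exact: lecR. Qed.

Lemma rC_lt s t : (rC s < rC t) = (s < t).
Proof. exact: ltcR. Qed.

Lemma rC_inj s t : rC s = rC t -> s = t.
Proof. by case. Qed.

Lemma rCM s t : rC (s * t) = rC s * rC t.
Proof. exact: (rmorphM (real_complex R)). Qed.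

Lemma rCD s t : rC (s + t) = rC s + rC t.
Proof. exact: (rmorphD (real_complex R)). Qed.

Lemma rCN s : rC (- s) = - rC s.
Proof. exact: (rmorphN (real_complex R)). Qed.

Lemma rC0 : rC (0 : R) = 0. Proof. by []. Qed.

Lemma rC1 : rC (1 : R) = 1. Proof. by []. Qed.

Lemma nm_ge0 z : 0 <= nm z.
Proof. by rewrite -rC_le rC_nm rC0 normr_ge0. Qed.

Lemma nmD x y : nm (x + y) <= nm x + nm y.
Proof. by rewrite -rC_le rCD !rC_nm ler_normD. Qed.

Lemma nmM x y : nm (x * y) = nm x * nm y.
Proof. by apply: rC_inj; rewrite rCM !rC_nm normrM. Qed.

Lemma nmN x : nm (- x) = nm x.
Proof. by rewrite /nm normrN. Qed.

Lemma nmC x y : nm (x - y) = nm (y - x).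
Proof. by rewrite -nmN opprB. Qed.

Lemma nm0 : nm (0 : C) = 0.
Proof. by rewrite /nm normr0. Qed.

Lemma nm1 : nm (1 : C) = 1.
Proof. by rewrite /nm normr1. Qed.

Lemma nm0P z : nm z = 0 -> z = 0.
Proof. by move=> z0; apply/eqP; rewrite -normr_eq0 -rC_nm z0 rC0. Qed.

Lemma nm_gt0 z : (0 < nm z) = (z != 0).
Proof. by rewrite -rC_lt rC_nm normr_gt0. Qed.

Lemma nmX z n : nm (z ^+ n) = nm z ^+ n.
Proof. by elim: n => [|n IH]; rewrite ?expr0 ?nm1// !exprS nmM IH. Qed.

Lemma nmV z : nm z^-1 = (nm z)^-1.
Proof.
have [->|z0] := eqVneq z 0; first by rewrite invr0 nm0 invr0.
apply: (@mulfI _ (nm z)); first by rewrite gt_eqF// nm_gt0.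
by rewrite -nmM !mulfV ?nm1// gt_eqF// nm_gt0.
Qed.

Lemma nm_rC t : nm (rC t) = `|t|.
Proof.
have pos (u : R) : 0 <= u -> nm (rC u) = u.
  by move=> u0; apply: rC_inj; rewrite rC_nm ger0_norm// (rC_le 0).
case: (lerP 0 t) => t0; first by rewrite ger0_norm ?pos.
by rewrite ltr0_norm // -nmN -rCN pos// oppr_ge0 ltW.
Qed.

Lemma nm_tri y x z : nm (x - z) <= nm (x - y) + nm (y - z).
Proof. by rewrite (_ : x - z = (x - y) + (y - z)) ?nmD// addrA subrK. Qed.

Lemma nm_le_dist x y : nm x <= nm y + nm (x - y).
Proof. by rewrite -{1}(subrK y x) addrC nmD. Qed.

Lemma nm_Re z : `|complex.Re z| <= nm z.
Proof. by rewrite -rC_le rC_nm; exact: normc_ge_Re. Qed.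

Lemma nm_Im z : `|complex.Im z| <= nm z.
Proof.
have := @normc_ge_Re R (z * 'i%C); rewrite ReiNIm normrN.
have -> : `|z * 'i%C| = `|z : C|.
  have -> : `|z * 'i%C| = `|z : C| * `|'i%C : C| by exact: (@normrM C).
  suff -> : `|'i%C : C| = 1 by rewrite mulr1.
  by rewrite [LHS]normc_def /= expr0n expr1n add0r sqrtr1.
by rewrite -rC_nm -rC_le.
Qed.

Lemma nm_le_ReIm z : nm z <= `|complex.Re z| + `|complex.Im z|.
Proof.
have zE : z = rC (complex.Re z) + 'i%C * rC (complex.Im z) := complexE z.
rewrite {1}zE; apply: le_trans (nmD _ _) _; rewrite nmM !nm_rC.
suff -> : nm 'i%C = 1 by rewrite mul1r.
apply: rC_inj; rewrite rC_nm [LHS]normc_def /= expr0n expr1n add0r sqrtr1.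
by [].
Qed.

End ComplexNorm.

Section ComplexTopology.
Variable R : realType.
Local Notation C := (Cplx R).
Implicit Types (x y z w : C) (s t e : R).

Lemma pos_rC (u : C) : 0 < u -> exists2 e : R, 0 < e & u = rC e.
Proof.
move=> u0; have uE : u = rC (nm u) by rewrite rC_nm gtr0_norm.
by exists (nm u) => //; rewrite nm_gt0 gt_eqF.
Qed.

Lemma nbhs_nmP z (A : set C) :
  nbhs z A <-> exists2 e : R, 0 < e & forall y, nm (z - y) < e -> A y.
Proof.
rewrite -nbhs_ballE; split=> [[u /= /pos_rC[e e0 ->] H]|[e e0 H]].
  by exists e => // y zy; apply: H; rewrite -ball_normE /= -rC_nm rC_lt.
exists (rC e) => /=; first by rewrite (rC_lt 0).
by move=> y; rewrite -ball_normE /= -rC_nm rC_lt; exact: H.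
Qed.

Lemma nbhs2_nmP x y (A : set (C * C)) :
  nbhs (x, y) A <-> exists2 e : R, 0 < e &
    forall x' y', nm (x - x') < e -> nm (y - y') < e -> A (x', y').
Proof.
split=> [[[B B'] /= [/nbhs_nmP[e e0 eB] /nbhs_nmP[e' e0' eB']] H]|[e e0 H]].
  exists (Num.min e e') => [|x' y']; first by rewrite lt_min e0.
  rewrite !lt_min => /andP[? _] /andP[_ ?].
  by apply: H; split => /=; [apply: eB|apply: eB'].
exists ([set x' | nm (x - x') < e], [set y' | nm (y - y') < e]) => /=.
  by split; apply/nbhs_nmP; exists e.
by case=> x' y' [/= ? ?]; apply: H.
Qed.

Lemma continuous_nm_rC : continuous (fun w : R * R => (w.1 +i* w.2)%C : C).
Proof.
case=> a b; apply/(@cvgrPdist_lt _ _ _ _ _).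
move=> u /pos_rC[e e0 ->].
have e2 : 0 < e / 2 by lra.
near=> w.
rewrite -rC_nm rC_lt.
apply: le_lt_trans (nm_le_ReIm _) _ => /=.
have h1 : `|a - w.1| < e / 2.
  near: w; apply: (@cvgr_dist_lt _ _ _ _ _ (fun w : R * R => w.1) a) => //.
  exact: cvg_fst.
have h2 : `|b - w.2| < e / 2.
  near: w; apply: (@cvgr_dist_lt _ _ _ _ _ (fun w : R * R => w.2) b) => //.
  exact: cvg_snd.
lra.
Unshelve. all: by end_near.
Qed.

(** Heine-Borel is carried over from a square in [R * R], because the topology of [Cplx R] comes
    from its norm and not from a product. *)
Lemma compact_nm_le (B : R) (A : set C) :
  closed A -> (forall z, A z -> nm z <= B) -> compact A.
Proof.
move=> cA AB.
pose I := `[- B, B]%classic : set R.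
apply: (@subclosed_compact _ _
  ((fun w : R * R => (w.1 +i* w.2)%C : C) @` (I `*` I))) => //.
  apply: continuous_compact.
    by apply: continuous_subspaceT; exact: continuous_nm_rC.
  by apply: compact_setX; exact: segment_compact.
move=> z Az; exists (complex.Re z, complex.Im z) => /=; last by case: (z).
have := le_trans (nm_Re z) (AB z Az); have := le_trans (nm_Im z) (AB z Az).
by rewrite !ler_norml /I /= !in_itv /= => -> ->.
Qed.

(** The form in which compactness is used below: what holds near each point from some rank on holds
    everywhere from a common rank on. *)
Lemma compact_increasing (A : set C) (U : nat -> set C) :
  compact A -> (forall n, open (U n)) ->
  (forall n, U n `<=` U n.+1) -> A `<=` \bigcup_n U n ->
  exists n, A `<=` U n.
Proof.
move=> cA oU iU AU.
have mono m n : (m <= n)%N -> U m `<=` U n.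
  move=> /subnK <-; elim: (n - m)%N => [//|k IH] t /IH; rewrite addSn; exact: iU.
move: cA; rewrite compact_cover => /(_ nat setT U).
case=> // [D _ AD].
exists (\max_(i <- finmap.enum_fset D) i)%N => t /AD[i /= iD].
by apply: mono; apply: (@leq_bigmax_seq _ _ xpredT id).
Qed.

(** Completeness of [R] is applied to the real and imaginary parts, which are 1-Lipschitz. The
    explicit rate is what later carries orbit estimates to the limit. *)
Lemma geometric_limit (s : nat -> C) (K th : R) : 0 <= th < 1 ->
  (forall m n, (m <= n)%N -> nm (s m - s n) <= K * th ^+ m) ->
  exists l, forall n, nm (s n - l) <= K * th ^+ n.
Proof.
move=> /andP[th0 th1] sK.
have K0 : 0 <= K.
  by have := sK 0%N 0%N (leqnn _); rewrite subrr nm0 expr0 mulr1.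
have tend : forall e : R, 0 < e -> exists n, forall m, (n <= m)%N -> K * th ^+ m < e.
  move=> e e0.
  have : (fun n => K * th ^+ n) @ \oo --> (0 : R).
    rewrite -(mulr0 K); apply: cvgMr; apply: cvg_expr.
    by rewrite ger0_norm.
  move=> /cvgrPdist_lt /(_ e e0) [n _ nP]; exists n => m nm_.
  by have := nP m nm_; rewrite sub0r normrN ger0_norm// mulr_ge0// exprn_ge0.
have lim (f : C -> R) : (forall x y, `|f x - f y| <= nm (x - y)) ->
    exists l : R, forall e, 0 < e -> exists n, forall m, (n <= m)%N -> `|f (s m) - l| < e.
  move=> fC.
  have : cvg ((fun n => f (s n)) @ \oo).
    apply: cauchy_cvg; apply: cauchy_exP => e e0.
    have [n nP] := tend e e0; exists (f (s n)); exists n => // m /= nm_.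
    rewrite /ball /=; apply: le_lt_trans (fC _ _) _.
    by apply: le_lt_trans (sK _ _ nm_) _; apply: nP.
  move=> cv; exists (limn (fun n => f (s n))) => e e0.
  move: cv => /cvgrPdist_lt /(_ e e0) [n _ nP]; exists n => m nm_.
  by rewrite distrC; apply: nP.
(* The Lipschitz bound is [nm_Re] at [x - y], transported along the additivity of the real part. *)
have [a aP] := lim (@complex.Re R) (fun x y => eq_rect _ (fun u => `|u| <= _) (nm_Re (x - y)) _ (raddfB (@complex.Re R) x y)).
have [b bP] := lim (@complex.Im R) (fun x y => eq_rect _ (fun u => `|u| <= _) (nm_Im (x - y)) _ (raddfB (@complex.Im R) x y)).
exists ((a +i* b)%C : C) => n; apply/ler_addgt0Pr => e e0.
have e2 : 0 < e / 2 by lra.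
have [n1 P1] := aP _ e2; have [n2 P2] := bP _ e2.
pose m := (n + n1 + n2)%N.
apply: le_trans (nm_tri (s m) _ _) _; apply: lerD.
  by apply: sK; rewrite /m -addnA leq_addr.
apply: le_trans (nm_le_ReIm _) _.
have h1 : `|complex.Re (s m) - a| < e / 2 by apply: P1; rewrite /m addnAC leq_addl.
have h2 : `|complex.Im (s m) - b| < e / 2 by apply: P2; rewrite /m leq_addl.
have -> : complex.Re (s m - (a +i* b)%C : C) = complex.Re (s m) - a by case: (s m).
have -> : complex.Im (s m - (a +i* b)%C : C) = complex.Im (s m) - b by case: (s m).
lra.
Qed.

End ComplexTopology.

(** * Polynomial estimates *)

Section PolynomialEstimates.
Variable R : realType.
Local Notation C := (Cplx R).
Implicit Types (p : {poly C}) (x y z w : C) (B e : R).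

Lemma horner_bounded p B :
  exists2 M : R, 0 <= M & forall x, nm x <= B -> nm p.[x] <= M.
Proof.
elim/poly_ind: p => [|p c [M M0 IH]]; first by exists 0 => // x _; rewrite horner0 nm0.
exists (M * `|B| + nm c) => [|x xB].
  by rewrite addr_ge0 ?nm_ge0// mulr_ge0.
rewrite hornerMXaddC; apply: le_trans (nmD _ _) _; rewrite lerD2r nmM.
apply: ler_pM; rewrite ?nm_ge0//; first exact: IH.
by apply: le_trans xB _; exact: ler_norm.
Qed.

Lemma horner_lipschitz p B :
  exists2 L : R, 0 <= L & forall x y, nm x <= B -> nm y <= B ->
    nm (p.[x] - p.[y]) <= L * nm (x - y).
Proof.
elim/poly_ind: p => [|p c [L L0 IH]].
  by exists 0 => // x y _ _; rewrite !horner0 subrr nm0 mul0r.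
have [M M0 pM] := horner_bounded p B.
exists (L * `|B| + M) => [|x y xB yB].
  by rewrite addr_ge0// mulr_ge0.
rewrite !hornerMXaddC.
have -> : p.[x] * x + c - (p.[y] * y + c) = (p.[x] - p.[y]) * x + p.[y] * (x - y).
  by ring.
apply: le_trans (nmD _ _) _; rewrite !nmM mulrDl; apply: lerD.
  rewrite mulrAC; apply: ler_pM; rewrite ?nm_ge0//; first exact: IH.
  by apply: le_trans xB _; exact: ler_norm.
by apply: ler_wpM2r; rewrite ?nm_ge0//; exact: pM.
Qed.

(** Taylor's estimate with a reference point [z] separate from [x] and [y], so that one derivative
    governs all differences in a disc. Induction on the polynomial replaces a mean value theorem. *)
Lemma horner_C1 p B :
  exists2 L : R, 0 <= L & forall x y z, nm x <= B -> nm y <= B -> nm z <= B ->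
    nm (p.[x] - p.[y] - p^`().[z] * (x - y)) <=
      L * (nm (x - z) + nm (y - z)) * nm (x - y).
Proof.
elim/poly_ind: p => [|p c [L L0 IH]].
  by exists 0 => // x y z _ _ _; rewrite deriv0 !horner0 subrr mul0r subr0 nm0 !mul0r.
have [M M0 pM] := horner_lipschitz p B.
exists (L * `|B| + M) => [|x y z xB yB zB].
  by rewrite addr_ge0// mulr_ge0.
rewrite !hornerMXaddC derivD derivC addr0 derivM derivX mulr1 [(_ + p).[z]]hornerD hornerMX.
set D := p^`().[z]; have D' := IH x y z xB yB zB; rewrite -/D in D'.
(* A product rule for differences: the outer terms are of second order by the Lipschitz bound, the
   middle one by induction. *)
have -> : p.[x] * x + c - (p.[y] * y + c) - (D * z + p.[z]) * (x - y) =
  (p.[x] - p.[y]) * (x - z) + (p.[x] - p.[y] - D * (x - y)) * z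
  + (p.[y] - p.[z]) * (x - y) by ring.
have h1 := pM x y xB yB; have h2 := pM y z yB zB.
have zB' : nm z <= `|B| := le_trans zB (ler_norm B).
apply: le_trans (nmD _ _) _; apply: le_trans (lerD (nmD _ _) (lexx _)) _.
rewrite !nmM.
have -> : (L * `|B| + M) * (nm (x - z) + nm (y - z)) * nm (x - y) =
   (M * nm (x - y)) * nm (x - z) +
   (L * (nm (x - z) + nm (y - z)) * nm (x - y)) * `|B| +
   (M * nm (y - z)) * nm (x - y) by ring.
apply: lerD; first apply: lerD.
- by apply: ler_wpM2r; rewrite ?nm_ge0.
- by apply: ler_pM; rewrite ?nm_ge0.
- by apply: ler_wpM2r; rewrite ?nm_ge0.
Qed.

Lemma nm_prod (I : Type) (s : seq I) (F : I -> C) :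
  nm (\prod_(i <- s) F i) = \prod_(i <- s) nm (F i).
Proof.
by elim: s => [|i s IH]; rewrite ?big_nil ?nm1// !big_cons nmM IH.
Qed.

Lemma monic_split p : p \is monic ->
  exists2 s : seq C, size p = (size s).+1 &
    forall x, p.[x] = \prod_(i <- s) (x - i).
Proof.
move=> /monicP pm; have [s sP] := closed_field_poly_normal p.
rewrite pm scale1r in sP; exists s; first by rewrite sP size_prod_XsubC.
move=> x; rewrite sP horner_prod; apply: eq_bigr => i _.
by rewrite hornerXsubC.
Qed.

(** [nm (p.[x] - w)] is the product of the distances from [x] to the [d] roots of [p - w], so the
    nearest root will do. This Hölder dependence of preimages stands in for the open mapping
    theorem. *)
Lemma monic_root_near p d x w : p \is monic -> size p = d.+1 -> (0 < d)%N ->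
  exists2 x', p.[x'] = w & nm (x - x') ^+ d <= nm (p.[x] - w).
Proof.
move=> pm sp d0; pose q := p - w%:P.
have sq : size q = d.+1.
  by rewrite /q size_polyDl sp// size_polyN (leq_ltn_trans (size_polyC_leq1 _)).
have qm : q \is monic.
  apply/monicP; rewrite /q lead_coefDl ?(monicP pm)//.
  by rewrite sp size_polyN (leq_ltn_trans (size_polyC_leq1 _)).
have [s + qE] := monic_split qm; rewrite sq => -[ds].
have pE y : p.[y] - w = \prod_(i <- s) (y - i) by rewrite -qE /q hornerD hornerN hornerC.
have [/hasP[i iS iP]|] := boolP (has (fun i => nm (x - i) ^+ d <= nm (p.[x] - w)) s).
  exists i => //; apply/eqP; rewrite -subr_eq0 pE.
  by rewrite (big_rem i iS) /= subrr mul0r.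
rewrite -all_predC => /allP H; exfalso.
have far i : i \in s -> nm (p.[x] - w) < nm (x - i) ^+ d.
  by move=> /H /=; rewrite -ltNge.
(* Multiplied over all [d] roots, the strict inequalities would have [nm (p.[x] - w) ^+ d] on both
   sides. *)
suff lt t : t != [::] -> {subset t <= s} ->
    nm (p.[x] - w) ^+ size t < \prod_(i <- t) nm (x - i) ^+ d.
  have s0 : s != [::] by rewrite -size_eq0 -ds -lt0n.
  by have := lt s s0 (fun _ => id); rewrite prodrXl -nm_prod -pE -ds ltxx.
elim: t => // i [|j t] IH _ ts.
  by rewrite /= expr1 big_seq1; apply: far; rewrite ts ?mem_head.
rewrite /= exprS big_cons; apply: ltr_pM; rewrite ?nm_ge0 ?exprn_ge0 ?nm_ge0 //.
  by apply: far; rewrite ts ?mem_head.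
by apply: IH => // k kt; apply: ts; rewrite inE kt orbT.
Qed.

Lemma monic_growth p d B : p \is monic -> size p = d.+1 -> (2 <= d)%N ->
  exists2 R0 : R, B <= R0 & forall z, R0 <= nm z -> 2 * nm z <= nm p.[z].
Proof.
move=> pm sp d2; have [s + pE] := monic_split pm; rewrite sp => -[ds].
have [B0 B00 sB] : exists2 B0 : R, 0 <= B0 & forall i, i \in s -> nm i <= B0.
  elim: (s) => [|i t [B0 B00 IH]]; first by exists 0.
  exists (nm i + B0); first by rewrite addr_ge0 ?nm_ge0.
  move=> j; rewrite inE => /orP[/eqP ->|/IH]; first by rewrite lerDl.
  by have := nm_ge0 i; lra.
(* [2 * B0] makes every factor at least [nm z / 2] and [8] makes that at least 4: two factors give
   [2 * nm z], the others are at least 1. *)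
exists (`|B| + 8 + 2 * B0) => [|z zR].
  by have := ler_norm B; lra.
rewrite pE nm_prod.
have B0' := normr_ge0 B.
have far i : i \in s -> nm z / 2 <= nm (z - i).
  by move=> /sB iB; have := nm_le_dist z i; lra.
have ge t : {subset t <= s} -> 1 <= \prod_(i <- t) nm (z - i).
  elim: t => [|i t IH] ts; first by rewrite big_nil.
  rewrite big_cons -[leLHS]mulr1; apply: ler_pM => //.
    by have := far i (ts i (mem_head _ _)); lra.
  by apply: IH => k kt; apply: ts; rewrite inE kt orbT.
move: far ge d2; rewrite ds; case: (s) => [//|i [//|j t]] far ge _.
rewrite !big_cons mulrA.
have h1 := far i (mem_head _ _).
have h2 : nm z / 2 <= nm (z - j) by apply: far; rewrite !inE eqxx orbT.
have h3 : 1 <= \prod_(k <- t) nm (z - k).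
  by apply: ge => k kt; rewrite !inE kt !orbT.
rewrite -[leLHS]mulr1; apply: ler_pM => //; first by have := nm_ge0 z; lra.
have -> : 2 * nm z = 4 * (nm z / 2) by lra.
by apply: ler_pM => //; have := nm_ge0 z; lra.
Qed.

(** The supremum of the times at which the segment from [x] to [w] is in [K] gives the boundary
    point. The lemma shows that a small jump out of the filled Julia set passes close to [J]. *)
Lemma boundary_between (K : set C) x w : K x -> ~ K w ->
  exists2 z, boundary K z & nm (z - x) <= nm (w - x).
Proof.
move=> Kx Kw; pose f (t : R) : C := x + rC t * (w - x).
pose S := [set t : R | 0 <= t <= 1 /\ K (f t)].
have S0 : S 0 by split; [rewrite lexx ler01|rewrite /f rC0 mul0r addr0].
have hS : has_sup S.
  by split; [exists 0|exists 1 => t [/andP[_ ?] _]].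
have t0 : 0 <= sup S by apply: ub_le_sup => //; case: hS.
have t1 : sup S <= 1 by apply: ge_sup => [|t [/andP[_ ?] _]] //; exists 0.
have fdist s t : nm (f s - f t) = `|s - t| * nm (w - x).
  rewrite -nm_rC -nmM; congr nm; rewrite /f rCD rCN; ring.
exists (f (sup S)); last first.
  have -> : f (sup S) - x = rC (sup S) * (w - x) by rewrite /f addrC addKr.
  rewrite nmM nm_rC ger0_norm// -[leRHS]mul1r.
  by apply: ler_wpM2r; rewrite ?nm_ge0.
have [n0|n0] := eqVneq (nm (w - x)) 0.
  by case: Kw; move/nm0P/eqP : n0; rewrite subr_eq0 => /eqP ->.
have n1 : 0 < nm (w - x) by rewrite lt_neqAle eq_sym n0 nm_ge0.
split.
  move=> A /nbhs_nmP[e e0 eA].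
  have en : 0 < e / nm (w - x) by rewrite divr_gt0.
  have [t St tS] := sup_adherent en hS.
  exists (f t); split; first by case: St.
  have tle : t <= sup S by apply: ub_le_sup => //; case: hS.
  by apply: eA; rewrite fdist ger0_norm ?subr_ge0// -ltr_pdivlMr//; lra.
move=> /nbhs_nmP[e e0 eK].
have [t1'|t1'] := eqVneq (sup S) 1.
  apply: Kw; have -> : w = f (sup S) by rewrite t1' /f rC1 mul1r addrC subrK.
  by apply: eK; rewrite subrr nm0.
have tlt : sup S < 1 by rewrite lt_neqAle t1'.
pose u := Num.min ((1 - sup S) / 2) (e / nm (w - x) / 2).
have en : 0 < e / nm (w - x) by rewrite divr_gt0.
have u0 : 0 < u by rewrite lt_min; apply/andP; split; lra.
have u1 : u <= (1 - sup S) / 2 by rewrite ge_min lexx.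
have u2 : u <= e / nm (w - x) / 2 by rewrite ge_min lexx orbT.
have : S (sup S + u).
  split; first by apply/andP; split; lra.
  apply: eK; rewrite fdist opprD addrA subrr add0r normrN gtr0_norm// -ltr_pdivlMr//; lra.
by move=> /(ub_le_sup (proj2 hS)); lra.
Qed.

End PolynomialEstimates.

(** * Bounded orbits and the Julia set *)

Section BoundedOrbits.
Variable R : realType.
Local Notation C := (Cplx R).

Lemma bounded_orbitP (V : normedModType C) (f : V -> V) (v : V) :
  bounded_orbit f v <-> exists B : R, forall n, `|iter n f v| <= rC B.
Proof.
split.
  move=> [M [Mr H]].
  have ME : M = rC (complex.Re M) by symmetry; exact: RRe_real.
  exists (complex.Re M + 1) => n.
  by apply: H => //; rewrite {1}ME rC_lt ltrDl.
move=> [B HB]; exists (rC B); split; first by rewrite realE (rC_le 0 B) (rC_le B 0) le_total.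
by move=> x Bx n _; apply: le_trans (HB n) (ltW Bx).
Qed.

Lemma nm2_le (w : C * C) (B : R) :
  (`|w| <= rC B) <-> (nm w.1 <= B /\ nm w.2 <= B).
Proof.
rewrite prod_normE -!rC_nm.
have -> : Num.max (rC (nm w.1)) (rC (nm w.2)) = rC (Num.max (nm w.1) (nm w.2)).
  by rewrite !maxEle rC_le; case: ifP.
rewrite rC_le ge_max; split; first by move/andP.
by move=> [-> ->].
Qed.

End BoundedOrbits.

Section JuliaSet.
Variables (R : realType) (p : {poly Cplx R}) (d : nat).
Local Notation C := (Cplx R).
Hypotheses (pm : p \is monic) (sp : size p = d.+1) (d2 : (2 <= d)%N).
Local Notation K := (filled_julia p).
Local Notation J := (julia p).
Implicit Types (x y z w : C) (e : R).

Lemma filledP z : K z <-> exists B : R, forall n, nm (iter n (horner p) z) <= B.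
Proof.
rewrite /filled_julia /= bounded_orbitP.
by split=> -[B H]; exists B => n; have := H n; rewrite -rC_nm rC_le.
Qed.

Lemma filled_horner z : K p.[z] <-> K z.
Proof.
rewrite !filledP; split=> -[B H].
  exists (Num.max B (nm z)) => -[|n]; first by rewrite /= le_max lexx orbT.
  by rewrite iterSr le_max H.
by exists B => n; have := H n.+1; rewrite iterSr.
Qed.

Lemma filled_iter n z : K (iter n (horner p) z) <-> K z.
Proof. by elim: n => [//|n IH] /=; rewrite filled_horner. Qed.

Lemma filled_escape (R0 : R) : 0 < R0 ->
  (forall z, R0 <= nm z -> 2 * nm z <= nm p.[z]) ->
  forall z, ~ K z <-> exists n, R0 < nm (iter n (horner p) z).
Proof.
move=> R00 gr z; split.
  move=> nK; apply: contrapT => H; apply: nK; apply/filledP; exists R0 => n.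
  by rewrite leNgt; apply/negP => ?; apply: H; exists n.
move=> [n Rn]; rewrite -(filled_iter n) filledP; set u := iter n _ z in Rn *.
move=> [B HB].
(* Adding [R0] at each step is weaker than doubling, but enough for the archimedean argument. *)
have gt m : R0 <= nm (iter m (horner p) u) /\ m.+1%:R * R0 <= nm (iter m (horner p) u).
  elim: m => [|m [IH1 IH2]] /=; first by rewrite mul1r; split; exact: ltW.
  have := gr _ IH1; set v := iter m _ u => h.
  split; first by lra.
  have : (m.+2%:R : R) = m.+1%:R + 1 by rewrite -addn1 natrD.
  move=> ->; lra.
have := archi_boundP (normr_ge0 (B / R0)); set m := Num.bound _ => mb.
have := le_trans (proj2 (gt m)) (HB m).
have : B / R0 < m%:R by apply: le_lt_trans mb; exact: ler_norm.
rewrite ltr_pdivrMr// => h1 h2.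
have : (m.+1%:R : R) = m%:R + 1 by rewrite -addn1 natrD.
move=> mE; rewrite mE in h2; lra.
Qed.

Lemma iter_horner_continuous n z e : 0 < e ->
  exists2 t : R, 0 < t & forall w, nm (z - w) < t ->
     nm (iter n (horner p) z - iter n (horner p) w) < e.
Proof.
elim: n e => [|n IH] e e0; first by exists e.
have [L L0 pL] := horner_lipschitz p (nm (iter n (horner p) z) + 1).
have e1 : 0 < Num.min 1 (e / (L + 1)).
  by rewrite lt_min ltr01 divr_gt0//; lra.
have [t t0 tP] := IH _ e1; exists t => // w /tP; rewrite lt_min => /andP[h1 h2] /=.
set u := iter n _ z in pL h1 h2 *; set v := iter n _ w in h1 h2 *.
have uv : nm (p.[u] - p.[v]) <= L * nm (u - v).
  apply: pL; first by lra.
  by have := nm_le_dist v u; rewrite nmC; lra.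
rewrite ltr_pdivlMr in h2; last lra.
by have := nm_ge0 (u - v); lra.
Qed.

Lemma open_iter_gt n (B : R) : open [set z | B < nm (iter n (horner p) z)].
Proof.
rewrite openE => z /= Bz; apply/nbhs_nmP.
have [|t t0 tP] := @iter_horner_continuous n z (nm (iter n (horner p) z) - B).
  by rewrite subr_gt0.
exists t => // w /tP h /=.
by have := nm_le_dist (iter n (horner p) z) (iter n (horner p) w); lra.
Qed.

Lemma filled_closed : closed K.
Proof.
have [R0 R1 gr] := monic_growth 1 pm sp d2.
have esc := @filled_escape R0 _ gr.
rewrite -[K]setCK; apply: open_closedC.
have -> : ~` K = \bigcup_n [set z | R0 < nm (iter n (horner p) z)].
  apply/seteqP; split => z /=.
    by move=> /esc [|n]; [lra|exists n].
  by move=> [n _ /=] h; apply/esc; [lra|exists n].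
by apply: bigcup_open => n _; exact: open_iter_gt.
Qed.

Lemma juliaP z : J z <-> K z /\ forall e, 0 < e -> exists2 y, nm (z - y) < e & ~ K y.
Proof.
rewrite /julia /boundary; split.
  move=> [cK iK]; split; first exact: filled_closed.
  move=> e e0; apply: contrapT => H; apply: iK; apply/nbhs_nmP; exists e => // y zy.
  by apply: contrapT => nK; apply: H; exists y.
move=> [Kz H]; split; first exact: subset_closure.
move=> /nbhs_nmP[e e0 eK]; have [y zy] := H e e0; apply; exact: eK.
Qed.

(** Points outside [K] near [p.[z]] are lifted to points near [z] by [monic_root_near]; conversely,
    those near [z] are pushed forward by continuity. *)
Lemma julia_horner z : J p.[z] <-> J z.
Proof.
rewrite !juliaP filled_horner; split=> -[Kz H]; split=> // e e0.
  have d0 : (0 < d)%N by exact: ltnW.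
  have ed : 0 < e ^+ d by rewrite exprn_gt0.
  have [y zy Ky] := H _ ed.
  have [x xE xz] := monic_root_near z y pm sp d0.
  exists x; last by rewrite -filled_horner xE.
  rewrite -(ltr_pXn2r d0) ?nnegrE ?nm_ge0 ?(ltW e0)//.
  exact: le_lt_trans zy.
have [t t0 tP] := iter_horner_continuous 1 z e0.
have [y zy Ky] := H _ t0; exists p.[y]; first exact: tP.
by rewrite filled_horner.
Qed.

Lemma julia_iter n z : J z -> J (iter n (horner p) z).
Proof. by move=> Jz; elim: n => [//|n IH] /=; apply/julia_horner. Qed.

Lemma julia_closed : closed J.
Proof.
rewrite /julia /boundary setDE; apply: closedI; first exact: closed_closure.
by apply: open_closedC; exact: open_interior.
Qed.

Lemma julia_bounded : exists2 B : R, 0 <= B & forall z, J z -> nm z <= B.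
Proof.
have [R0 R1 gr] := monic_growth 1 pm sp d2.
exists R0 => [|z /juliaP[Kz _]]; first lra.
rewrite leNgt; apply/negP => h.
by move: Kz; apply/(filled_escape _ gr); [lra|exists 0%N].
Qed.

Lemma julia_compact : compact J.
Proof.
have [B _ JB] := julia_bounded.
by apply: (@compact_nm_le _ B); [exact: julia_closed|exact: JB].
Qed.

Lemma julia_preimage z w : J z -> 
  exists2 x, p.[x] = z & J x /\ nm (w - x) ^+ d <= nm (p.[w] - z).
Proof.
move=> Jz; have [x xE xw] := monic_root_near w z pm sp (ltnW d2).
exists x; first exact: xE.
by split; [apply/julia_horner; rewrite xE|exact: xw].
Qed.

End JuliaSet.

(** * Expansion near the Julia set *)

Section Contractions.
Variable R : realType.
Local Notation C := (Cplx R).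
Implicit Types (e s th c B K : R).

Lemma half_contraction_fixpoint (G : C -> C) (c0 : C) s :
  0 <= s ->
  (forall x, nm (x - c0) <= s -> nm (G x - c0) <= s) ->
  (forall x x', nm (x - c0) <= s -> nm (x' - c0) <= s ->
     nm (G x - G x') <= nm (x - x') / 2) ->
  exists2 x, nm (x - c0) <= s & G x = x.
Proof.
move=> s0 Gs Gc; pose u n := iter n G c0.
have us n : nm (u n - c0) <= s.
  by elim: n => [|n IH] /=; [rewrite subrr nm0|exact: Gs].
have h0 : 0 <= (1 / 2 : R) < 1 by lra.
have geo m n : nm (u m - u (m + n)%N) <= 2 * s * (1 / 2) ^+ m.
  elim: m => [|m IH].
    rewrite expr0 mulr1 add0n; apply: le_trans (nm_tri c0 _ _) _.
    by have := us 0%N; have := us n; rewrite (nmC c0); lra.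
  rewrite addSn /= exprS; apply: le_trans (Gc _ _ (us _) (us _)) _; lra.
have [x xP] : exists x, forall n, nm (u n - x) <= 2 * s * (1 / 2) ^+ n.
  by apply: geometric_limit => // m n mn; have := geo m (n - m)%N; rewrite subnKC.
have small e : 0 < e -> exists n, nm (u n - x) < e /\ nm (u n.+1 - x) < e.
  move=> e0.
  have : (fun n => 2 * s * (1 / 2 : R) ^+ n) @ \oo --> (0 : R).
    by rewrite -(mulr0 (2 * s)); apply: cvgMr; apply: cvg_expr; rewrite ger0_norm; lra.
  move=> /cvgrPdist_lt /(_ e e0) [n _ nP]; exists n.
  have h k : (n <= k)%N -> nm (u k - x) < e.
    move=> /nP /=; rewrite sub0r normrN => h; apply: le_lt_trans (xP k) _.
    by apply: le_lt_trans h; exact: ler_norm.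
  by split; apply: h.
have xs : nm (x - c0) <= s.
  apply/ler_addgt0Pr => e /small[n [h _]].
  apply: le_trans (nm_tri (u n) _ _) _; rewrite nmC; have := us n; lra.
exists x => //; apply/eqP; rewrite -subr_eq0; apply/eqP; apply: nm0P; apply/eqP.
rewrite eq_le nm_ge0 andbT; apply/ler_addgt0Pr => e e0; rewrite add0r.
have [|n [h1 h2]] := small (e / 2); first by lra.
apply: le_trans (nm_tri (u n.+1) _ _) _.
have := Gc _ _ xs (us n); rewrite (nmC x) /= => h3.
have : nm (G x - u n.+1) <= nm (u n - x) / 2 by [].
lra.
Qed.

(* The bound [B] at the last time is damped by [th] at each step backwards, up to a geometric accumulation of the errors [c]. *)
Lemma backward_contraction (u : nat -> R) th c B n :
  0 <= th < 1 -> (forall k, (k <= n)%N -> u k <= B) -> 0 <= c ->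
  (forall k K, (k < n)%N -> (forall i, (i <= k.+1)%N -> u i <= K) -> u k <= th * K + c) ->
  forall j k, (k + j <= n)%N -> u k <= th ^+ j * B + c / (1 - th).
Proof.
move=> /andP[th0 th1] uB c0 step.
have cc : 0 <= c / (1 - th) by rewrite divr_ge0//; lra.
elim=> [|j IH] k kj.
  by rewrite expr0 mul1r; have := uB k; rewrite -(addn0 k) => /(_ kj); lra.
have kn : (k < n)%N by apply: leq_trans kj; rewrite addnS ltnS leq_addr.
apply: le_trans (step k (th ^+ j * B + c / (1 - th)) kn _) _.
  move=> i ik; apply: IH; apply: leq_trans kj.
  by rewrite addnS -addSn leq_add2r.
rewrite mulrDr exprS mulrA -addrA lerD2l.
have : c = c / (1 - th) * (1 - th) by rewrite divfK//; lra.
set q := c / (1 - th); move=> {1}->; lra.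
Qed.

End Contractions.

Section Expansion.
Variables (R : realType) (p : {poly Cplx R}) (d : nat).
Local Notation C := (Cplx R).
Local Notation J := (julia p).
Implicit Types (x y z w : C) (e : R).

(* The hyperbolic metric is only evaluated at points [z] of J (its values there are normalized to be at least 1); with the weights [rho z] and [rho p.[z]] all differences of points [del]-close to [z] are expanded, so that no metric is needed off J. *)
Record expansion (rho : C -> R) (M lam del : R) : Prop := Expansion {
  exp_lam : 1 < lam;
  exp_del : 0 < del;
  exp_rho : forall z, J z -> 1 <= rho z <= M;
  exp_deriv : forall z, J z -> lam * rho z <= nm p^`().[z] * rho p.[z];
  exp_dist : forall z x x', J z -> nm (x - z) <= del -> nm (x' - z) <= del ->
    lam * rho z * nm (x - x') <= rho p.[z] * nm (p.[x] - p.[x']) }.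

Hypotheses (pm : p \is monic) (sp : size p = d.+1) (d2 : (2 <= d)%N).

Lemma hyperbolic_expansion : hyperbolic p ->
  exists rho M lam del, expansion rho M lam del.
Proof.
move=> [U [rho [lam [[oU JU lam1] [rhoc rho0 rhoE]]]]].
have rhoz z : U z -> {for z, continuous rho}.
  by move=> Uz; move: rhoc; rewrite continuous_open_subspace// => /(_ z); apply; rewrite inE.
(* These open sets increase and bound [rho] from both sides; by compactness one of them contains
   [J]. *)
pose V n := [set z | [/\ U z, rho z < n.+1%:R & n.+1%:R^-1 < rho z]].
have [n JV] : exists n, J `<=` V n.
  apply: compact_increasing.
  - exact: (julia_compact pm sp d2).
  - move=> n; rewrite openE => z [Uz z1 z2].
    have n1 : nbhs z U by apply: open_nbhs_nbhs.
    have n2 : \forall w \near z, rho w < n.+1%:R.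
      by apply: (cvgr_lt (rho z) (rhoz z Uz)).
    have n3 : \forall w \near z, n.+1%:R^-1 < rho w.
      by apply: (cvgr_gt (rho z) (rhoz z Uz)).
    apply: (filterS3 (nbhs_filter z) _ n1 n2 n3).
    by move=> w ? ? ?; split.
  - move=> n z [Uz z1 z2]; split => //.
      by apply: lt_trans z1 _; rewrite ltr_nat.
    by apply: le_lt_trans z2; rewrite lef_pV2 ?posrE ?ltr0n// ler_nat.
  - move=> z Jz; have Uz := JU z Jz; have r0 := rho0 z Uz.
    pose n := (Num.bound (rho z) + Num.bound (rho z)^-1)%N.
    have h1 : rho z < (Num.bound (rho z))%:R by apply: archi_boundP; apply: ltW.
    have h2 : (rho z)^-1 < (Num.bound (rho z)^-1)%:R.
      by apply: archi_boundP; rewrite invr_ge0 ltW.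
    exists n => //; split => //.
      by apply: lt_le_trans h1 _; rewrite ler_nat ltnW// ltnS leq_addr.
    rewrite -[ltRHS]invrK ltf_pV2 ?posrE ?ltr0n ?invr_gt0//.
    by apply: lt_le_trans h2 _; rewrite ler_nat ltnW// ltnS leq_addl.
pose N : R := n.+1%:R; have N1 : 1 <= N by rewrite /N ler1n.
have [B0 _ B0P] := julia_bounded pm sp d2.
have [L L0 LP] := horner_C1 p (B0 + 1).
pose lam' := (1 + lam) / 2; have lam'1 : 1 < lam' < lam by rewrite /lam'; lra.
have M0 : 0 < 2 * N * N * L + 1 by have := mulr_ge0 (mulr_ge0 (ltW (lt_le_trans ltr01 N1)) (ltW (lt_le_trans ltr01 N1))) L0; lra.
have N0 : 0 < N by lra.
(* The second order error on a [del]-disc, with weights up to [N * N], must fit into the gap between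
   [lam] and [lam']; the bound 1 keeps the points in the ball where [L] is valid. *)
pose del := Num.min 1 ((lam - lam') / (2 * N * N * L + 1)).
have del0 : 0 < del by rewrite lt_min ltr01 divr_gt0//; lra.
have del1 : del <= 1 by rewrite /del ge_min lexx.
have delL : del * (2 * N * N * L + 1) <= lam - lam'.
  by rewrite -ler_pdivlMr// /del ge_min lexx orbT.
clearbody del lam'.
have rhoN z : J z -> 1 <= N * rho z <= N * N.
  move=> /JV [_ z1 z2]; apply/andP; split; last by apply: ler_wpM2l; [lra|exact: ltW].
  by rewrite mulrC -ler_pdivrMr// mul1r ltW.
have ddE z : J z -> lam * rho z <= nm p^`().[z] * rho p.[z].
  move=> Jz; have Jpz := (julia_horner pm sp d2 z).2 Jz.
  have := rhoE z (JU z Jz) (JU _ Jpz).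
  by rewrite -rC_nm -rCM rC_le.
(* The factor [N] makes the weights at least 1 and leaves the expansion ratio unchanged. *)
exists (fun z => N * rho z), (N * N), lam', del; split.
- by lra.
- exact: del0.
- exact: rhoN.
- move=> z Jz; have := ddE z Jz; have /andP[r1 _] := rhoN z Jz => h.
  have h' : N * (lam * rho z) <= N * (nm p^`().[z] * rho p.[z]) by rewrite ler_pM2l.
  have : lam' * (N * rho z) <= lam * (N * rho z) by apply: ler_wpM2r; lra.
  lra.
- move=> z x x' Jz xz x'z.
  have Jpz := (julia_horner pm sp d2 z).2 Jz.
  have /andP[r1 _] := rhoN z Jz; have /andP[r2 r3] := rhoN _ Jpz.
  have h := ddE z Jz; have zB := B0P z Jz.
  have xB : nm x <= B0 + 1 by have := nm_le_dist x z; lra.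
  have x'B : nm x' <= B0 + 1 by have := nm_le_dist x' z; lra.
  have zB' : nm z <= B0 + 1 by lra.
  have D := LP x x' z xB x'B zB'.
  set u := nm (x - x') in D *; have u0 : 0 <= u := nm_ge0 _.
  have D2 : nm (p.[x] - p.[x'] - p^`().[z] * (x - x')) <= L * (2 * del) * u.
    apply: le_trans D _; apply: ler_wpM2r => //; apply: ler_wpM2l => //; lra.
  have := nm_le_dist (p^`().[z] * (x - x')) (p.[x] - p.[x']); rewrite nmM -/u nmC => D3.
  have D4 : nm p^`().[z] * u - L * (2 * del) * u <= nm (p.[x] - p.[x']) by lra.
  apply: le_trans (_ : N * rho p.[z] * (nm p^`().[z] * u - L * (2 * del) * u) <= _); last first.
    by apply: ler_wpM2l => //; lra.
  have E1 : N * (lam * rho z) * u <= N * (nm p^`().[z] * rho p.[z]) * u.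
    by apply: ler_wpM2r => //; rewrite ler_pM2l.
  have E2 : N * rho p.[z] * (L * (2 * del) * u) <= N * N * (L * (2 * del) * u).
    apply: ler_wpM2r => //; apply: mulr_ge0 => //; apply: mulr_ge0 => //; lra.
  have E3 : N * N * (L * (2 * del)) <= (lam - lam') * (N * rho z).
    apply: (@le_trans _ _ (lam - lam')).
      have -> : N * N * (L * (2 * del)) = del * (2 * N * N * L + 1) - del by ring.
      lra.
    by rewrite -[leLHS]mulr1; apply: ler_wpM2l => //; lra.
  have E4 := ler_wpM2r u0 E3.
  lra.
Qed.

End Expansion.

(** * Shadowing *)

Lemma geometric_small (R : realType) (th B e : R) : 0 <= th < 1 -> 0 < e ->
  exists n, forall m, (n <= m)%N -> th ^+ m * B < e.
Proof.
move=> th01 e0.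
have : (fun n => th ^+ n * B) @ \oo --> (0 : R).
  rewrite -(mul0r B); apply: cvgMl; apply: cvg_expr; rewrite ger0_norm; lra.
move=> /cvgrPdist_lt /(_ e e0) [n _ nP]; exists n => m nm_.
by have := nP m nm_; rewrite /= sub0r normrN; apply: le_lt_trans; exact: ler_norm.
Qed.

Lemma henon_iter_continuous (R : realType) (p : {poly Cplx R}) (a : Cplx R) n
    (w : Cplx R * Cplx R) (e : R) : 0 < e ->
  exists2 t : R, 0 < t & forall w' : Cplx R * Cplx R,
    nm (w.1 - w'.1) < t -> nm (w.2 - w'.2) < t ->
    nm ((iter n (henon p a) w).1 - (iter n (henon p a) w').1) < e /\
    nm ((iter n (henon p a) w).2 - (iter n (henon p a) w').2) < e.
Proof.
elim: n e => [|n IH] e e0; first by exists e.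
set u := iter n (henon p a) w in IH *.
have [L L0 pL] := horner_lipschitz p (nm u.1 + 1).
have a0 := nm_ge0 a.
have e1 : 0 < Num.min 1 (e / (L + nm a + 1)).
  by rewrite lt_min ltr01 divr_gt0//; lra.
have [t t0 tP] := IH _ e1; exists t => // w' h1' h2'.
have {tP h1' h2'} [] := tP w' h1' h2'; rewrite !iterS -/u; set v := iter n _ w'.
rewrite !lt_min => /andP[h1 h2] /andP[_ h3]; rewrite /henon /=.
have uv : nm (p.[u.1] - p.[v.1]) <= L * nm (u.1 - v.1).
  apply: pL; first by lra.
  by have := nm_le_dist v.1 u.1; rewrite nmC; lra.
have c0 : 0 < L + nm a + 1 by lra.
rewrite !ltr_pdivlMr// in h2 h3.
have := nm_ge0 (u.1 - v.1); have := nm_ge0 (u.2 - v.2) => p1 p2.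
have q1 := mulr_ge0 a0 p1; have q2 := mulr_ge0 a0 p2.
have q3 := mulr_ge0 L0 p1; have q4 := mulr_ge0 L0 p2.
split.
  have -> : p.[u.1] + a * u.2 - (p.[v.1] + a * v.2) =
    (p.[u.1] - p.[v.1]) + a * (u.2 - v.2) by ring.
  apply: le_lt_trans (nmD _ _) _; rewrite nmM.
  set X := nm (u.1 - v.1) in h1 h2 h3 uv p1 p2 q1 q2 q3 q4 *.
  set Y := nm (u.2 - v.2) in h1 h2 h3 uv p1 p2 q1 q2 q3 q4 *.
  have [XY|/ltW YX] := lerP X Y.
    have : L * X <= L * Y by apply: ler_wpM2l.
    lra.
  have : nm a * Y <= nm a * X by apply: ler_wpM2l.
  lra.
rewrite -mulrBr nmM; lra.
Qed.

Section Shadowing.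
Variables (R : realType) (p : {poly Cplx R}) (d : nat).
Local Notation C := (Cplx R).
Local Notation J := (julia p).
Hypotheses (pm : p \is monic) (sp : size p = d.+1) (d2 : (2 <= d)%N).
Variables (rho : C -> R) (M lam del : R).
Hypothesis expn : expansion p rho M lam del.
Implicit Types (a x y z : C) (w : C * C) (e : R).
Local Notation P := (horner p).
Local Notation H := (henon p).
Local Notation th := ((1 + lam) / (2 * lam)).
Local Notation B := (2 * M * del).

(** [th] is the midpoint of [1 / lam] and 1: half of the gain is given up to absorb the coupling
    through the second coordinate. *)
Lemma damping_lt1 : 0 <= th < 1.
Proof.
have l1 := exp_lam expn.
rewrite divr_ge0 ?ltr_pdivrMr /=; lra.
Qed.

Lemma weight_ge1 z : J z -> 1 <= M.
Proof. by move=> /(exp_rho expn) /andP[]; exact: le_trans. Qed.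

Lemma deriv_lower z : J z -> lam <= M * nm p^`().[z].
Proof.
move=> Jz; have h := exp_deriv expn Jz; have l1 := exp_lam expn.
have /andP[r1 _] := exp_rho expn Jz.
have /andP[_ r2] := exp_rho expn ((julia_horner pm sp d2 z).2 Jz).
have h1 : lam * 1 <= lam * rho z by apply: ler_wpM2l => //; lra.
have h2 : nm p^`().[z] * rho p.[z] <= nm p^`().[z] * M by apply: ler_wpM2l; rewrite ?nm_ge0.
lra.
Qed.

(** Expansion is read backwards in time: a weighted distance at time [k] is at most [1 / lam] times
    the next one, up to errors. [eta * K] allows feedback from other times, as in the Hénon map, and
    [E] is a fixed defect; [B] bounds the weighted distance of two points within [del] of the orbit
    of [z]. *)
Lemma pseudo_orbits_close (x x' : nat -> C) z n eta E :
  J z -> 0 <= eta -> 0 <= E -> M * eta <= (lam - 1) / 2 ->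
  (forall k, (k <= n)%N -> nm (x k - iter k P z) <= del /\ nm (x' k - iter k P z) <= del) ->
  (forall k K, (k < n)%N -> (forall i, (i <= k.+1)%N -> nm (x i - x' i) <= K) ->
    nm (p.[x k] - p.[x' k]) <= nm (x k.+1 - x' k.+1) + eta * K + E) ->
  forall j k, (k + j <= n)%N -> nm (x k - x' k) <= th ^+ j * B + 2 * M / (lam - 1) * E.
Proof.
move=> Jz eta0 E0 Meta near_z step j k kj.
have l1 := exp_lam expn; have M1 := weight_ge1 Jz; have d0 := exp_del expn.
have Jk i := julia_iter pm sp d2 i Jz.
have rk i := exp_rho expn (Jk i).
pose u i := rho (iter i P z) * nm (x i - x' i).
have ux i : nm (x i - x' i) <= u i.
  by rewrite -[leLHS]mul1r; apply: ler_wpM2r; rewrite ?nm_ge0//; case/andP: (rk i).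
(* The geometric accumulation of the defects, as [1 - th = (lam - 1) / (2 * lam)]. *)
have cE : M * E / lam / (1 - th) = 2 * M / (lam - 1) * E.
  have t1 := damping_lt1.
  by field; rewrite ?lt0r_neq0//; lra.
apply: le_trans (ux k) _; rewrite -cE.
apply: (@backward_contraction R u th (M * E / lam) B n) => //.
- exact: damping_lt1.
- move=> i iN; have [h1 h2] := near_z i iN; rewrite /u.
  have -> : B = M * (2 * del) by ring.
  have /andP[r1 r2] := rk i.
  apply: ler_pM => //; rewrite ?nm_ge0//; first lra.
  by have := nm_tri (iter i P z) (x i) (x' i); rewrite (nmC (iter i P z)); lra.
- by rewrite divr_ge0 ?mulr_ge0//; lra.
- move=> i K iN uK.
  have [h1 h2] := near_z i (ltnW iN).
  have K0 : 0 <= K by apply: le_trans (uK i _); rewrite ?leqW // mulr_ge0 ?nm_ge0//; case/andP: (rk i) => ? _; lra.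
  have h3 := exp_dist expn (Jk i) h1 h2.
  have h4 : nm (p.[x i] - p.[x' i]) <= nm (x i.+1 - x' i.+1) + eta * K + E.
    by apply: step => // l li; apply: le_trans (ux l) _; exact: uK.
  have h5 := uK i.+1 (leqnn _); rewrite /u iterS in h5.
  have /andP[r1 r2] := rk i.+1; rewrite iterS in r1 r2.
  set r' := rho p.[iter i P z] in h3 h5 r1 r2.
  have h6 : r' * nm (p.[x i] - p.[x' i]) <= r' * (nm (x i.+1 - x' i.+1) + eta * K + E).
    by apply: ler_wpM2l => //; lra.
  have h7 : r' * (eta * K + E) <= M * (eta * K + E).
    by apply: ler_wpM2r => //; apply: addr_ge0 => //; apply: mulr_ge0.
  have h8 : M * eta * K <= (lam - 1) / 2 * K by apply: ler_wpM2r.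
  have h9 : lam * u i <= (1 + lam) / 2 * K + M * E by rewrite /u; lra.
  have -> : th * K + M * E / lam = ((1 + lam) / 2 * K + M * E) / lam.
    by field; rewrite ?lt0r_neq0//; lra.
  by rewrite ler_pdivlMr; lra.
Qed.

(** The case [eta = E = 0]: quantitative expansivity of [p] on [J]. *)
Lemma julia_orbits_separate z z' n : J z -> J z' ->
  (forall k, (k <= n)%N -> nm (iter k P z' - iter k P z) <= del) ->
  nm (z' - z) <= th ^+ n * B.
Proof.
move=> Jz Jz' near_z; have l1 := exp_lam expn; have M1 := weight_ge1 Jz.
have := @pseudo_orbits_close (fun k => iter k P z') (fun k => iter k P z) z n 0 0 Jz (lexx _) (lexx _).
rewrite !mulr0; move=> /(_ _ _ _ n 0%N (leqnn _)) /=.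
rewrite addr0; apply.
- lra.
- by move=> k kn; rewrite subrr nm0 (ltW (exp_del expn)); split => //; exact: near_z.
- by move=> k K kn _; rewrite mul0r !addr0.
Qed.

Lemma henon_snd a n w : (iter n.+1 (H a) w).2 = a * (iter n (H a) w).1.
Proof. by []. Qed.

Lemma henon_fst a n w :
  (iter n.+1 (H a) w).1 = p.[(iter n (H a) w).1] + a * (iter n (H a) w).2.
Proof. by []. Qed.

Lemma henon_orbits_close a z w w' n : J z -> M * nm a ^+ 2 <= (lam - 1) / 2 ->
  (forall k, (k <= n)%N -> nm ((iter k (H a) w).1 - iter k P z) <= del /\
                           nm ((iter k (H a) w').1 - iter k P z) <= del) ->
  forall j k, (k + j <= n)%N ->
  nm ((iter k (H a) w).1 - (iter k (H a) w').1) <=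
    th ^+ j * B + 2 * M / (lam - 1) * (nm a * nm (w.2 - w'.2)).
Proof.
move=> Jz Ma near_z.
apply: (@pseudo_orbits_close (fun k => (iter k (H a) w).1) (fun k => (iter k (H a) w').1)
  z n (nm a ^+ 2)) => //.
- by rewrite exprn_ge0 ?nm_ge0.
- by rewrite mulr_ge0 ?nm_ge0.
move=> k K kn uK.
have -> : p.[(iter k (H a) w).1] - p.[(iter k (H a) w').1] =
    (iter k.+1 (H a) w).1 - (iter k.+1 (H a) w').1 -
    a * ((iter k (H a) w).2 - (iter k (H a) w').2).
  by rewrite !henon_fst; ring.
apply: le_trans (nmD _ _) _; rewrite nmN nmM -[leRHS]addrA lerD2l.
have a0 := nm_ge0 a.
have K0 : 0 <= K by apply: le_trans (uK 0%N _); rewrite ?nm_ge0.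
(* At time 0 the second coordinates are initial data and give the defect; later they are [a] times
   the previous first coordinates, whence the feedback [nm a ^+ 2]. *)
case: k kn uK => [|k] kn uK.
  by rewrite /= lerDr; apply: mulr_ge0 => //; apply: exprn_ge0.
rewrite !henon_snd -mulrBr nmM mulrA -expr2 -[leLHS]addr0; apply: lerD.
  by apply: ler_wpM2l; [apply: exprn_ge0|apply: uK; rewrite leqW].
by rewrite mulr_ge0 ?nm_ge0.
Qed.

(** Here a Hénon orbit is compared with an exact orbit of [p], and the whole term [a * y] counts as
    defect. *)
Lemma henon_orbit_close a z w n Y : J z -> 0 <= Y ->
  (forall k, (k <= n)%N -> nm ((iter k (H a) w).1 - iter k P z) <= del) ->
  (forall k, (k < n)%N -> nm (iter k (H a) w).2 <= Y) ->
  forall j k, (k + j <= n)%N ->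
  nm ((iter k (H a) w).1 - iter k P z) <=
    th ^+ j * B + 2 * M / (lam - 1) * (nm a * Y).
Proof.
move=> Jz Y0 near_z wY; have l1 := exp_lam expn; have a0 := nm_ge0 a.
apply: (@pseudo_orbits_close (fun k => (iter k (H a) w).1) (fun k => iter k P z)
  z n 0) => //.
- by rewrite mulr_ge0.
- lra.
- by move=> k kn; rewrite subrr nm0 (ltW (exp_del expn)); split => //; exact: near_z.
move=> k K kn _; rewrite mul0r addr0.
have -> : p.[(iter k (H a) w).1] - p.[iter k P z] =
    (iter k.+1 (H a) w).1 - iter k.+1 P z - a * (iter k (H a) w).2.
  by rewrite !henon_fst iterS; ring.
apply: le_trans (nmD _ _) _; rewrite nmN nmM lerD2l.
by apply: ler_wpM2l => //; exact: wY.
Qed.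

End Shadowing.

(** * Local stable sets *)

Section StableGraph.
Variable R : realType.
Local Notation C := (Cplx R).

(* [s] is the size of the shadowing neighbourhood, [r] bounds the second coordinate, [R1] bounds the [del]-neighbourhood of the Julia set and [L] is the second order constant of [p] there. *)
Record frame (p : {poly C}) (d : nat) (rho : C -> R) (M lam del s R1 L r : R) : Prop := Frame {
  fr_monic : p \is monic;
  fr_size : size p = d.+1;
  fr_deg : (2 <= d)%N;
  fr_exp : expansion p rho M lam del;
  fr_M : 1 <= M;
  fr_s : 0 < s;
  fr_sdel : 4 * s <= del;
  fr_R1 : forall z, julia p z -> nm z + del <= R1;
  fr_R1_ge0 : 0 <= R1;
  fr_L0 : 0 <= L;
  fr_L : forall x y z, nm x <= R1 -> nm y <= R1 -> nm z <= R1 ->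
    nm (p.[x] - p.[y] - p^`().[z] * (x - y)) <= L * (nm (x - z) + nm (y - z)) * nm (x - y);
  fr_sL : M * (2 * L * s) <= (lam - 1) / 4;
  fr_r : 0 < r }.

(** [sp_R1] keeps images in the disc of radius [r]; [sp_r] and [sp_lam] respectively make the Newton
    map below preserve its disc and contract; [sp_half] makes the Lipschitz constant 1 of the graphs
    reproduce itself. *)
Record small_param (M lam s R1 r : R) (a : C) : Prop := SmallParam {
  sp_R1 : nm a * R1 <= r;
  sp_r : M * (nm a * r) <= (lam - 1) / 2 * s;
  sp_half : M * nm a <= 1 / 2;
  sp_lam : M * nm a <= (lam - 1) / 4 }.

Variables (p : {poly C}) (d : nat) (rho : C -> R) (M lam del s R1 L r : R).
Hypothesis fr : frame p d rho M lam del s R1 L r.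
Local Notation J := (julia p).
Local Notation P := (horner p).
Local Notation H := (henon p).
Local Notation th := ((1 + lam) / (2 * lam)).
Local Notation B := (2 * M * del).
Local Notation cst := (2 * M / (lam - 1)).
Implicit Types (a x y z : C) (w : C * C) (e : R).

Let pm := fr_monic fr.
Let sp := fr_size fr.
Let d2 := fr_deg fr.
Let expn := fr_exp fr.

Local Ltac constants := have M1 := fr_M fr; have s0 := fr_s fr; have l1 := exp_lam expn;
  have r0 := fr_r fr; have L0 := fr_L0 fr.

Lemma julia_step z : J z -> J p.[z].
Proof. by move/(julia_horner pm sp d2). Qed.

Lemma julia_it n z : J z -> J (iter n P z).
Proof. exact: julia_iter pm sp d2 n z. Qed.

Lemma cst_ge0 : 0 <= cst.
Proof.
constants.
by apply: divr_ge0; lra.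
Qed.

Lemma near_bound z x : J z -> nm (x - z) <= del -> nm x <= R1.
Proof. by move=> /(fr_R1 fr) h xz; have := nm_le_dist x z; lra. Qed.

Section FixedParameter.
Variable a : C.
Hypothesis sm : small_param M lam s R1 r a.

Lemma param_half : nm a <= 1 / 2.
Proof.
constants.
have h := sp_half sm; have a0 := nm_ge0 a.
have : 1 * nm a <= M * nm a by apply: ler_wpM2r.
lra.
Qed.

Lemma param_sqr : M * nm a ^+ 2 <= (lam - 1) / 2.
Proof.
constants.
have h := sp_lam sm; have h2 := param_half; have a0 := nm_ge0 a.
have : M * nm a * nm a <= M * nm a * 1.
  by apply: ler_wpM2l; [apply: mulr_ge0|]; lra.
rewrite expr2 mulrA; lra.
Qed.

(* The simplified Newton map [G x = x - (p x + a y - X (a x)) / p' z] is a half contraction. *)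
Lemma finite_graph_step z (X : C -> C) y : J z -> nm y <= r ->
  (forall v, nm v <= r -> rho p.[z] * nm (X v - p.[z]) <= s) ->
  (forall v v', nm v <= r -> nm v' <= r -> nm (X v - X v') <= nm (v - v')) ->
  exists2 x, rho z * nm (x - z) <= s & p.[x] + a * y = X (a * x).
Proof.
constants.
move=> Jz yr Xs Xlip.
have Jpz := julia_step Jz.
have /andP[r1 r2] := exp_rho expn Jz.
have /andP[r1' r2'] := exp_rho expn Jpz.
have a0 := nm_ge0 a.
have sdel := fr_sdel fr.
have disk x : rho z * nm (x - z) <= s -> nm (x - z) <= s.
  by move=> h; apply: le_trans h; rewrite -[leLHS]mul1r; apply: ler_wpM2r; rewrite ?nm_ge0.
have xR x : rho z * nm (x - z) <= s -> nm x <= R1.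
  by move=> /disk h; apply: near_bound Jz _; lra.
have ax x : rho z * nm (x - z) <= s -> nm (a * x) <= r.
  move=> /xR h; rewrite nmM; apply: le_trans (sp_R1 sm); exact: ler_wpM2l.
have zz : rho z * nm (z - z) <= s by rewrite subrr nm0 mulr0 ltW.
have dl := deriv_lower pm sp d2 expn Jz.
set D := p^`().[z] in dl *.
have D0 : 0 < nm D.
  rewrite lt_neqAle nm_ge0 andbT eq_sym; apply/eqP => D0; rewrite D0 mulr0 in dl; lra.
have D0' : D != 0 by rewrite -nm_gt0.
have hl := exp_deriv expn Jz; rewrite -/D in hl.
have slam := sp_lam sm; have sr := sp_r sm; have sL := fr_sL fr.
pose G x := x - (p.[x] + a * y - X (a * x)) / D.
have DG x : D * (G x - z) = - (p.[x] - p.[z] - D * (x - z)) + (X (a * x) - p.[z]) - a * y.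
  by rewrite /G; field.
have equiv x : nm (x - z) <= s / rho z <-> rho z * nm (x - z) <= s.
  have rz : 0 < rho z by lra.
  by rewrite (ler_pdivlMr _ _ rz) mulrC.
have sr0 : 0 <= s / rho z by apply: divr_ge0; lra.
(* The next graph contributes [s], the curvature and the term [a * y] at most [(lam - 1) * s]
   together; the expansion [lam] brings the sum back to [s]. *)
have Gs x : nm (x - z) <= s / rho z -> nm (G x - z) <= s / rho z.
  move/equiv => xs; apply/equiv.
  have xs' := disk _ xs; have N0 := nm_ge0 (x - z).
  have h1 : nm D * nm (G x - z) <= L * nm (x - z) * nm (x - z) + nm (X (a * x) - p.[z]) + nm a * r.
    rewrite -nmM DG; apply: le_trans (nmD _ _) _; apply: lerD.
      apply: le_trans (nmD _ _) _; rewrite lerD2r nmN.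
      apply: le_trans (fr_L fr (xR _ xs) (xR _ zz) (xR _ zz)) _.
      by rewrite subrr nm0 addr0.
    by rewrite nmN nmM; apply: ler_wpM2l.
  have h2 := Xs _ (ax x xs).
  have G0 := nm_ge0 (G x - z).
  have h3 : rho p.[z] * (nm D * nm (G x - z)) <= rho p.[z] * (L * nm (x - z) * nm (x - z) + nm (X (a * x) - p.[z]) + nm a * r).
    by apply: ler_wpM2l => //; lra.
  have h4 : lam * rho z * nm (G x - z) <= nm D * rho p.[z] * nm (G x - z) by apply: ler_wpM2r.
  have h5 : rho p.[z] * (L * nm (x - z) * nm (x - z) + nm a * r) <= M * (L * s * s + nm a * r).
    have q1 : L * nm (x - z) * nm (x - z) <= L * s * s.
      by apply: ler_pM => //; [apply: mulr_ge0|apply: ler_wpM2l].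
    apply: ler_pM => //; first lra.
      by apply: addr_ge0; rewrite !mulr_ge0//; lra.
    by rewrite lerD2r.
  have h6 : M * (2 * L * s) * s <= (lam - 1) / 4 * s by apply: ler_wpM2r => //; exact: ltW.
  have h6' : 0 <= (lam - 1) * s by apply: mulr_ge0; lra.
  have h7 : lam * (rho z * nm (G x - z)) <= lam * s by lra.
  by move: h7; rewrite ler_pM2l//; lra.
have Gc x x' : nm (x - z) <= s / rho z -> nm (x' - z) <= s / rho z ->
    nm (G x - G x') <= nm (x - x') / 2.
  move=> /equiv xs /equiv x's.
  have N0 := nm_ge0 (x - x').
  have h1 : nm D * nm (G x - G x') <= L * (2 * s) * nm (x - x') + nm a * nm (x - x').
    rewrite -nmM.
    have -> : D * (G x - G x') = - (p.[x] - p.[x'] - D * (x - x')) + (X (a * x) - X (a * x')).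
      by rewrite /G; field.
    apply: le_trans (nmD _ _) _; apply: lerD.
      rewrite nmN; apply: le_trans (fr_L fr (xR _ xs) (xR _ x's) (xR _ zz)) _.
      apply: ler_wpM2r => //; apply: ler_wpM2l => //.
      by have := disk _ xs; have := disk _ x's; lra.
    apply: le_trans (Xlip _ _ (ax _ xs) (ax _ x's)) _.
    by rewrite -mulrBr nmM.
  have h2 : M * (nm D * nm (G x - G x')) <= M * (L * (2 * s) * nm (x - x') + nm a * nm (x - x')).
    by apply: ler_wpM2l => //; lra.
  have h3 : M * (2 * L * s) * nm (x - x') <= (lam - 1) / 4 * nm (x - x') by apply: ler_wpM2r.
  have h4 : M * nm a * nm (x - x') <= (lam - 1) / 4 * nm (x - x') by apply: ler_wpM2r.
  have h5 : lam * nm (G x - G x') <= M * nm D * nm (G x - G x') by apply: ler_wpM2r; rewrite ?nm_ge0.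
  have h6 : lam * nm (G x - G x') <= lam * (nm (x - x') / 2) by lra.
  by move: h6; rewrite ler_pM2l//; lra.
have [x /equiv xs Gx] := half_contraction_fixpoint sr0 Gs Gc.
exists x; first exact: xs.
apply/eqP; rewrite -subr_eq0; apply/eqP.
have : (p.[x] + a * y - X (a * x)) / D = 0.
  have -> : (p.[x] + a * y - X (a * x)) / D = x - G x by rewrite /G subKr.
  by rewrite Gx subrr.
by move/eqP; rewrite mulf_eq0 invr_eq0 (negbTE D0') orbF => /eqP.
Qed.

(* Orbits shadowing that of [z] for [n] steps with prescribed last first coordinate: with [t] on J they produce the stable graph in the limit, with [t] outside the filled Julia set they produce escaping points near it. *)
Lemma finite_graph n z t : J z -> rho (iter n P z) * nm (t - iter n P z) <= s ->
  exists X : C -> C, forall y, nm y <= r ->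
    [/\ rho z * nm (X y - z) <= s,
        forall y', nm y' <= r -> nm (X y - X y') <= nm (y - y'),
        (iter n (H a) (X y, y)).1 = t,
        forall k, (k <= n)%N -> rho (iter k P z) * nm ((iter k (H a) (X y, y)).1 - iter k P z) <= s
      & forall k, (k <= n)%N -> nm (iter k (H a) (X y, y)).2 <= r].
Proof.
constants.
elim: n z => [|n IH] z Jz ts.
  exists (fun=> t) => y yr; split => //.
  - by move=> y' _; rewrite subrr nm0 nm_ge0.
  - by move=> k; rewrite leqn0 => /eqP ->.
  - by move=> k; rewrite leqn0 => /eqP ->.
have Jpz := julia_step Jz.
rewrite iterSr in ts; have [X XP] := IH _ Jpz ts.
have ex y : exists x, nm y <= r -> rho z * nm (x - z) <= s /\ p.[x] + a * y = X (a * x).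
  have [yr|yr] := lerP (nm y) r; last by exists 0.
  have Xs v : nm v <= r -> rho p.[z] * nm (X v - p.[z]) <= s by move=> /XP[].
  have Xl v v' : nm v <= r -> nm v' <= r -> nm (X v - X v') <= nm (v - v').
    by move=> /XP[_ h _ _ _]; exact: h.
  by have [x xs xE] := finite_graph_step Jz yr Xs Xl; exists x.
have [X' X'P] := choice ex.
have a0 := nm_ge0 a.
have hle x : rho z * nm (x - z) <= s -> nm (x - z) <= s.
  have /andP[r1 r2] := exp_rho expn Jz.
  by move=> h; apply: le_trans h; rewrite -[leLHS]mul1r; apply: ler_wpM2r; rewrite ?nm_ge0.
have sdel := fr_sdel fr.
have ax x : rho z * nm (x - z) <= s -> nm (a * x) <= r.
  move=> /hle h; rewrite nmM; apply: le_trans (sp_R1 sm); apply: ler_wpM2l => //.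
  by apply: near_bound Jz _; lra.
exists X' => y yr; have [xs xE] := X'P _ yr.
have axr := ax _ xs; have [q1 q2 q3 q4 q5] := XP _ axr.
have HE : H a (X' y, y) = (X (a * X' y), a * X' y) by rewrite /henon /= xE.
split => //.
(* For the differences [u] of the values and [v] of the arguments, expansion yields
   [u <= u / 2 + v / 2], hence the constant 1 again. *)
- move=> y' y'r; have [x's x'E] := X'P _ y'r.
  have ax'r := ax _ x's.
  have h1 : nm (X' y - z) <= del by have := hle _ xs; lra.
  have h2 : nm (X' y' - z) <= del by have := hle _ x's; lra.
  have h3 := exp_dist expn Jz h1 h2.
  have h4 : nm (p.[X' y] - p.[X' y']) <= nm a * nm (X' y - X' y') + nm a * nm (y - y').
    have -> : p.[X' y] - p.[X' y'] = X (a * X' y) - X (a * X' y') - a * (y - y').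
      by rewrite -xE -x'E; ring.
    apply: le_trans (nmD _ _) _; rewrite nmN nmM lerD2r.
    by apply: le_trans (q2 _ ax'r) _; rewrite -mulrBr nmM.
  have /andP[r1 r2] := exp_rho expn Jz.
  have /andP[r1' r2'] := exp_rho expn Jpz.
  set u := nm (X' y - X' y') in h3 h4 *; have u0 : 0 <= u := nm_ge0 _.
  set v := nm (y - y') in h4 *; have v0 : 0 <= v := nm_ge0 _.
  have h5 : rho p.[z] * nm (p.[X' y] - p.[X' y']) <= M * (nm a * u + nm a * v).
    apply: ler_pM => //; [lra|exact: nm_ge0].
  have h6 : lam * rho z * u >= 1 * u.
    by apply: ler_wpM2r => //; rewrite -[leLHS]mulr1; apply: ler_pM => //; lra.
  have sh := sp_half sm.
  have h7 : M * nm a * u <= 1 / 2 * u by apply: ler_wpM2r.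
  have h8 : M * nm a * v <= 1 / 2 * v by apply: ler_wpM2r.
  lra.
- by rewrite iterSr HE.
- move=> [|k] kn; first exact: xs.
  by rewrite !iterSr HE; exact: q4.
- move=> [|k] kn; first exact: yr.
  by rewrite !iterSr HE; exact: q5.
Qed.

(** The local stable set of [z]. Only first coordinates are compared, since every later second
    coordinate is [a] times a first one. *)
Definition shadow z w := forall k, nm ((iter k (H a) w).1 - iter k P z) <= s.

Lemma shadow_henon z w : shadow z w -> shadow p.[z] (H a w).
Proof. by move=> h k; have := h k.+1; rewrite !iterSr. Qed.

Lemma shadow_iter n z w : shadow z w -> shadow (iter n P z) (iter n (H a) w).
Proof. by elim: n => //= n IH h; apply: shadow_henon; exact: IH. Qed.

Lemma shadow_fst_R1 z w : J z -> shadow z w -> nm w.1 <= R1.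
Proof.
constants.
by move=> Jz /(_ 0%N) /= h; apply: near_bound Jz _; have := fr_sdel fr; lra.
Qed.

Lemma shadow_snd z w n : J z -> shadow z w -> nm w.2 <= r -> nm (iter n (H a) w).2 <= r.
Proof.
constants.
move=> Jz sh wr; case: n => [//|n].
rewrite henon_snd nmM; apply: le_trans (sp_R1 sm).
apply: ler_wpM2l; first exact: nm_ge0.
exact: shadow_fst_R1 (julia_it n Jz) (shadow_iter n sh).
Qed.

(** Points that shadow for [n] steps over the same [y] differ by at most [B * th ^+ n], so they
    converge; the bound at each fixed time passes to the limit by continuity of the iterates. *)
Lemma shadow_exists z y : J z -> nm y <= r -> exists x, shadow z (x, y).
Proof.
constants.
move=> Jz yr; have sdel := fr_sdel fr; have d0 := exp_del expn.
have ex n : exists x, forall k, (k <= n)%N -> nm ((iter k (H a) (x, y)).1 - iter k P z) <= s.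
  have [|X XP] := @finite_graph n z (iter n P z) Jz.
    by rewrite subrr nm0 mulr0 ltW.
  have [_ _ _ h _] := XP y yr; exists (X y) => k /h.
  have /andP[r1 _] := exp_rho expn (julia_it k Jz).
  apply: le_trans; rewrite -[leLHS]mul1r; apply: ler_wpM2r => //; exact: nm_ge0.
have [x xP] := choice ex.
have [x' x'P] : exists x', forall n, nm (x n - x') <= B * th ^+ n.
  apply: geometric_limit; first exact: damping_lt1 expn.
  move=> m n mn.
  have := @henon_orbits_close _ _ _ pm sp d2 _ _ _ _ expn a z (x m, y) (x n, y) m Jz param_sqr.
  move=> /(_ _ m 0%N (leqnn _)) /=; rewrite subrr nm0 !mulr0 addr0 mulrC; apply.
  move=> k km; split; [have := xP m k km|have := xP n k (leq_trans km mn)]; lra.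
exists x' => k; apply/ler_addgt0Pr => e e0.
have [t t0 tP] := henon_iter_continuous p a k (x', y) e0.
have [n nP] := geometric_small B (damping_lt1 expn) t0.
pose m := (n + k)%N.
have xm : nm (x' - x m) < t.
  rewrite nmC; apply: le_lt_trans (x'P m) _; rewrite mulrC; apply: nP; exact: leq_addr.
have yy : nm (y - y) < t by rewrite subrr nm0.
have [h _] := tP (x m, y) xm yy.
have h' := xP m k (leq_addl _ _).
apply: le_trans (nm_tri (iter k (H a) (x m, y)).1 _ _) _; lra.
Qed.

(** As the horizon of [henon_orbits_close] tends to infinity, the damped term disappears and only
    the second coordinates count. *)
Lemma shadow_lipschitz z w w' : J z -> shadow z w -> shadow z w' ->
  nm (w.1 - w'.1) <= cst * (nm a * nm (w.2 - w'.2)).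
Proof.
constants.
move=> Jz sw sw'; apply/ler_addgt0Pr => e e0.
have [n nP] := geometric_small B (damping_lt1 expn) e0.
have sdel := fr_sdel fr.
have := @henon_orbits_close _ _ _ pm sp d2 _ _ _ _ expn a z w w' n Jz param_sqr.
move=> /(_ _ n 0%N (leqnn _)) /=.
have := nP n (leqnn _) => h1 h2.
apply: le_trans (h2 _) _; last by lra.
by move=> k _; have := sw k; have := sw' k; lra.
Qed.

Lemma shadow_close z w Y : J z -> shadow z w -> 0 <= Y ->
  (forall k, nm (iter k (H a) w).2 <= Y) ->
  forall k, nm ((iter k (H a) w).1 - iter k P z) <= cst * (nm a * Y).
Proof.
constants.
move=> Jz sw Y0 wY k; apply/ler_addgt0Pr => e e0.
have [n nP] := geometric_small B (damping_lt1 expn) e0.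
have sdel := fr_sdel fr.
have := @henon_orbit_close _ _ _ pm sp d2 _ _ _ _ expn a z w (k + n) Y Jz Y0.
move=> /(_ _ _ n k (leqnn _)) /=.
have := nP n (leqnn _) => h1 h2.
apply: le_trans (h2 _ _) _ => //; last by lra.
by move=> i _; have := sw i; lra.
Qed.

(** The base orbits are within [e + 2 * s <= del] of each other, and expansivity applies. *)
Lemma shadow_base_close z z' w w' n (e : R) : J z -> J z' -> e <= del / 2 ->
  shadow z w -> shadow z' w' ->
  (forall k, (k <= n)%N -> nm ((iter k (H a) w).1 - (iter k (H a) w').1) <= e) ->
  nm (z' - z) <= th ^+ n * B.
Proof.
constants.
move=> Jz Jz' ed sw sw' ww'.
apply: (julia_orbits_separate pm sp d2 expn) => // k kn.
have := sw k; have := sw' k; have := ww' k kn; have := fr_sdel fr.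
set u := (iter k (H a) w).1; set u' := (iter k (H a) w').1 => h1 h2 h3 h4.
have := nm_tri u' (iter k P z') (iter k P z); have := nm_tri u u' (iter k P z).
rewrite (nmC (iter k P z') u') (nmC u' u); lra.
Qed.

Lemma shadow_base_unique z z' w : J z -> J z' -> shadow z w -> shadow z' w -> z = z'.
Proof.
constants.
move=> Jz Jz' sw sw'; apply/eqP; rewrite eq_sym -subr_eq0; apply/eqP/nm0P/eqP.
rewrite eq_le nm_ge0 andbT; apply/ler_addgt0Pr => e e0; rewrite add0r.
have [n nP] := geometric_small B (damping_lt1 expn) e0.
have d0 := exp_del expn.
apply: le_trans (@shadow_base_close z z' w w n 0 Jz Jz' _ sw sw' _) _; first lra.
  by move=> k _; rewrite subrr nm0.
by apply: ltW; exact: nP.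
Qed.

End FixedParameter.
End StableGraph.

(** * The forward Julia set *)

Section ForwardJulia.
Variables (R : realType) (p : {poly Cplx R}) (R0 : R).
Local Notation C := (Cplx R).
Local Notation P := (horner p).
Local Notation H := (henon p).
Hypotheses (R0_gt0 : 0 < R0) (growth : forall z, R0 <= nm z -> 2 * nm z <= nm p.[z]).
Implicit Types (x y z : C) (w : C * C) (e : R).

Lemma KplusP (a : C) w : Kplus p a w <->
  exists B : R, forall n, nm (iter n (H a) w).1 <= B /\ nm (iter n (H a) w).2 <= B.
Proof.
by rewrite /Kplus /= bounded_orbitP; split=> -[B h]; exists B => n;
  apply/nm2_le; apply: h.
Qed.

Lemma Kplus_iter (a : C) n w : Kplus p a (iter n (H a) w) <-> Kplus p a w.
Proof.
elim: n => [//|n IH]; rewrite -IH iterS; set u := iter n _ w.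
rewrite !KplusP; split=> -[B h]; last first.
  by exists B => k; have := h k.+1; rewrite iterSr.
exists (Num.max B (Num.max (nm u.1) (nm u.2))) => -[|k].
  by rewrite /= !le_max !lexx !orbT.
by have := h k; rewrite -iterSr !le_max => -[-> ->].
Qed.

(** Strict inequalities make the region open, so that reaching it is stable under perturbation. *)
Definition escaping w := R0 < nm w.1 /\ nm w.2 < nm w.1.

Lemma uniform_perturbation N (B e : R) : 0 < B -> 0 < e ->
  exists2 a1 : R, 0 < a1 & forall a : C, nm a < a1 -> forall w,
    nm w.1 <= B -> nm w.2 <= B ->
    nm ((iter N (H a) w).1 - iter N P w.1) <= e /\ nm (iter N (H a) w).2 <= B.
Proof.
move=> B0.
have bd k : exists2 D : R, 0 <= D & forall x, nm x <= B -> nm (iter k P x) <= D.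
  elim: k => [|k [D D0 IH]]; first by exists B => //; exact: ltW.
  have [D' D'0 pD] := horner_bounded p D; exists D' => // x /IH; exact: pD.
elim: N e => [|N IH] e e0.
  by exists 1 => // a _ w w1 w2; rewrite /= subrr nm0 ltW.
have [D D0 bD] := bd N; have [L L0 pL] := horner_lipschitz p (D + 1).
have e'0 : 0 < Num.min 1 (e / (2 * (L + 1))).
  by rewrite lt_min ltr01 divr_gt0//; lra.
have [a1 a10 h] := IH _ e'0.
(* The bounds serve the induction hypothesis, the term [a * y], and the size of the next second
   coordinate. *)
exists (Num.min a1 (Num.min (e / (2 * B)) (B / (D + 1)))).
  by rewrite !lt_min a10 !divr_gt0//; lra.
move=> a; rewrite !lt_min => /andP[aa1 /andP[ae aB]] w w1 w2.
have {h} [h1 h2] := h a aa1 w w1 w2; rewrite le_min in h1.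
case/andP: h1 => h1 h1'; have bDw := bD _ w1.
rewrite iterS [iter N.+1 P _]iterS.
set u := iter N (H a) w in h1 h1' h2 *; set v := iter N P w.1 in h1 h1' bDw *.
have uD : nm u.1 <= D + 1 by have := nm_le_dist u.1 v; lra.
have a0 := nm_ge0 a.
split; rewrite /henon /=.
  have -> : p.[u.1] + a * u.2 - p.[v] = (p.[u.1] - p.[v]) + a * u.2 by ring.
  apply: le_trans (nmD _ _) _; rewrite nmM.
  have h3 : nm (p.[u.1] - p.[v]) <= L * nm (u.1 - v) by apply: pL => //; lra.
  have h4 : nm a * nm u.2 <= nm a * B by apply: ler_wpM2l.
  rewrite ltr_pdivlMr in ae; last lra.
  rewrite ler_pdivlMr in h1'; last lra.
  have := nm_ge0 (u.1 - v); lra.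
rewrite nmM; apply: le_trans (_ : nm a * (D + 1) <= _); first exact: ler_wpM2l.
by rewrite ltr_pdivlMr in aB; lra.
Qed.

Section FixedParameter.
Variable a : C.
Hypotheses (a0 : a != 0) (ah : nm a <= 1 / 2).

Lemma escaping_henon w : escaping w ->
  escaping (H a w) /\ 3 / 2 * nm w.1 <= nm (H a w).1.
Proof.
have R0' := R0_gt0; have ah' := ah.
move=> [w1 w2]; rewrite /escaping /henon /=.
have := growth (ltW w1); have h := nm_le_dist p.[w.1] (p.[w.1] + a * w.2).
rewrite opprD addrA subrr add0r nmN nmM in h => g.
have n0 := nm_ge0 a; have m1 := nm_ge0 w.1; have m2 := nm_ge0 w.2.
have q1 : nm a * nm w.2 <= 1 / 2 * nm w.1 by apply: ler_pM => //; exact: ltW.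
have q2 : nm a * nm w.1 <= 1 / 2 * nm w.1 by apply: ler_wpM2r.
rewrite nmM; split; last lra.
by split; lra.
Qed.

(** An orbit that never meets the escaping region stays below the maximum of [R0] and its initial
    coordinates: a first coordinate above that bound would dominate the second, which is still below
    it. *)
Lemma not_Kplus w : ~ Kplus p a w <-> exists n, escaping (iter n (H a) w).
Proof.
have R0' := R0_gt0; have ah' := ah.
split.
  move=> nK; apply: contrapT => nE; apply: nK; apply/KplusP.
  exists (Num.max R0 (Num.max (nm w.1) (nm w.2))).
  set B := Num.max _ _.
  have B0 : 0 <= B by rewrite le_max ltW.
  have BR : R0 <= B by rewrite le_max lexx.
  have Bw : nm w.1 <= B /\ nm w.2 <= B by rewrite /B !le_max !lexx !orbT.
  clearbody B; elim=> [//|n [h1 h2]].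
  have y1 : nm (iter n.+1 (H a) w).2 <= B.
    rewrite henon_snd nmM -[leRHS]mul1r; apply: ler_pM; rewrite ?nm_ge0//; first lra.
  split => //; rewrite leNgt; apply/negP => h; apply: nE; exists n.+1.
  by split; lra.
move=> [n En]; rewrite -(Kplus_iter a n) KplusP; set u := iter n _ w in En *.
move=> [B HB].
(* The factor [3 / 2] adds at least [R0 / 2] per step; linear growth contradicts boundedness. *)
have gt m : escaping (iter m (H a) u) /\ (m.+2%:R / 2) * R0 <= nm (iter m (H a) u).1.
  elim: m => [|m [IH1 IH2]].
    by split => //; rewrite divff ?mul1r ?pnatr_eq0//=; case: En => /ltW.
  have [h1 h2] := escaping_henon IH1.
  split; rewrite iterS //.
  have : (m.+3%:R : R) = m.+2%:R + 1 by rewrite -addn1 natrD.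
  move=> ->; case: IH1 => h3 _; lra.
have := archi_boundP (normr_ge0 (2 * B / R0)); set m := Num.bound _ => mb.
have := le_trans (proj2 (gt m)) (proj1 (HB m)).
have : 2 * B / R0 < m%:R by apply: le_lt_trans mb; exact: ler_norm.
rewrite ltr_pdivrMr// => h1 h2.
have : (m.+2%:R : R) = m%:R + 2 by rewrite -addn2 natrD.
by move=> mE; rewrite mE in h2; lra.
Qed.

Lemma not_Kplus_open w : ~ Kplus p a w -> exists2 e, 0 < e &
  forall w', nm (w.1 - w'.1) < e -> nm (w.2 - w'.2) < e -> ~ Kplus p a w'.
Proof.
have R0' := R0_gt0; have ah' := ah.
move=> /not_Kplus[n]; set u := iter n _ w => -[u1 u2].
pose e0 := Num.min (nm u.1 - R0) ((nm u.1 - nm u.2) / 2).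
have e00 : 0 < e0 by rewrite lt_min; apply/andP; split; lra.
have [e ee h] := henon_iter_continuous p a n w e00.
exists e => // w' h1 h2; apply/not_Kplus; exists n.
have {h} [] := h w' h1 h2; rewrite -/u; set v := iter n _ w'.
rewrite !lt_min => /andP[q1 q2] /andP[q3 q4]; split.
  by have := nm_le_dist u.1 v.1; lra.
by have := nm_le_dist u.1 v.1; have := nm_le_dist v.2 u.2; rewrite (nmC v.2); lra.
Qed.

Lemma JplusP w : Jplus p a w <-> Kplus p a w /\ forall e, 0 < e ->
  exists w', [/\ nm (w.1 - w'.1) < e, nm (w.2 - w'.2) < e & ~ Kplus p a w'].
Proof.
have R0' := R0_gt0; have ah' := ah.
case: w => x y; split.
  move=> [cK iK]; split.
    apply: contrapT => nK; have [e e0 h] := not_Kplus_open nK.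
    have /cK [[x' y'] [K' /= [h1 h2]]] : nbhs (x, y) [set w' : C * C | nm (x - w'.1) < e /\ nm (y - w'.2) < e].
      by apply/nbhs2_nmP; exists e.
    by apply: h K'.
  move=> e e0; apply: contrapT => h; apply: iK; apply/nbhs2_nmP; exists e => // x' y' h1 h2.
  by apply: contrapT => nK; apply: h; exists (x', y').
move=> [Kw h]; split; first exact: subset_closure.
move=> /nbhs2_nmP[e e0 eK]; have [[x' y'] [h1 h2 nK]] := h e e0.
by apply: nK; exact: eK.
Qed.

Lemma henon_inv_continuous w e : 0 < e -> exists2 t : R, 0 < t & forall w',
  nm (w.1 - w'.1) < t -> nm (w.2 - w'.2) < t ->
  nm ((henon_inv p a w).1 - (henon_inv p a w').1) < e /\
  nm ((henon_inv p a w).2 - (henon_inv p a w').2) < e.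
Proof.
move=> e0; have na : 0 < nm a by rewrite nm_gt0.
have [L L0 pL] := horner_lipschitz p (nm (w.2 / a) + 1).
pose t := Num.min (nm a * Num.min 1 e) (nm a * e / 2 / (1 + L / nm a)).
have Ln : 0 <= L / nm a by apply: divr_ge0 => //; exact: ltW.
exists t.
  rewrite lt_min mulr_gt0 ?lt_min ?ltr01 ?e0//= divr_gt0//; last lra.
  by rewrite divr_gt0// mulr_gt0.
move=> w'; rewrite !lt_min => /andP[_ h1] /andP[h2 h3].
have yE : nm (w.2 / a - w'.2 / a) = nm (w.2 - w'.2) / nm a by rewrite -mulrBl nmM nmV.
have h4 : nm (w.2 / a - w'.2 / a) < Num.min 1 e by rewrite yE ltr_pdivrMr// mulrC.
rewrite lt_min in h4; case/andP: h4 => h4 h5.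
rewrite /henon_inv /=; split => //.
rewrite -mulrBl nmM nmV ltr_pdivrMr//.
have -> : w.1 - p.[w.2 / a] - (w'.1 - p.[w'.2 / a]) =
  (w.1 - w'.1) - (p.[w.2 / a] - p.[w'.2 / a]) by ring.
apply: le_lt_trans (nmD _ _) _; rewrite nmN.
have h6 : nm (p.[w.2 / a] - p.[w'.2 / a]) <= L / nm a * nm (w.2 - w'.2).
  rewrite mulrAC -mulrA -yE; apply: pL; first by lra.
  by have := nm_le_dist (w'.2 / a) (w.2 / a); rewrite nmC; lra.
rewrite ltr_pdivlMr in h1; last lra.
rewrite ltr_pdivlMr in h3; last lra.
have := nm_ge0 (w.1 - w'.1); have := nm_ge0 (w.2 - w'.2) => p2 p1.
have := mulr_ge0 Ln p1; have := mulr_ge0 Ln p2; lra.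
Qed.

Lemma Jplus_henon w : Jplus p a (H a w) <-> Jplus p a w.
Proof.
have R0' := R0_gt0; have ah' := ah.
rewrite !JplusP (Kplus_iter a 1 w); split=> -[Kw h]; (split; first exact: Kw) => e e0.
  have [t t0 tP] := henon_inv_continuous (H a w) e0.
  have [w' [h1 h2 h3]] := h t t0; exists (henon_inv p a w').
  have [q1 q2] := tP w' h1 h2; rewrite (henonK p a0) in q1 q2.
  split; [exact: q1|exact: q2|].
  by rewrite -(Kplus_iter a 1) /= (henon_invK p a0).
have [t t0 tP] := henon_iter_continuous p a 1 w e0.
have [w' [h1 h2 h3]] := h t t0; exists (H a w').
have [q1 q2] := tP w' h1 h2; split; [exact: q1|exact: q2|].
by rewrite (Kplus_iter a 1).
Qed.

Lemma Jplus_iter n w : Jplus p a (iter n (H a) w) <-> Jplus p a w.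
Proof. by elim: n => [//|n IH]; rewrite iterS Jplus_henon. Qed.

(** As long as the first coordinate exceeds [R0], not escaping forces it below the second one, which
    is [a] times the previous first coordinate; so it is halved at each step and must come down. *)
Lemma Kplus_eventually r w : nm a * R0 <= r -> r <= R0 -> Kplus p a w ->
  exists n, nm (iter n (H a) w).1 <= R0 /\ nm (iter n (H a) w).2 <= r.
Proof.
have R0' := R0_gt0; have ah' := ah.
move=> ar rR Kw.
have nE n : nm (iter n (H a) w).1 <= R0 \/ nm (iter n (H a) w).1 <= nm (iter n (H a) w).2.
  have [h|h] := lerP (nm (iter n (H a) w).1) R0; first by left.
  right; rewrite leNgt; apply/negP => h'.
  have : ~ ~ Kplus p a w by move/(_ Kw).
  by apply; apply/not_Kplus; exists n.
have [n nP] : exists n, nm (iter n (H a) w).1 <= R0.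
  apply: contrapT => h.
  have big n : R0 < nm (iter n (H a) w).1.
    by rewrite ltNge; apply/negP => h'; apply: h; exists n.
  have dec n : nm (iter n (H a) w).1 <= (1 / 2) ^+ n * nm w.1.
    elim: n => [|n IH]; first by rewrite expr0 mul1r.
    case: (nE n.+1) => [|h']; first by have := big n.+1; lra.
    apply: le_trans h' _; rewrite henon_snd nmM exprS -mulrA.
    by apply: ler_pM => //; exact: nm_ge0.
  have h01 : 0 <= (1 / 2 : R) < 1 by lra.
  have [n nP] := geometric_small (nm w.1) h01 R0_gt0.
  by have := nP n (leqnn _); have := dec n; have := big n; lra.
(* At the entrance time the second coordinate may still be large; it is small one step later. *)
have yr : nm (iter n.+1 (H a) w).2 <= r.
  by rewrite henon_snd nmM; apply: le_trans ar; apply: ler_wpM2l; rewrite ?nm_ge0.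
exists n.+1; split => //.
by case: (nE n.+1) => //; lra.
Qed.

Lemma Kplus_bounded r w n : nm a * R0 <= r -> r <= R0 -> Kplus p a w ->
  nm w.1 <= R0 -> nm w.2 <= r ->
  nm (iter n (H a) w).1 <= R0 /\ nm (iter n (H a) w).2 <= r.
Proof.
have R0' := R0_gt0; have ah' := ah.
move=> ar rR Kw w1 w2; elim: n => [//|n [h1 h2]].
have yr : nm (iter n.+1 (H a) w).2 <= r.
  by rewrite henon_snd nmM; apply: le_trans ar; apply: ler_wpM2l; rewrite ?nm_ge0.
split => //; rewrite leNgt; apply/negP => h.
have : ~ ~ Kplus p a w by move/(_ Kw).
by apply; apply/not_Kplus; exists n.+1; split; lra.
Qed.

End FixedParameter.
End ForwardJulia.

(** * Trapping, escape and shadowing near the Julia set *)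

Section LocalJulia.
Variable R : realType.
Local Notation C := (Cplx R).
Variables (p : {poly C}) (d : nat) (rho : C -> R) (M lam del s R1 L r R0 t : R).
Hypothesis fr : frame p d rho M lam del s R1 L r.
Local Notation J := (julia p).
Local Notation K := (filled_julia p).
Local Notation P := (horner p).
Local Notation H := (henon p).
Local Notation th := ((1 + lam) / (2 * lam)).
Local Notation B := (2 * M * del).
Implicit Types (a x y z : C) (w : C * C) (e : R).

(** [t] is the weighted radius of the neighbourhood of [J] used for trapping. [ef_del] makes the
    Hölder bound on preimages land within [del], where the expansion holds. *)
Record escape_frame : Prop := EscapeFrame {
  ef_R0 : 1 <= R0;
  ef_growth : forall z, R0 <= nm z -> 2 * nm z <= nm p.[z];
  ef_R1 : R1 + 1 <= R0;
  ef_r : r < R0;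
  ef_t : 0 < t <= s;
  ef_del : lam * t <= del ^+ d }.

Hypothesis ef : escape_frame.

Local Ltac constants := have pm := fr_monic fr; have sp := fr_size fr; have d2 := fr_deg fr;
  have expn := fr_exp fr; have M1 := fr_M fr; have s0 := fr_s fr; have l1 := exp_lam (fr_exp fr);
  have r0 := fr_r fr; have L0 := fr_L0 fr; have d0 := exp_del expn; have sdel := fr_sdel fr;
  have R01 := ef_R0 ef; have R00 : 0 < R0 := lt_le_trans ltr01 R01; have growth := ef_growth ef; have R10 := ef_R1 ef;
  have rR := ef_r ef; have /andP[t0 ts] := ef_t ef; have tdel := ef_del ef.

(** With the weight [rho], pulling back by [p] shrinks [q] to [q / lam], with no multiplicative
    constant lost. *)
Definition julia_nbhd (q : R) x := exists2 z, J z & rho z * nm (x - z) < q.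

Lemma julia_nbhd_preimage z v x (q e : R) : J z -> rho z * nm (v - z) < q ->
  nm (p.[x] - v) <= e -> q + M * e <= del ^+ d ->
  exists2 z', J z' & p.[z'] = z /\ lam * (rho z' * nm (x - z')) < q + M * e.
Proof.
constants; move=> Jz wz xw qe.
have /andP[r1 r2] := exp_rho expn Jz.
have h1 : rho z * nm (p.[x] - z) < q + M * e.
  apply: (@le_lt_trans _ _ (rho z * nm (v - z) + M * e)); last by rewrite ltrD2r.
  have e0 : 0 <= e := le_trans (nm_ge0 _) xw.
  apply: (@le_trans _ _ (rho z * nm (v - z) + rho z * e)).
    rewrite -mulrDr; apply: ler_wpM2l; first lra.
    by apply: le_trans (nm_tri v _ _) _; rewrite addrC lerD2l.
  by rewrite lerD2l; apply: ler_wpM2r.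
have [z' pz' [Jz' xz']] := julia_preimage pm sp d2 x Jz.
have near : nm (x - z') < del.
  have dd : (0 < d)%N by exact: ltnW.
  rewrite -(ltr_pXn2r dd) ?nnegrE ?nm_ge0 ?(ltW d0)//.
  apply: le_lt_trans xz' _; apply: lt_le_trans qe; apply: le_lt_trans h1.
  by rewrite -[leLHS]mul1r; apply: ler_wpM2r; rewrite ?nm_ge0.
exists z'; first exact: Jz'.
split; first exact: pz'.
have zz : nm (z' - z') <= del by rewrite subrr nm0 ltW.
have := exp_dist expn Jz' (ltW near) zz; rewrite pz' mulrA.
by move=> h; apply: le_lt_trans h1.
Qed.

Lemma julia_nbhd_open (q : R) : open [set x | julia_nbhd q x].
Proof.
constants; rewrite openE => x [z Jz xz]; apply/nbhs_nmP.
have /andP[r1 r2] := exp_rho expn Jz.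
exists ((q - rho z * nm (x - z)) / rho z); first by rewrite divr_gt0//; lra.
move=> y; rewrite ltr_pdivlMr; last lra.
move=> h; exists z; first exact: Jz.
have : rho z * nm (y - z) <= rho z * (nm (x - y) + nm (x - z)).
  by apply: ler_wpM2l; [lra|rewrite (nmC x y); exact: nm_tri].
lra.
Qed.

(** If [v] were in the smaller neighbourhood of [J], pulling back would put [x] there. If [v] were
    outside [K], the segment from [p.[x]] to [v] would meet [J] within [e] of [p.[x]], with the same
    contradiction. *)
Lemma filled_or_far_step x v e : K x -> ~ julia_nbhd (t / lam) x ->
  nm (p.[x] - v) <= e -> lam * (M * e) <= (lam - 1) * t ->
  K v /\ ~ julia_nbhd (t / lam) v.
Proof.
constants; move=> Kx far xw et.
have l0 : lam != 0 by rewrite lt0r_neq0//; lra.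
have tlam : lam * (t / lam) = t by rewrite mulrC divfK.
have Met : M * e <= (lam - 1) * (t / lam).
  have lp : 0 < lam by lra.
  have : lam * (M * e) <= lam * ((lam - 1) * (t / lam)) by rewrite [leRHS]mulrCA tlam.
  by rewrite ler_pM2l.
have tld : t / lam + M * e <= t.
  by apply: le_trans (lerD (lexx _) Met) _; lra.
have ltd : t <= del ^+ d.
  have : 1 * t <= lam * t by apply: ler_wpM2r; lra.
  lra.
have notnear z q e' : J z -> nm (p.[x] - q) <= e' -> rho z * nm (q - z) < t / lam ->
    M * e' <= (lam - 1) * (t / lam) -> False.
  move=> Jz xq qz Me'.
  have h : t / lam + M * e' <= del ^+ d by apply: le_trans (lerD (lexx _) Me') _; lra.
  have [z' Jz' [_ h']] := julia_nbhd_preimage Jz qz xq h.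
  apply: far; exists z'; first exact: Jz'.
  rewrite ltr_pdivlMr; lra.
split; last by move=> [z Jz wz]; exact: (notnear z v e).
have Kpx : K p.[x] by apply/(filled_horner p).
apply: contrapT => nK.
have [z Jz zx] := boundary_between Kpx nK.
have tl0 : 0 < t / lam by apply: divr_gt0; [exact: t0|lra].
apply: (notnear z z e Jz); [|by rewrite subrr nm0 mulr0|exact: Met].
by rewrite nmC; apply: le_trans zx _; rewrite nmC.
Qed.

Lemma filled_bound x : K x -> nm x <= R0.
Proof.
constants; move=> Kx; rewrite leNgt; apply/negP => h.
by move: Kx; apply/(filled_escape R00 growth); exists 0%N.
Qed.

Definition escaping_base x := [/\ nm x <= R0, ~ K x & ~ julia_nbhd t x].

(** The margin 1 above [R0] pays for replacing [p] by the Hénon map. *)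
Lemma escaping_base_uniform :
  exists N, forall x, escaping_base x -> R0 + 1 < nm (iter N P x).
Proof.
constants.
(* The complement of the interior of [K] is taken because it is closed; away from [J] it agrees with
   the complement of [K]. *)
pose E := [set x | nm x <= R0] `&` ~` [set x | julia_nbhd t x] `&` ~` interior K.
have cE : compact E.
  apply: (@compact_nm_le _ R0); last by move=> x [[]].
  apply: closedI; first apply: closedI.
  - rewrite -[X in closed X]setCK; apply: open_closedC.
    have -> : ~` [set x : C | nm x <= R0] = [set x | R0 < nm (iter 0 P x)].
      by apply/seteqP; split => x /=; rewrite ltNge => /negP.
    exact: open_iter_gt.
  - by apply: open_closedC; exact: julia_nbhd_open.
  - by apply: open_closedC; exact: open_interior.
have EK x : E x -> ~ K x.
  move=> [[_ far] nI] Kx; apply: far; exists x; last by rewrite subrr nm0 mulr0.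
  by split; [exact: subset_closure|exact: nI].
have grow n x : R0 + 1 < nm (iter n P x) -> R0 + 1 < nm (iter n.+1 P x).
  by move=> h; rewrite iterS; have := growth (iter n P x); lra.
have cover : E `<=` \bigcup_n [set x | R0 + 1 < nm (iter n P x)].
  move=> x /EK /(filled_escape R00 growth)[n h]; exists n.+1 => //=.
  have := growth (iter n P x); lra.
have [N NP] := compact_increasing cE (fun n => @open_iter_gt R p n (R0 + 1)) grow cover.
exists N => x [xR nK far]; apply: NP; split; first split; [exact: xR|exact: far|].
by move=> /interior_subset.
Qed.

Lemma escaping_near_julia_uniform :
  exists N, forall z, J z -> exists2 x, M * nm (x - z) < s & R0 + 1 < nm (iter N P x).
Proof.
constants.
have grow n x : R0 + 1 < nm (iter n P x) -> R0 + 1 < nm (iter n.+1 P x).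
  by move=> h; rewrite iterS; have := growth (iter n P x); lra.
pose U n := [set z | exists2 x, M * nm (x - z) < s & R0 + 1 < nm (iter n P x)].
have oU n : open (U n).
  rewrite openE => z [x xz xn]; apply/nbhs_nmP.
  exists ((s - M * nm (x - z)) / M); first by rewrite divr_gt0//; lra.
  move=> y; rewrite ltr_pdivlMr; last lra.
  move=> h; exists x => //.
  have : M * nm (x - y) <= M * (nm (x - z) + nm (z - y)).
    by apply: ler_wpM2l; [lra|exact: nm_tri].
  lra.
have iU n : U n `<=` U n.+1 by move=> z [x xz xn]; exists x => //; exact: grow.
have cover : J `<=` \bigcup_n U n.
  move=> z /(juliaP pm sp d2)[_ h].
  have sM : 0 < s / M by rewrite divr_gt0//; lra.
  have [x xz /(filled_escape R00 growth)[n xn]] := h _ sM.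
  exists n.+1 => //; exists x.
    by move: xz; rewrite ltr_pdivlMr; [rewrite nmC mulrC|lra].
  by have := growth (iter n P x); rewrite iterS; lra.
have [N NP] := compact_increasing (julia_compact pm sp d2) oU iU cover.
by exists N => z /NP.
Qed.

Record escape_param a : Prop := EscapeParam {
  ep_neq0 : a != 0;
  ep_R0 : nm a * R0 <= r;
  ep_trap : lam * (M * (nm a * R0)) <= (lam - 1) * t;
  ep_base : forall w, escaping_base w.1 -> nm w.2 <= R0 -> ~ Kplus p a w;
  ep_near : forall z, J z -> exists2 x, M * nm (x - z) < s &
    forall y, nm y <= R0 -> ~ Kplus p a (x, y) }.

Lemma escape_param_exists : exists2 a1 : R, 0 < a1 &
  forall a, 0 < nm a < a1 -> escape_param a.
Proof.
constants.
have [N NP] := escaping_base_uniform.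
have [N' NP'] := escaping_near_julia_uniform.
have [a1 a10 h1] := uniform_perturbation p N R00 ltr01.
have [a2 a20 h2] := uniform_perturbation p N' R00 ltr01.
have lp : 0 < lam by lra.
pose a3 := Num.min (1 / 2) (Num.min (r / R0) ((lam - 1) * t / (lam * M * R0))).
have a30 : 0 < a3.
  rewrite /a3 !lt_min; apply/and3P; split; first lra.
    by rewrite divr_gt0.
  by apply: divr_gt0; rewrite !mulr_gt0//; lra.
exists (Num.min a1 (Num.min a2 a3)).
  by rewrite lt_min a10 lt_min a20 a30.
move=> a; rewrite /a3 !lt_min => /and4P[a0 aa1 aa2 /and3P[ah ar at_]].
have a_neq0 : a != 0 by rewrite -nm_gt0.
have ah' : nm a <= 1 / 2 := ltW ah.
split => //.
- by move: ar; rewrite ltr_pdivlMr// => /ltW.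
- have q : 0 < lam * M * R0 by rewrite !mulr_gt0//; lra.
  move: at_; rewrite ltr_pdivlMr//; lra.
- move=> w Ew w2; case: (Ew) => w1 _ _; have := NP _ Ew.
  have [q1 q2] := h1 a aa1 w w1 w2 => q3.
  apply/(not_Kplus R00 growth ah'); exists N.
  have := nm_le_dist (iter N P w.1) (iter N (H a) w).1; rewrite nmC => q4.
  by split; lra.
- move=> z Jz; have [x xz xN] := NP' z Jz; exists x => // y yR.
  have xR : nm x <= R0.
    have := nm_le_dist x z; have := fr_R1 fr Jz; have := nm_ge0 (x - z) => n0 q1 q2.
    have : 1 * nm (x - z) <= M * nm (x - z) by apply: ler_wpM2r.
    lra.
  have [q1 q2] := h2 a aa2 (x, y) xR yR.
  apply/(not_Kplus R00 growth ah'); exists N'.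
  have := nm_le_dist (iter N' P x) (iter N' (H a) (x, y)).1; rewrite nmC => q4.
  by split; move: q1 => /= q1; lra.
Qed.

Section FixedParameter.
Variable a : C.
Hypotheses (sm : small_param M lam s R1 r a) (ep : escape_param a).

Local Ltac constants' := constants; have ah := param_half fr sm; have a0 := ep_neq0 ep;
  have na := nm_ge0 a; have aR := ep_R0 ep; have trap := ep_trap ep.

Lemma Kplus_of_filled w : K w.1 -> ~ julia_nbhd (t / lam) w.1 -> nm w.2 <= R0 ->
  Kplus p a w.
Proof.
constants'; move=> Kw far w2.
have inv n : [/\ K (iter n (H a) w).1, ~ julia_nbhd (t / lam) (iter n (H a) w).1
    & nm (iter n (H a) w).2 <= R0].
  elim: n => [|n [q1 q2 q3]]; first by split.
  have yR : nm (iter n.+1 (H a) w).2 <= R0.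
    rewrite henon_snd nmM.
    have : nm a * nm (iter n (H a) w).1 <= nm a * R0.
      by apply: ler_wpM2l => //; exact: filled_bound.
    lra.
  have e1 : nm (p.[(iter n (H a) w).1] - (iter n.+1 (H a) w).1) <= nm a * R0.
    rewrite henon_fst opprD addrA subrr add0r nmN nmM.
    exact: ler_wpM2l.
  have [q4 q5] := filled_or_far_step q1 q2 e1 trap.
  by split; [exact: q4|exact: q5|exact: yR].
apply/KplusP; exists R0 => n; have [q1 _ q3] := inv n.
by split; [exact: filled_bound|exact: q3].
Qed.

Lemma Jplus_fst_near w : Jplus p a w -> nm w.1 <= R0 -> nm w.2 <= r ->
  julia_nbhd t w.1.
Proof.
constants'; move=> /(JplusP R00 growth ah)[Kw nint] w1 w2.
apply: contrapT => far.
have [Kb|nKb] := pselect (K w.1); last first.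
  apply: (ep_base ep _ _ Kw); last lra.
  by split; [exact: w1|exact: nKb|exact: far].
have lp : 0 < lam by lra.
(* Since [w] is outside the neighbourhood of radius [t], the first bound keeps [w'] outside that of
   radius [t / lam] and the segment between them away from [J]; the second keeps the second
   coordinate below [R0]. *)
pose e := Num.min ((t - t / lam) / M) (R0 - r).
have tl : t / lam < t by rewrite ltr_pdivrMr// -[ltLHS]mulr1 ltr_pM2l.
have e0 : 0 < e by rewrite lt_min; apply/andP; split; [apply: divr_gt0; lra|lra].
have [w' [h1 h2]] := nint e e0; apply.
move: h1 h2; rewrite !lt_min => /andP[h1 _] /andP[_ h2].
rewrite ltr_pdivlMr in h1; last lra.
have notnear z v : J z -> nm (w.1 - v) <= nm (w.1 - w'.1) -> rho z * nm (v - z) < t / lam -> False.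
  move=> Jz wv vz; apply: far; exists z; first exact: Jz.
  have /andP[r1 r2] := exp_rho expn Jz.
  have q1 : rho z * nm (w.1 - z) <= rho z * (nm (w.1 - v) + nm (v - z)).
    by apply: ler_wpM2l; [lra|exact: nm_tri].
  have q2 : rho z * nm (w.1 - v) <= M * nm (w.1 - w'.1).
    by apply: ler_pM => //; [lra|exact: nm_ge0].
  lra.
apply: Kplus_of_filled.
- apply: contrapT => nK'; have [z Jz zw] := boundary_between Kb nK'.
  apply: (@notnear z z Jz); first by rewrite nmC (nmC _ w'.1).
  by rewrite subrr nm0 mulr0 divr_gt0.
- by move=> [z Jz wz]; exact: (notnear z w'.1).
- by have := nm_le_dist w'.2 w.2; rewrite nmC; lra.
Qed.

(** The shadowing lemma: pulling back along the orbit gives points of [J] that shadow for [n] steps,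
    and expansivity makes them converge. *)
Lemma shadow_of_nbhd w : (forall n, julia_nbhd t (iter n (H a) w).1) ->
  (forall n, nm (iter n (H a) w).2 <= R0) -> exists2 z, J z & shadow p s a z w.
Proof.
constants'; move=> wN wR.
have Mat : M * (nm a * R0) <= (lam - 1) * t.
  apply: le_trans trap; rewrite -[leLHS]mul1r; apply: ler_wpM2r; last lra.
  by apply: mulr_ge0; [lra|apply: mulr_ge0 => //; lra].
have ex n : forall w, (forall n, julia_nbhd t (iter n (H a) w).1) ->
   (forall n, nm (iter n (H a) w).2 <= R0) -> exists2 z, J z &
    forall k, (k <= n)%N -> rho (iter k P z) * nm ((iter k (H a) w).1 - iter k P z) < t.
  elim: n => [|n IH] {wN wR}w wN wR.
    by have [z Jz wz] := wN 0%N; exists z => // k; rewrite leqn0 => /eqP ->.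
  have [||z Jz zP] := IH (H a w).
  - by move=> m; rewrite -iterSr; exact: wN.
  - by move=> m; rewrite -iterSr; exact: wR.
  have e1 : nm (p.[w.1] - (H a w).1) <= nm a * R0.
    rewrite /henon /= opprD addrA subrr add0r nmN nmM.
    by apply: ler_wpM2l => //; exact: (wR 0%N).
  have qe : t + M * (nm a * R0) <= del ^+ d by lra.
  have [z' Jz' [pz' h]] := julia_nbhd_preimage Jz (zP 0%N (leq0n _)) e1 qe.
  exists z'; first exact: Jz'.
  case=> [_|k kn]; last by rewrite !iterSr pz'; exact: zP.
  have : lam * (rho z' * nm (w.1 - z')) < lam * t by lra.
  by rewrite ltr_pM2l//; lra.
have ex2 : forall n, exists z : C, J z /\ forall k, (k <= n)%N -> nm ((iter k (H a) w).1 - iter k P z) < t.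
  move=> n; have [z Jz zP] := ex n w wN wR; exists z; split; first exact: Jz.
  move=> k /zP; apply: le_lt_trans; rewrite -[leLHS]mul1r; apply: ler_wpM2r; first exact: nm_ge0.
  by have /andP[] := exp_rho expn (julia_it fr k Jz).
have [z zP] := choice ex2.
have [z' z'P] : exists z', forall n, nm (z n - z') <= B * th ^+ n.
  apply: geometric_limit; first exact: damping_lt1 expn.
  move=> m n mn; rewrite mulrC.
  have [Jm hm] := zP m; have [Jn hn] := zP n.
  apply: (julia_orbits_separate pm sp d2 expn) => // k km.
  have := hm k km; have := hn k (leq_trans km mn).
  set u := (iter k (H a) w).1 => q1 q2.
  have := nm_tri u (iter k P (z m)) (iter k P (z n)).
  by rewrite (nmC _ u); lra.
have Jz' : J z'.
  apply: (julia_closed (p := p)) => A /nbhs_nmP[e e0 eA].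
  have [n nP] := geometric_small B (damping_lt1 expn) e0.
  exists (z n); split; first by case: (zP n).
  by apply: eA; rewrite nmC; apply: le_lt_trans (z'P n) _; rewrite mulrC; exact: nP.
exists z' => // k; apply/ler_addgt0Pr => e e0.
have [u u0 uP] := iter_horner_continuous p k z' e0.
have [n nP] := geometric_small B (damping_lt1 expn) u0.
have zu : nm (z' - z (n + k)%N) < u.
  by rewrite nmC; apply: le_lt_trans (z'P _) _; rewrite mulrC; apply: nP; exact: leq_addr.
have := uP _ zu; have [_ /(_ k (leq_addl _ _)) q1] := zP (n + k)%N => q2.
by apply: le_trans (nm_tri (iter k P (z (n + k)%N)) _ _) _; rewrite [X in _ + X]nmC; lra.
Qed.

Lemma Jplus_shadow w : Jplus p a w -> nm w.1 <= R0 -> nm w.2 <= r ->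
  exists2 z, J z & shadow p s a z w.
Proof.
constants'; move=> Jw w1 w2.
have [Kw _] := (JplusP R00 growth ah w).1 Jw.
have inv n := Kplus_bounded R00 growth ah n aR (ltW rR) Kw w1 w2.
apply: shadow_of_nbhd => n; have [q1 q2] := inv n; last lra.
by apply: (Jplus_fst_near _ q1 q2); apply/(Jplus_iter R00 growth a0 ah).
Qed.

Lemma shadow_Jplus z w : J z -> shadow p s a z w -> nm w.2 <= r -> Jplus p a w.
Proof.
constants'; move=> Jz sw w2; apply/(JplusP R00 growth ah); split.
  apply/KplusP; exists R0 => n; split.
    by have := shadow_fst_R1 fr (julia_it fr n Jz) (shadow_iter n sw); lra.
  by have := shadow_snd fr sm n Jz sw w2; lra.
move=> e e0; have [n nP] := geometric_small B (damping_lt1 expn) e0.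
have [x xz xesc] := ep_near ep (julia_it fr n Jz).
have xs : rho (iter n P z) * nm (x - iter n P z) <= s.
  have /andP[r1 r2] := exp_rho expn (julia_it fr n Jz).
  by apply: le_trans (ltW xz); apply: ler_wpM2r; rewrite ?nm_ge0.
have [X XP] := finite_graph fr sm Jz xs; have [_ _ q1 q2 q3] := XP _ w2.
exists (X w.2, w.2); split => /=; last 1 first.
- rewrite -(Kplus_iter p a n).
  have := xesc _ (le_trans (q3 n (leqnn _)) (ltW rR)).
  by rewrite -q1 -surjective_pairing.
(* The second coordinates agree, so that only the damped term [th ^+ n * B] remains. *)
- have := @henon_orbits_close _ _ _ pm sp d2 _ _ _ _ expn a z w (X w.2, w.2) n Jz (param_sqr fr sm).
  move=> /(_ _ n 0%N (leqnn _)) /=; rewrite subrr nm0 !mulr0 addr0 => q.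
  apply: le_lt_trans (q _) (nP n (leqnn _)) => k kn.
  have := sw k; have := q2 k kn.
  have /andP[r1 r2] := exp_rho expn (julia_it fr k Jz).
  have : 1 * nm ((iter k (H a) (X w.2, w.2)).1 - iter k P z) <=
    rho (iter k P z) * nm ((iter k (H a) (X w.2, w.2)).1 - iter k P z).
    by apply: ler_wpM2r; rewrite ?nm_ge0.
  lra.
- by rewrite subrr nm0.
Qed.

(** One iterate beyond the entrance gives the bound [nm a * R1], which divided by [nm a / eps] is
    [eps * R1]: this puts the point in the open disc of the model. *)
Lemma Jplus_eventually_shadow w : Jplus p a w ->
  exists n, exists2 z, J z & shadow p s a z (iter n (H a) w) /\ nm (iter n (H a) w).2 <= nm a * R1.
Proof.
constants'; move=> Jw; have [Kw _] := (JplusP R00 growth ah w).1 Jw.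
have [n [q1 q2]] := Kplus_eventually R00 growth ah aR (ltW rR) Kw.
have [z Jz sw] := Jplus_shadow ((Jplus_iter R00 growth a0 ah n w).2 Jw) q1 q2.
exists n.+1, p.[z]; first exact: (julia_step fr).
split; first exact: (shadow_henon sw).
rewrite henon_snd nmM; apply: ler_wpM2l => //.
exact: (shadow_fst_R1 fr Jz sw).
Qed.

End FixedParameter.
End LocalJulia.

(** * The stable graph *)

Lemma iter_horner_continuous_upto (R : realType) (p : {poly Cplx R}) n (z : Cplx R) (e : R) :
  0 < e -> exists2 t : R, 0 < t & forall w, nm (z - w) < t ->
    forall k, (k <= n)%N -> nm (iter k (horner p) z - iter k (horner p) w) < e.
Proof.
move=> e0; elim: n => [|n [t t0 tP]].
  by exists e => // w zw k; rewrite leqn0 => /eqP ->.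
have [u u0 uP] := iter_horner_continuous p n.+1 z e0.
exists (Num.min t u) => [|w]; first by rewrite lt_min t0.
rewrite lt_min => /andP[h1 h2] k; rewrite leq_eqVlt ltnS => /orP[/eqP ->|].
  exact: uP.
exact: tP.
Qed.

Lemma henon_iter_continuous_upto (R : realType) (p : {poly Cplx R}) (a : Cplx R) n
    (w : Cplx R * Cplx R) (e : R) : 0 < e ->
  exists2 t : R, 0 < t & forall w' : Cplx R * Cplx R,
    nm (w.1 - w'.1) < t -> nm (w.2 - w'.2) < t -> forall k, (k <= n)%N ->
    nm ((iter k (henon p a) w).1 - (iter k (henon p a) w').1) < e.
Proof.
move=> e0; elim: n => [|n [t t0 tP]].
  by exists e => // w' h1 h2 k; rewrite leqn0 => /eqP ->.
have [u u0 uP] := henon_iter_continuous p a n.+1 w e0.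
exists (Num.min t u) => [|w']; first by rewrite lt_min t0.
rewrite !lt_min => /andP[h1 h2] /andP[h3 h4] k; rewrite leq_eqVlt ltnS => /orP[/eqP ->|].
  by have [] := uP w' h2 h4.
exact: tP.
Qed.

(** * Continuity of fibrewise functions *)

Section ContinuityOverJulia.
Variables (R : realType) (J : set (Cplx R)).
Local Notation C := (Cplx R).
Implicit Types (F G : C -> C -> C) (z v : C) (e : R).

(** Joint continuity on [J x C] of total curried functions. Leaving the fibre variable unrestricted
    lets such functions be composed without domain conditions. *)
Definition contJ F := forall z v e, J z -> 0 < e -> exists2 t : R, 0 < t &
  forall z' v', J z' -> nm (z - z') < t -> nm (v - v') < t -> nm (F z v - F z' v') < e.

Lemma contJ_snd : contJ (fun _ v => v).
Proof. by move=> z v e _ e0; exists e. Qed.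

Lemma contJ_fst : contJ (fun z _ => z).
Proof. by move=> z v e _ e0; exists e. Qed.

Lemma contJ_cst c : contJ (fun _ _ => c).
Proof. by move=> z v e _ e0; exists 1 => // *; rewrite subrr nm0. Qed.

Lemma contJ_comp F G : contJ F -> contJ G -> contJ (fun z v => F z (G z v)).
Proof.
move=> cF cG z v e Jz e0; have [t t0 tP] := cF z (G z v) e Jz e0.
have [u u0 uP] := cG z v t Jz t0; exists (Num.min t u) => [|z' v' Jz'].
  by rewrite lt_min t0.
by rewrite !lt_min => /andP[h1 h2] /andP[h3 h4]; apply: tP => //; exact: uP.
Qed.

Lemma contJ_add F G : contJ F -> contJ G -> contJ (fun z v => F z v + G z v).
Proof.
move=> cF cG z v e Jz e0; have e2 : 0 < e / 2 by lra.
have [t t0 tP] := cF z v _ Jz e2; have [u u0 uP] := cG z v _ Jz e2.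
exists (Num.min t u) => [|z' v' Jz']; first by rewrite lt_min t0.
rewrite !lt_min => /andP[h1 h2] /andP[h3 h4].
rewrite opprD addrACA; apply: le_lt_trans (nmD _ _) _.
by have := tP _ _ Jz' h1 h3; have := uP _ _ Jz' h2 h4; lra.
Qed.

Lemma contJ_mul F G : contJ F -> contJ G -> contJ (fun z v => F z v * G z v).
Proof.
move=> cF cG z v e Jz e0; set f := F z v; set g := G z v.
have f0 := nm_ge0 f; have g0 := nm_ge0 g.
pose e1 := Num.min 1 (e / (nm f + nm g + 1)).
have e10 : 0 < e1 by rewrite lt_min ltr01 divr_gt0//; lra.
have [t t0 tP] := cF z v _ Jz e10; have [u u0 uP] := cG z v _ Jz e10.
exists (Num.min t u) => [|z' v' Jz']; first by rewrite lt_min t0.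
rewrite !lt_min => /andP[h1 h2] /andP[h3 h4].
have := tP _ _ Jz' h1 h3; have := uP _ _ Jz' h2 h4; rewrite -/f -/g.
set f' := F z' v'; set g' := G z' v'.
rewrite /e1 !lt_min => /andP[q1 q2] /andP[q3 q4].
have -> : f * g - f' * g' = f * (g - g') + g * (f - f') - (f - f') * (g - g') by ring.
apply: le_lt_trans (nmD _ _) _; rewrite nmN.
apply: le_lt_trans (lerD (nmD _ _) (lexx _)) _; rewrite !nmM.
rewrite !ltr_pdivlMr in q2 q4; try lra.
set A := nm (f - f') in q3 q4 *; set A' := nm (g - g') in q1 q2 *.
have A0 : 0 <= A := nm_ge0 _; have A'0 : 0 <= A' := nm_ge0 _.
set m := Num.max A A'.
have Am : A <= m by rewrite le_max lexx.
have Am' : A' <= m by rewrite le_max lexx orbT.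
have mE : m * (nm f + nm g + 1) < e by rewrite /m maxEle; case: ifP => _; lra.
have r1 : nm f * A' <= nm f * m by apply: ler_wpM2l.
have r2 : nm g * A <= nm g * m by apply: ler_wpM2l.
have r3 : A * A' <= m * 1 by apply: ler_pM => //; lra.
lra.
Qed.

Lemma contJ_opp F : contJ F -> contJ (fun z v => - F z v).
Proof.
move=> cF z v e Jz e0; have [t t0 tP] := cF z v e Jz e0; exists t => // *.
by rewrite -opprD nmN; exact: tP.
Qed.

Lemma contJ_inv F : contJ F -> (forall z v, J z -> F z v != 0) -> contJ (fun z v => (F z v)^-1).
Proof.
move=> cF F0 z v e Jz e0; set f := F z v.
have f0 : 0 < nm f by rewrite nm_gt0; exact: F0.
pose e1 := Num.min (nm f / 2) (e * nm f * nm f / 2).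
have e10 : 0 < e1 by rewrite lt_min !divr_gt0 ?mulr_gt0.
have [t t0 tP] := cF z v _ Jz e10; exists t => // z' v' Jz' h1 h2.
have := tP _ _ Jz' h1 h2; rewrite -/f; set f' := F z' v'.
rewrite lt_min => /andP[q1 q2].
have f'2 : nm f / 2 < nm f' by have := nm_le_dist f f'; lra.
have f'0 : 0 < nm f' by lra.
have -> : f^-1 - f'^-1 = - (f - f') / (f * f').
  by field; rewrite -!nm_gt0 f0 f'0.
rewrite nmM nmV nmN nmM ltr_pdivrMr ?mulr_gt0//.
apply: lt_le_trans q2 _.
have : nm f * (nm f / 2) <= nm f * nm f' by apply: ler_wpM2l; exact: ltW.
move=> h; have : e * (nm f * (nm f / 2)) <= e * (nm f * nm f') by rewrite ler_pM2l.
lra.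
Qed.

Lemma contJ_horner (q : {poly C}) : contJ (fun z _ => q.[z]).
Proof.
move=> z v e Jz e0; have [t t0 tP] := iter_horner_continuous q 1 z e0.
by exists t => // z' v' _ h _; exact: tP.
Qed.

Lemma contJ_limit (Fn : nat -> C -> C -> C) F (K th : R) : 0 <= th < 1 ->
  (forall n, contJ (Fn n)) ->
  (forall n z v, J z -> nm (Fn n z v - F z v) <= K * th ^+ n) -> contJ F.
Proof.
move=> th01 cF lim z v e Jz e0; have e3 : 0 < e / 3 by lra.
have [n nP] := geometric_small K th01 e3; have := nP n (leqnn _); rewrite mulrC => hn.
have [t t0 tP] := cF n z v _ Jz e3; exists t => // z' v' Jz' h1 h2.
have := tP _ _ Jz' h1 h2; have := lim n z v Jz; have := lim n z' v' Jz'.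
move=> q1 q2 q3.
apply: le_lt_trans (nm_tri (Fn n z v) _ _) _; rewrite nmC.
have := nm_tri (Fn n z' v') (Fn n z v) (F z' v'); lra.
Qed.

End ContinuityOverJulia.

Section GraphFunction.
Variable R : realType.
Local Notation C := (Cplx R).
Variables (p : {poly C}) (d : nat) (rho : C -> R) (M lam del s R1 L r : R).
Hypothesis fr : frame p d rho M lam del s R1 L r.
Variable a : C.
Hypothesis sm : small_param M lam s R1 r a.
Local Notation J := (julia p).
Local Notation P := (horner p).
Local Notation H := (henon p).
Local Notation th := ((1 + lam) / (2 * lam)).
Local Notation B := (2 * M * del).
Local Notation cst := (2 * M / (lam - 1)).
Local Notation sh := (shadow p s a).
Implicit Types (x y z v : C) (w : C * C) (e : R).

Local Ltac constants := have pm := fr_monic fr; have sp := fr_size fr; have d2 := fr_deg fr;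
  have expn := fr_exp fr; have M1 := fr_M fr; have s0 := fr_s fr; have l1 := exp_lam (fr_exp fr);
  have r0 := fr_r fr; have L0 := fr_L0 fr; have d0 := exp_del expn; have sdel := fr_sdel fr;
  have na := nm_ge0 a; have ah := param_half fr sm; have c0 := cst_ge0 fr.

(* The local stable set of the base point [z] is the graph of [y |-> graph z y] over the disk of radius [r]. *)
Definition graph z y : C := xget 0 [set x | sh z (x, y)].

Lemma graphP z y : J z -> nm y <= r -> sh z (graph z y, y).
Proof. by move=> Jz yr; rewrite /graph; case: xgetP => [x _ //|h]; have [x /h] := shadow_exists fr sm Jz yr. Qed.

Lemma graph_lipschitz z y y' : J z -> nm y <= r -> nm y' <= r ->
  nm (graph z y - graph z y') <= cst * (nm a * nm (y - y')).
Proof. by move=> Jz yr y'r; have := shadow_lipschitz fr sm Jz (graphP Jz yr) (graphP Jz y'r). Qed.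

Lemma graph_unique z w : J z -> nm w.2 <= r -> sh z w -> w.1 = graph z w.2.
Proof.
move=> Jz wr sw; have := shadow_lipschitz fr sm Jz sw (graphP Jz wr).
rewrite /= subrr nm0 !mulr0 => h; apply/eqP; rewrite -subr_eq0; apply/eqP/nm0P/eqP.
by rewrite eq_le h nm_ge0.
Qed.

Lemma graph_image_bound z y : J z -> nm y <= r -> nm (a * graph z y) <= nm a * R1.
Proof.
move=> Jz yr; rewrite nmM; apply: ler_wpM2l; rewrite ?nm_ge0//.
exact: (shadow_fst_R1 fr Jz (graphP Jz yr)).
Qed.

Lemma graph_image_le z y : J z -> nm y <= r -> nm (a * graph z y) <= r.
Proof. by move=> Jz yr; apply: le_trans (graph_image_bound Jz yr) (sp_R1 sm). Qed.

Lemma graph_henon z y : J z -> nm y <= r ->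
  p.[graph z y] + a * y = graph p.[z] (a * graph z y).
Proof.
move=> Jz yr; apply: (@graph_unique p.[z] (H a (graph z y, y))).
- exact: (julia_step fr Jz).
- exact: (graph_image_le Jz yr).
- exact: (shadow_henon (graphP Jz yr)).
Qed.

Lemma graph_close z y : J z -> nm y <= r -> nm (graph z y - z) <= cst * (nm a * r).
Proof.
constants; move=> Jz yr.
have := shadow_close fr Jz (graphP Jz yr) (ltW r0) => /(_ _ 0%N); apply => k.
exact: (shadow_snd fr sm k Jz (graphP Jz yr) yr).
Qed.

(** The orbit starts with second coordinate 0, and all later ones are at most [nm a * R1]. The
    second factor [nm a] so gained is needed to compare the fibre map with a multiplication by
    [(a / eps) ^+ 2]. *)
Lemma graph_close0 z : J z -> nm (graph z 0 - z) <= cst * (nm a * (nm a * R1)).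
Proof.
constants; move=> Jz; have zr : nm (0 : C) <= r by rewrite nm0 ltW.
have R10 := fr_R1_ge0 fr.
have Y0 : 0 <= nm a * R1 by exact: mulr_ge0.
have := shadow_close fr Jz (graphP Jz zr) Y0 => /(_ _ 0%N); apply => -[|k]; first by rewrite nm0.
rewrite henon_snd nmM; apply: ler_wpM2l => //.
exact: (shadow_fst_R1 fr (julia_it fr k Jz) (shadow_iter k (graphP Jz zr))).
Qed.

(** Subtracting [graph_henon] at [y] and [y'] leaves the Taylor remainder of [p] and a difference of
    values of the next graph. Both are of order [nm a] times [nm (x - x')], which is itself of order
    [nm a]; so the slope is [- a / p'] up to second order, without differentiating [graph]. *)
Lemma graph_linear z y y' : J z -> nm y <= r -> nm y' <= r ->
  nm (p^`().[z] * (graph z y - graph z y') + a * (y - y')) <=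
    (2 * L * r + 1) * cst ^+ 2 * nm a ^+ 2 * nm (y - y').
Proof.
constants; move=> Jz yr y'r.
have g1 := graph_henon Jz yr; have g2 := graph_henon Jz y'r.
have x1 : nm (graph z y) <= R1 := shadow_fst_R1 fr Jz (graphP Jz yr).
have x2 : nm (graph z y') <= R1 := shadow_fst_R1 fr Jz (graphP Jz y'r).
have zR : nm z <= R1 by have := fr_R1 fr Jz; lra.
have q1 := fr_L fr x1 x2 zR.
have q2 := graph_lipschitz (julia_step fr Jz) (graph_image_le Jz yr) (graph_image_le Jz y'r).
have q3 := graph_lipschitz Jz yr y'r.
have q4 := graph_close Jz yr; have q5 := graph_close Jz y'r.
set x := graph z y in g1 x1 q1 q2 q3 q4 *.
set x' := graph z y' in g2 x2 q1 q2 q3 q5 *.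
have -> : p^`().[z] * (x - x') + a * (y - y') =
   - (p.[x] - p.[x'] - p^`().[z] * (x - x')) + ((p.[x] + a * y) - (p.[x'] + a * y')).
  by ring.
rewrite g1 g2; apply: le_trans (nmD _ _) _; rewrite nmN.
rewrite -mulrBr nmM in q2.
have u0 := nm_ge0 (x - x'); have v0 := nm_ge0 (y - y').
have k1 : L * (nm (x - z) + nm (x' - z)) * nm (x - x') <=
   L * (2 * (cst * (nm a * r))) * nm (x - x').
  by apply: ler_wpM2r => //; apply: ler_wpM2l => //; lra.
have k2 : nm a * (nm a * nm (x - x')) <= nm a * nm (x - x').
  by apply: ler_wpM2l => //; rewrite -[leRHS]mul1r; apply: ler_wpM2r => //; lra.
have k3 : cst * (nm a * (nm a * nm (x - x'))) <= cst * (nm a * nm (x - x')) by apply: ler_wpM2l.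
have k4 : 0 <= (2 * L * r + 1) * cst * nm a.
  apply: mulr_ge0 => //; apply: mulr_ge0 => //; have := mulr_ge0 L0 (ltW r0); lra.
have k5 := ler_wpM2l k4 q3.
lra.
Qed.

Lemma graph_continuous z y e : J z -> nm y <= r -> 0 < e -> exists2 t : R, 0 < t &
  forall z' y', J z' -> nm y' <= r -> nm (z - z') < t -> nm (y - y') < t ->
    nm (graph z y - graph z' y') < e.
Proof.
constants; move=> Jz yr e0; have e2 : 0 < e / 2 by lra.
have [n nP] := geometric_small B (damping_lt1 expn) e2.
have [t t0 tP] := iter_horner_continuous_upto p n z s0.
pose u := e / 2 / (cst + 1).
have u0 : 0 < u by rewrite divr_gt0//; lra.
exists (Num.min t u) => [|z' y' Jz' y'r]; first by rewrite lt_min t0.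
rewrite !lt_min => /andP[h1 _] /andP[_ h2].
have sw := graphP Jz yr; have sw' := graphP Jz' y'r.
have := @henon_orbits_close _ _ _ pm sp d2 _ _ _ _ expn a z _ _ n Jz (param_sqr fr sm) _ n 0%N (leqnn _).
move=> /(_ (graph z y, y) (graph z' y', y')) /= h.
apply: le_lt_trans (h _) _.
  move=> k kn; have := sw k; have := sw' k; have := tP _ h1 k kn.
  set X := (iter k (H a) (graph z' y', y')).1.
  have := nm_tri (iter k P z') X (iter k P z); rewrite (nmC (iter k P z')); lra.
have := nP n (leqnn _) => q1.
have q2 : nm a * nm (y - y') <= 1 * nm (y - y') by apply: ler_wpM2r; [exact: nm_ge0|lra].
have q3 : cst * (nm a * nm (y - y')) <= cst * nm (y - y') by apply: ler_wpM2l => //; lra.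
rewrite ltr_pdivlMr in h2; last lra.
have := nm_ge0 (y - y'); lra.
Qed.

Lemma shadow_base_continuous z w e : J z -> sh z w -> 0 < e -> exists2 t : R, 0 < t &
  forall z' w', J z' -> sh z' w' -> nm (w.1 - w'.1) < t -> nm (w.2 - w'.2) < t ->
    nm (z - z') < e.
Proof.
constants; move=> Jz sw e0.
have [n nP] := geometric_small B (damping_lt1 expn) e0.
have d20 : 0 < del / 2 by lra.
have [t t0 tP] := henon_iter_continuous_upto p a n w d20.
exists t => // z' w' Jz' sw' h1 h2; rewrite nmC.
apply: le_lt_trans (nP n (leqnn _)).
apply: (shadow_base_close fr Jz Jz' (lexx (del / 2)) sw sw') => k kn.
by apply: ltW; exact: tP.
Qed.

End GraphFunction.

(** * Conjugating the model map *)

Lemma halving_limit (R : realType) (u : nat -> Cplx R) (K : R) : 0 <= K ->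
  (forall n, nm (u n - u n.+1) <= K * (1 / 2) ^+ n) ->
  exists l, forall n, nm (u n - l) <= 2 * K * (1 / 2) ^+ n.
Proof.
move=> K0 uK; apply: geometric_limit; first by lra.
move=> m n mn; rewrite -(subnKC mn); move: (n - m)%N => k {n mn}; elim: k m => [|k IH] m.
  rewrite addn0 subrr nm0; apply: mulr_ge0; first lra.
  by apply: exprn_ge0; lra.
rewrite addnS -addSn; apply: le_trans (nm_tri (u m.+1) _ _) _.
by have := uK m; have := IH m.+1; rewrite exprS; lra.
Qed.

Section FibreMaps.
Variables (R : realType) (J : set (Cplx R)).
Local Notation C := (Cplx R).
Implicit Types (F G : C -> C -> C) (z v w : C) (e q : R).

(** Homeomorphisms of the whole plane, fixed outside a disc, compose and invert without boundary
    conditions; the inverse is carried along so that it can be iterated too. *)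
Record fibre_homeo q F G : Prop := FibreHomeo {
  fh_cont : contJ J F;
  fh_inv_cont : contJ J G;
  fh_K : forall z v, J z -> G z (F z v) = v;
  fh_VK : forall z v, J z -> F z (G z v) = v;
  fh_out : forall z v, J z -> q <= nm v -> F z v = v }.

Lemma fibre_homeo_sym q F G : fibre_homeo q F G -> fibre_homeo q G F.
Proof.
case=> cF cG K VK out; split => //.
by move=> z v Jz qv; rewrite -{1}(out z v Jz qv) K.
Qed.

Lemma fibre_homeo_id q : fibre_homeo q (fun _ v => v) (fun _ v => v).
Proof. by split => //; exact: contJ_snd. Qed.

Lemma fibre_homeo_comp q F G F' G' : fibre_homeo q F G -> fibre_homeo q F' G' ->
  fibre_homeo q (fun z v => F z (F' z v)) (fun z v => G' z (G z v)).
Proof.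
case=> cF cG K VK out [cF' cG' K' VK' out']; split.
- exact: contJ_comp.
- exact: contJ_comp.
- by move=> z v Jz; rewrite K// K'.
- by move=> z v Jz; rewrite VK'// VK.
- by move=> z v Jz qv; rewrite out'// out.
Qed.

Lemma fibre_homeo_le q q' F G : q <= q' -> fibre_homeo q F G -> fibre_homeo q' F G.
Proof.
move=> qq' [cF cG K VK out]; split => // z v Jz qv; apply: out => //.
exact: le_trans qv.
Qed.

(** An image outside the disc would be a fixed point, and injectivity would identify it with [v]. *)
Lemma fibre_homeo_lt q q' F G z v : fibre_homeo q F G -> q <= q' -> J z ->
  nm v < q' -> nm (F z v) < q'.
Proof.
move=> fh qq' Jz vq; rewrite ltNge; apply/negP => h.
have := fh_out fh Jz (le_trans qq' h) => FF.
have : F z v = v by rewrite -[LHS](fh_K fh (F z v) Jz) FF (fh_K fh).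
by move=> Fv; rewrite Fv in h; lra.
Qed.

End FibreMaps.

Section Sheets.
Variables (R : realType) (p : {poly Cplx R}) (d : nat) (eps r : R).
Local Notation C := (Cplx R).
Local Notation J := (julia p).
Hypotheses (pm : p \is monic) (sp : size p = d.+1) (d2 : (2 <= d)%N).
Implicit Types (F G : C -> C -> C) (z v w : C) (e : R).

Definition model_fibre z v : C := (model_map p eps (z, v)).2.
Local Notation m := model_fibre.

Definition sheet z w : C := (rC eps * z - w) * p^`().[z] / rC eps ^+ 2.

(** [sf_sep] is the injectivity of the model map on discs of radius [3 * r], larger than the support
    [2 * r] of the maps to be transported. *)
Record sheet_frame : Prop := SheetFrame {
  sf_r : 0 < r;
  sf_eps : 0 < eps;
  sf_deriv : forall z, J z -> p^`().[z] != 0;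
  sf_sep : forall z z' v v', J z -> J z' -> p.[z] = p.[z'] ->
    nm v <= 3 * r -> nm v' <= 3 * r -> m z v = m z' v' -> z = z';
  sf_inside : forall z v, J z -> nm v <= 3 * r -> nm (m z v) < r;
  sf_contract : forall z v v', J z -> nm (m z v - m z v') <= 1 / 2 * nm (v - v') }.

Hypothesis sf : sheet_frame.

Lemma rC_eps_neq0 : rC eps != 0.
Proof. by rewrite -nm_gt0 nm_rC normr_gt0 gt_eqF// (sf_eps sf). Qed.

Lemma model_fibreK z v : J z -> sheet z (m z v) = v.
Proof.
move=> Jz; have D := sf_deriv sf Jz; have E := rC_eps_neq0.
by rewrite /sheet /model_fibre /model_map /=; field; rewrite D E.
Qed.

Lemma sheetK z w : J z -> m z (sheet z w) = w.
Proof.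
move=> Jz; have D := sf_deriv sf Jz; have E := rC_eps_neq0.
by rewrite /sheet /model_fibre /model_map /=; field; rewrite D E.
Qed.

Lemma contJ_model_fibre : contJ J m.
Proof.
apply: contJ_add; first by apply: contJ_mul; [exact: contJ_cst|exact: contJ_fst].
apply: contJ_opp; apply: contJ_mul.
  by apply: contJ_mul; [exact: contJ_cst|exact: contJ_snd].
apply: contJ_inv => [|z v Jz]; last exact: (sf_deriv sf).
exact: contJ_horner.
Qed.

Lemma contJ_sheet : contJ J sheet.
Proof.
apply: contJ_mul; last exact: contJ_cst.
apply: contJ_mul; last exact: contJ_horner.
apply: contJ_add; first by apply: contJ_mul; [exact: contJ_cst|exact: contJ_fst].
by apply: contJ_opp; exact: contJ_snd.
Qed.

Definition in_sheet z' w z := [/\ J z, p.[z] = z' & nm (sheet z w) < 3 * r].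

(* The conjugate of a fibre map by the model map on the union of the sheets [m z D_(3r)], extended by the identity. *)
Definition transport F z' w : C :=
  if pselect (exists z, in_sheet z' w z) is left _
  then let z := xget 0 [set z | in_sheet z' w z] in m z (F z (sheet z w))
  else w.

Lemma in_sheet_unique z' w z1 z2 : in_sheet z' w z1 -> in_sheet z' w z2 -> z1 = z2.
Proof.
move=> [J1 p1 s1] [J2 p2 s2].
apply: (sf_sep sf J1 J2 _ (ltW s1) (ltW s2)); first by rewrite p1 p2.
by rewrite !sheetK.
Qed.

Lemma transport_in F z' w z : in_sheet z' w z ->
  transport F z' w = m z (F z (sheet z w)).
Proof.
move=> zP; rewrite /transport; case: pselect => [ex|]; last by case; exists z.
have [x _ xP|h] := xgetP; last by case: (h z).
by rewrite (in_sheet_unique zP xP).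
Qed.

Lemma transport_model F z v : J z -> nm v < 3 * r ->
  transport F p.[z] (m z v) = m z (F z v).
Proof.
move=> Jz vr; have zP : in_sheet p.[z] (m z v) z by split => //; rewrite model_fibreK.
by rewrite (transport_in F zP) model_fibreK.
Qed.

Lemma transport_notin F z' w : (forall z, ~ in_sheet z' w z) -> transport F z' w = w.
Proof. by move=> h; rewrite /transport; case: pselect => // -[z /h]. Qed.

Lemma sheet_cases z' w : (exists z v, [/\ J z, p.[z] = z', nm v < 3 * r & w = m z v])
  \/ (forall z, ~ in_sheet z' w z).
Proof.
have [[z [Jz pz zr]]|h] := pselect (exists z, in_sheet z' w z).
  by left; exists z, (sheet z w); rewrite sheetK.
by right => z zP; apply: h; exists z.
Qed.

Lemma transport_out F z' w : r <= nm w -> transport F z' w = w.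
Proof.
move=> rw; have [[z [v [Jz pz vr wE]]]|] := sheet_cases z' w; last exact: transport_notin.
by exfalso; have := sf_inside sf Jz (ltW vr); rewrite -wE; lra.
Qed.

Lemma preimage_close z0 z' e : J z0 -> J z' -> 0 < e -> nm (p.[z0] - z') < e ^+ d ->
  exists z, [/\ J z, p.[z] = z' & nm (z0 - z) < e].
Proof.
move=> J0 J' e0 h; have [z pz [Jz zz]] := julia_preimage pm sp d2 z0 J'.
exists z; split; [exact: Jz|exact: pz|].
have dd : (0 < d)%N by exact: ltnW.
rewrite -(ltr_pXn2r dd) ?nnegrE ?nm_ge0 ?(ltW e0)//.
exact: le_lt_trans h.
Qed.

(** The constant is uniform over pairs of sheets because [contJ_transport] has to treat a sheet that
    is not known in advance. *)
Lemma sheet_lipschitz w0 : exists2 Q : R, 0 < Q & forall z z0 w, J z -> J z0 ->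
  nm (sheet z w - sheet z0 w0) <= Q * (nm (z - z0) + nm (w - w0)).
Proof.
have e0 := sf_eps sf.
have [B0 B00 JB] := julia_bounded pm sp d2.
have [D D0 qD] := horner_bounded p^`() B0.
have [L L0 qL] := horner_lipschitz p^`() B0.
have w00 := nm_ge0 w0.
have Q0 : 0 <= (eps + 1) * D + (eps * B0 + nm w0) * L.
  by apply: addr_ge0; apply: mulr_ge0 => //; [lra|apply: addr_ge0 => //; apply: mulr_ge0; lra].
exists (((eps + 1) * D + (eps * B0 + nm w0) * L + 1) / eps ^+ 2).
  by rewrite divr_gt0 ?exprn_gt0//; lra.
move=> z z0 w Jz J0.
have -> : sheet z w - sheet z0 w0 = ((rC eps * (z - z0) - (w - w0)) * p^`().[z]
   + (rC eps * z0 - w0) * (p^`().[z] - p^`().[z0])) / rC eps ^+ 2.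
  by rewrite /sheet; field; rewrite rC_eps_neq0.
rewrite nmM nmV nmX nm_rC gtr0_norm// mulrAC ler_pM2r ?invr_gt0 ?exprn_gt0//.
apply: le_trans (nmD _ _) _; rewrite !nmM.
have zB := JB z Jz; have z0B := JB z0 J0.
set A := nm (z - z0); set A' := nm (w - w0).
have A0 : 0 <= A := nm_ge0 _; have A'0 : 0 <= A' := nm_ge0 _.
have h1 : nm (rC eps * (z - z0) - (w - w0)) <= eps * A + A'.
  by apply: le_trans (nmD _ _) _; rewrite nmN nmM nm_rC gtr0_norm.
have h2 : nm (rC eps * z0 - w0) <= eps * B0 + nm w0.
  apply: le_trans (nmD _ _) _; rewrite nmN nmM nm_rC gtr0_norm// lerD2r.
  by apply: ler_wpM2l => //; exact: ltW.
have h3 : nm (rC eps * (z - z0) - (w - w0)) * nm p^`().[z] <= (eps * A + A') * D.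
  by apply: ler_pM; rewrite ?nm_ge0//; exact: qD.
have h4 : nm (rC eps * z0 - w0) * nm (p^`().[z] - p^`().[z0]) <= (eps * B0 + nm w0) * (L * A).
  by apply: ler_pM; rewrite ?nm_ge0//; exact: qL.
have k1 := mulr_ge0 A'0 (ltW e0); have k2 := mulr_ge0 k1 D0.
have k3 := mulr_ge0 A0 D0; have k4 := mulr_ge0 (mulr_ge0 (addr_ge0 (mulr_ge0 (ltW e0) B00) w00) L0) A'0.
lra.
Qed.

(** On a sheet the transport is locally a composition of continuous maps, the preimage [z] following
    [z'] by the Hölder bound; off the sheets, nearby sheets are met only where [F] is the
    identity. *)
Lemma contJ_transport F G : fibre_homeo J (2 * r) F G -> contJ J (transport F).
Proof.
move=> fh z0' w0 e J0' e0; have r0 := sf_r sf.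
have ed t : 0 < t -> 0 < t ^+ d by move=> t0; rewrite exprn_gt0.
have [[z0 [v0 [J0 pz0 v0r wE]]]|no] := sheet_cases z0' w0.
  pose FF z w := m z (F z (sheet z w)).
  have cFF : contJ J FF.
    apply: contJ_comp; first exact: contJ_model_fibre.
    by apply: contJ_comp; [exact: fh_cont fh|exact: contJ_sheet].
  have [t t0 tP] := cFF z0 w0 e J0 e0.
  have e1 : 0 < 3 * r - nm v0 by lra.
  have [u u0 uP] := contJ_sheet w0 J0 e1.
  have tu0 : 0 < Num.min t u by rewrite lt_min t0.
  exists (Num.min (Num.min t u) (Num.min t u ^+ d)) => [|z' w J' h1 h2].
    by rewrite lt_min tu0 ed.
  move: h1; rewrite lt_min => /andP[_ h1].
  move: h2; rewrite lt_min => /andP[h2 _].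
  rewrite -pz0 in h1; have [z [Jz pz zz]] := preimage_close J0 J' tu0 h1.
  move: zz h2; rewrite !lt_min => /andP[q1 q2] /andP[q3 q4].
  have zP : in_sheet z' w z.
    split; [exact: Jz|exact: pz|].
    have := uP _ _ Jz q2 q4; rewrite wE model_fibreK// => q5.
    by have := nm_le_dist (sheet z w) v0; rewrite nmC; lra.
  rewrite (transport_in F zP) wE -pz0 transport_model//.
  by have := tP _ _ Jz q1 q3; rewrite /FF wE model_fibreK.
rewrite (transport_notin F no).
(* A point near [w0] that does lie in a sheet has coordinate at least [3 * r - 2 * Q * u >= 2 * r]
   in it, so the transport fixes it. *)
have [Q Q0 QP] := sheet_lipschitz w0.
pose u := Num.min e (r / (2 * Q)).
have u0 : 0 < u by rewrite lt_min e0 divr_gt0//; lra.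
exists (Num.min u (u ^+ d)) => [|z' w J' h1 h2]; first by rewrite lt_min u0 ed.
move: h1; rewrite lt_min => /andP[_ h1].
move: h2; rewrite lt_min => /andP[h2 _].
have ue : u <= e by rewrite ge_min lexx.
have uQ : u * (2 * Q) <= r by rewrite -ler_pdivlMr ?ge_min ?lexx ?orbT//; lra.
suff -> : transport F z' w = w by lra.
have [[z [v [Jz pz vr wE]]]|] := sheet_cases z' w; last exact: transport_notin.
rewrite wE -pz transport_model// (fh_out fh Jz)//.
rewrite nmC -pz in h1.
have [z0 [J0 pz0 zz0]] := preimage_close Jz J0' u0 h1.
have far : 3 * r <= nm (sheet z0 w0).
  by rewrite leNgt; apply/negP => h; apply: (no z0).
have := QP z z0 w Jz J0; rewrite wE model_fibreK// -wE (nmC w) => q1.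
have q2 : Q * (nm (z - z0) + nm (w0 - w)) <= Q * (u + u).
  by apply: ler_wpM2l; lra.
have := nm_le_dist (sheet z0 w0) v; rewrite nmC; lra.
Qed.

Lemma transport_comp F G F' z' w : fibre_homeo J (2 * r) F G -> J z' ->
  transport F' z' (transport F z' w) = transport (fun z v => F' z (F z v)) z' w.
Proof.
move=> fh J'; have r0 := sf_r sf.
have [[z [v [Jz pz vr wE]]]|no] := sheet_cases z' w; last by rewrite !(transport_notin _ no).
rewrite wE -pz !transport_model//.
by apply: (fibre_homeo_lt fh) => //; lra.
Qed.

Lemma transport_id z' w : transport (fun _ v => v) z' w = w.
Proof.
have [[z [v [Jz pz vr wE]]]|no] := sheet_cases z' w; last by rewrite (transport_notin _ no).
by rewrite wE -pz transport_model.
Qed.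

Lemma transport_ext F F' z' w : (forall z v, J z -> F z v = F' z v) ->
  transport F z' w = transport F' z' w.
Proof.
move=> FF'.
have [[z [v [Jz pz vr wE]]]|no] := sheet_cases z' w; last by rewrite !(transport_notin _ no).
by rewrite wE -pz !transport_model// FF'.
Qed.

(** The support shrinks from [2 * r] to [r] because the sheets lie in the disc of radius [r]; this
    lets the iteration continue. *)
Lemma fibre_homeo_transport F G : fibre_homeo J (2 * r) F G ->
  fibre_homeo J r (transport F) (transport G).
Proof.
move=> fh; have fh' := fibre_homeo_sym fh; split.
- exact: contJ_transport fh.
- exact: contJ_transport fh'.
- move=> z v Jz; rewrite (@transport_comp F G G z v fh Jz) -[RHS](transport_id z).
  by apply: transport_ext => z1 v1 J1; rewrite (fh_K fh).
- move=> z v Jz; rewrite (@transport_comp G F F z v fh' Jz) -[RHS](transport_id z).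
  by apply: transport_ext => z1 v1 J1; rewrite (fh_K fh').
- by move=> z v Jz; exact: transport_out.
Qed.

Lemma transport_contract F F' z' w (K : R) : 0 <= K ->
  (forall z v, J z -> nm (F z v - F' z v) <= K) ->
  nm (transport F z' w - transport F' z' w) <= 1 / 2 * K.
Proof.
move=> K0 h.
have [[z [v [Jz pz vr wE]]]|no] := sheet_cases z' w; last first.
  by rewrite !(transport_notin _ no) subrr nm0; lra.
rewrite wE -pz !transport_model//; apply: le_trans (sf_contract sf _ _ Jz) _.
by apply: ler_wpM2l; [lra|exact: h].
Qed.

Section Conjugacy.
Variables T S : C -> C -> C.
Hypotheses (TS : fibre_homeo J (2 * r) T S)
  (Tlip : forall z v v', J z -> nm v < r -> nm v' < r -> nm (T z v - T z v') <= nm (v - v')).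

(* The conjugacy is the fixed point [h = transport (T \o h)]; its inverse satisfies [g = transport (g \o S)]. The first iteration only converges because [T] is a contraction of the disk of radius [r], outside of which the iterates agree. *)
Fixpoint conj_iter n : C -> C -> C :=
  if n is n'.+1 then transport (fun z v => T z (conj_iter n' z v)) else fun _ v => v.

Fixpoint conj_inv_iter n : C -> C -> C :=
  if n is n'.+1 then transport (fun z v => conj_inv_iter n' z (S z v)) else fun _ v => v.

Lemma conj_iter_homeo n : fibre_homeo J r (conj_iter n) (conj_inv_iter n).
Proof.
have r0 := sf_r sf.
elim: n => [|n IH] /=; first exact: fibre_homeo_id.
apply: fibre_homeo_transport; apply: fibre_homeo_comp => //.
by apply: fibre_homeo_le IH; lra.
Qed.

Lemma fibre_homeo_dist F G F' G' z v : fibre_homeo J r F G -> fibre_homeo J r F' G' ->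
  J z -> nm (F z v - F' z v) <= 2 * r.
Proof.
move=> fh fh' Jz; have r0 := sf_r sf.
have [rv|vr] := lerP r (nm v).
  by rewrite (fh_out fh)// (fh_out fh')// subrr nm0; lra.
have := fibre_homeo_lt fh (lexx r) Jz vr; have := fibre_homeo_lt fh' (lexx r) Jz vr.
by have := nmD (F z v) (- F' z v); rewrite nmN; lra.
Qed.

Lemma conj_iter_cauchy n z v : J z ->
  nm (conj_iter n z v - conj_iter n.+1 z v) <= 2 * r * (1 / 2) ^+ n.
Proof.
have r0 := sf_r sf.
elim: n z v => [|n IH] z v Jz.
  rewrite expr0 mulr1; exact: fibre_homeo_dist (conj_iter_homeo 0) (conj_iter_homeo 1) Jz.
have step z' v' : J z' -> nm (T z' (conj_iter n z' v') - T z' (conj_iter n.+1 z' v')) <=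
    2 * r * (1 / 2) ^+ n.
  move=> Jz'; apply: le_trans (IH z' v' Jz').
  have [rv|vr] := lerP r (nm v').
    rewrite (fh_out (conj_iter_homeo n) Jz' rv) (fh_out (conj_iter_homeo n.+1) Jz' rv).
    by rewrite !subrr.
  by apply: Tlip => //; exact: (fibre_homeo_lt (conj_iter_homeo _) (lexx r) Jz' vr).
rewrite exprS mulrCA; apply: transport_contract; last exact: step.
by apply: mulr_ge0; [lra|apply: exprn_ge0; lra].
Qed.

(** Precomposition with [S] preserves uniform distances, so [transport_contract] alone gives the
    factor [1 / 2]. *)
Lemma conj_inv_iter_cauchy n z v : J z ->
  nm (conj_inv_iter n z v - conj_inv_iter n.+1 z v) <= 2 * r * (1 / 2) ^+ n.
Proof.
have r0 := sf_r sf.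
elim: n z v => [|n IH] z v Jz.
  rewrite expr0 mulr1; exact: fibre_homeo_dist (fibre_homeo_sym (conj_iter_homeo 0)) (fibre_homeo_sym (conj_iter_homeo 1)) Jz.
rewrite exprS mulrCA; apply: transport_contract.
  by apply: mulr_ge0; [lra|apply: exprn_ge0; lra].
by move=> {}z {}v {}Jz; exact: IH.
Qed.

Lemma fibre_limit (Fn : nat -> C -> C -> C) :
  (forall n z v, J z -> nm (Fn n z v - Fn n.+1 z v) <= 2 * r * (1 / 2) ^+ n) ->
  exists F : C -> C -> C, forall n z v, J z -> nm (Fn n z v - F z v) <= 4 * r * (1 / 2) ^+ n.
Proof.
move=> FnP; have r0 := sf_r sf.
exists (fun z v => xget 0 [set l | forall n, nm (Fn n z v - l) <= 4 * r * (1 / 2) ^+ n]) => n z v Jz.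
case: xgetP => [l _ //|no].
have r2 : 0 <= 2 * r by lra.
have [l lP] := halving_limit r2 (fun n => FnP n z v Jz).
by exfalso; apply: (no l) => k; have := lP k; rewrite mulrA (_ : 2 * 2 = 4 :> R); [|lra].
Qed.

Lemma limit_inverse (Fn Gn : nat -> C -> C -> C) F G :
  (forall n z v, J z -> nm (Fn n z v - F z v) <= 4 * r * (1 / 2) ^+ n) ->
  (forall n z v, J z -> nm (Gn n z v - G z v) <= 4 * r * (1 / 2) ^+ n) ->
  contJ J G -> (forall n z v, J z -> Gn n z (Fn n z v) = v) ->
  forall z v, J z -> G z (F z v) = v.
Proof.
move=> Fl Gl cG GF z v Jz; have r0 := sf_r sf.
apply/eqP; rewrite -subr_eq0; apply/eqP/nm0P/eqP; rewrite eq_le nm_ge0 andbT.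
apply/ler_addgt0Pr => e e0; rewrite add0r.
have e2 : 0 < e / 2 by lra.
have [t t0 tP] := cG z (F z v) (e / 2) Jz e2.
have h01 : 0 <= (1 / 2 : R) < 1 by lra.
have [n nP] := geometric_small (4 * r) h01 t0.
have [k kP] := geometric_small (4 * r) h01 e2.
have q1 : nm (F z v - Fn (n + k)%N z v) < t.
  rewrite nmC; apply: le_lt_trans (Fl _ _ _ Jz) _; rewrite mulrC; apply: nP; exact: leq_addr.
have zz : nm (z - z) < t by rewrite subrr nm0.
have := tP z _ Jz zz q1; have := Gl (n + k)%N z (Fn (n + k)%N z v) Jz.
rewrite GF// mulrC => q2 q3; have := kP (n + k)%N (leq_addl _ _) => q4.
apply: le_trans (nm_tri (G z (Fn (n + k)%N z v)) _ _) _.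
rewrite [X in _ + X]nmC; lra.
Qed.

Lemma model_conjugacy : exists h g, fibre_homeo J r h g /\ forall z v, J z -> nm v < 3 * r -> h p.[z] (m z v) = m z (T z (h z v)).
Proof.
have r0 := sf_r sf; have h01 : 0 <= (1 / 2 : R) < 1 by lra.
have [h hP] := fibre_limit conj_iter_cauchy.
have [g gP] := fibre_limit conj_inv_iter_cauchy.
have ch : contJ J h.
  by apply: (contJ_limit h01 _ hP) => n; exact: fh_cont (conj_iter_homeo n).
have cg : contJ J g.
  by apply: (contJ_limit h01 _ gP) => n; exact: fh_inv_cont (conj_iter_homeo n).
have lim0 (x : R) K : (forall n, x <= K * (1 / 2) ^+ n) -> x <= 0.
  move=> xK; apply/ler_addgt0Pr => e e0; rewrite add0r.
  have [n nP] := geometric_small K h01 e0.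
  by have := nP n (leqnn _); have := xK n; rewrite mulrC; lra.
exists h, g; split.
  split => //.
  - apply: (limit_inverse hP gP cg) => n z v Jz; exact: fh_K (conj_iter_homeo n) _ _ Jz.
  - apply: (limit_inverse gP hP ch) => n z v Jz; exact: fh_VK (conj_iter_homeo n) _ _ Jz.
  - move=> z v Jz rv; apply/eqP; rewrite eq_sym -subr_eq0; apply/eqP/nm0P/eqP.
    rewrite eq_le nm_ge0 andbT; apply: (lim0 _ (4 * r)) => n.
    by have := hP n z v Jz; rewrite (fh_out (conj_iter_homeo n)).
move=> z v Jz vr; have Jpz := (julia_horner pm sp d2 z).2 Jz.
apply/eqP; rewrite -subr_eq0; apply/eqP/nm0P/eqP.
rewrite eq_le nm_ge0 andbT; apply/ler_addgt0Pr => e e0; rewrite add0r.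
have e2 : 0 < e / 2 by lra.
have [t t0 tP] := fh_cont TS (h z v) Jz e2.
have [n nP] := geometric_small (4 * r) h01 t0.
have [k kP] := geometric_small (4 * r) h01 e2.
have q1 : nm (h z v - conj_iter (n + k)%N z v) < t.
  rewrite nmC; apply: le_lt_trans (hP _ _ _ Jz) _; rewrite mulrC; apply: nP; exact: leq_addr.
have zz : nm (z - z) < t by rewrite subrr nm0.
have q2 := tP z _ Jz zz q1.
(* Consecutive iterates satisfy the equation exactly on the sheet, and both sides converge. *)
have := hP (n + k).+1 p.[z] (m z v) Jpz; rewrite /= transport_model// => q3.
have q4 := kP (n + k).+1 (leqW (leq_addl _ _)); rewrite mulrC in q4.
apply: le_trans (nm_tri (m z (T z (conj_iter (n + k)%N z v))) _ _) _.
have q5 := sf_contract sf (T z (h z v)) (T z (conj_iter (n + k)%N z v)) Jz.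
rewrite [X in X + _]nmC [X in _ + X]nmC; lra.
Qed.

End Conjugacy.
End Sheets.

(** * Extending near-linear maps *)

Section Twists.
Variables (R : realType) (J : set (Cplx R)) (r : R).
Local Notation C := (Cplx R).
Hypothesis r_gt0 : 0 < r.
Implicit Types (F G : C -> C -> C) (z v w k : C) (e q : R).

(** The inverse at [w] is the fixed point of the half contraction [v |-> w - D z v]; comparing the
    equations in two fibres gives its joint continuity. *)
Lemma fibre_homeo_perturbation q (D : C -> C -> C) (s : R) : contJ J D ->
  (forall z v v', J z -> nm (D z v - D z v') <= nm (v - v') / 2) ->
  (forall z v, J z -> nm (D z v) <= s) ->
  (forall z v, J z -> q <= nm v -> D z v = 0) ->
  exists G, fibre_homeo J q (fun z v => v + D z v) G.
Proof.
move=> cD lip bd out.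
have ex z w : exists v, J z -> v + D z v = w.
  have [Jz|nJ] := pselect (J z); last by exists 0.
  have s0 : 0 <= s := le_trans (nm_ge0 _) (bd z 0 Jz).
  have Gs v : nm (v - w) <= s -> nm ((w - D z v) - w) <= s.
    by move=> _; rewrite addrC addKr nmN; exact: bd.
  have Gc v v' : nm (v - w) <= s -> nm (v' - w) <= s ->
      nm ((w - D z v) - (w - D z v')) <= nm (v - v') / 2.
    move=> _ _; rewrite (_ : w - D z v - (w - D z v') = - (D z v - D z v')); last by ring.
    by rewrite nmN; exact: lip.
  have [v _ vE] := half_contraction_fixpoint s0 Gs Gc.
  by exists v => _; rewrite -{1}vE subrK.
have /choice[G GP] : forall zw : C * C, exists v, J zw.1 -> v + D zw.1 v = zw.2.
  by case=> z w; exact: ex.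
have VK z w : J z -> G (z, w) + D z (G (z, w)) = w by exact: (GP (z, w)).
have inv_lip z z0 w w0 : J z -> J z0 ->
    nm (G (z0, w0) - G (z, w)) <= 2 * (nm (w0 - w) + nm (D z0 (G (z0, w0)) - D z (G (z0, w0)))).
  move=> Jz J0; have h1 := VK z w Jz; have h2 := VK z0 w0 J0.
  set v := G (z, w) in h1 *; set v0 := G (z0, w0) in h2 *.
  clearbody v v0.
  have vE : v0 - v = (w0 - w) - (D z0 v0 - D z v0) - (D z v0 - D z v).
    by rewrite -h1 -h2; ring.
  have : nm (v0 - v) <= nm (w0 - w) + nm (D z0 v0 - D z v0) + nm (D z v0 - D z v).
    rewrite {1}vE; apply: le_trans (nmD _ _) _; rewrite nmN lerD2r.
    by apply: le_trans (nmD _ _) _; rewrite nmN.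
  by have := lip z v0 v Jz; lra.
exists (fun z w => G (z, w)); split.
- by apply: contJ_add => //; exact: contJ_snd.
- move=> z0 w0 e J0 e0.
  have e4 : 0 < e / 4 by lra.
  have [t t0 tP] := cD z0 (G (z0, w0)) _ J0 e4.
  exists (Num.min t (e / 4)) => [|z w Jz]; first by rewrite lt_min t0.
  rewrite !lt_min => /andP[h1 _] /andP[_ h2].
  apply: le_lt_trans (inv_lip z z0 w w0 Jz J0) _.
  have vv : nm (G (z0, w0) - G (z0, w0)) < t by rewrite subrr nm0.
  have := tP z _ Jz h1 vv; lra.
- move=> z v Jz; have h := VK z (v + D z v) Jz.
  set u := G (z, v + D z v) in h *.
  have := lip z u v Jz.
  have -> : D z u - D z v = - (u - v).
    have -> : D z u = v + D z v - u by rewrite -h; ring.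
    by ring.
  rewrite nmN => q1; apply/eqP; rewrite -subr_eq0; apply/eqP/nm0P/eqP.
  by rewrite eq_le nm_ge0; lra.
- by move=> z v Jz; exact: VK.
- by move=> z v Jz qv; rewrite (out z v Jz qv) addr0.
Qed.

Lemma nm_dist v v' : `|nm v - nm v'| <= nm (v - v').
Proof.
rewrite ler_norml.
by have := nm_le_dist v v'; have := nm_le_dist v' v; rewrite (nmC v' v); lra.
Qed.

Lemma contJ_radial (f : R -> R) (K : R) : 0 < K ->
  (forall t t', K * `|f t - f t'| <= `|t - t'|) -> contJ J (fun _ v => rC (f (nm v))).
Proof.
move=> K0 lip z v e Jz e0; exists (K * e) => [|z' v' _ _ h]; first exact: mulr_gt0.
rewrite -rCN -rCD nm_rC -(ltr_pM2l K0).
by apply: le_lt_trans (lip _ _) _; apply: le_lt_trans h; exact: nm_dist.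
Qed.

Definition cutoff (q q' t : R) : R := Num.max 0 (Num.min 1 ((q' - t) / (q' - q))).

Lemma cutoff_ge0 q q' t : 0 <= cutoff q q' t <= 1.
Proof. by rewrite /cutoff le_max lexx /= ge_max ler01 ge_min lexx. Qed.

Lemma cutoff1 q q' t : q < q' -> t <= q -> cutoff q q' t = 1.
Proof.
move=> qq' tq; rewrite /cutoff (_ : Num.min _ _ = 1) ?maxEge ?ler01//.
  by rewrite lt_geF.
apply/min_idPl; rewrite ler_pdivlMr; lra.
Qed.

Lemma cutoff0 q q' t : q < q' -> q' <= t -> cutoff q q' t = 0.
Proof.
move=> qq' tq; rewrite /cutoff; apply/max_idPl.
by rewrite ge_min; apply/orP; right; rewrite ler_pdivrMr; lra.
Qed.

Lemma cutoff_lipschitz q q' t t' : q < q' ->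
  (q' - q) * `|cutoff q q' t - cutoff q q' t'| <= `|t - t'|.
Proof.
rewrite mulrC; move=> qq'; have d0 : 0 < q' - q by lra.
wlog tt' : t t' / t <= t'.
  move=> h; have [/h//|/h H] := orP (le_total t t').
  by rewrite (distrC (cutoff q q' t)) (distrC t).
rewrite (ler0_norm (_ : t - t' <= 0)); last lra.
have [t1|t1] := lerP q' t'.
  rewrite (cutoff0 qq' t1) subr0.
  have [t2|t2] := lerP q' t; first by rewrite (cutoff0 qq' t2) normr0 mul0r; lra.
  have [t3|t3] := lerP t q.
    by rewrite (cutoff1 qq' t3) normr1; lra.
  rewrite /cutoff.
  have h0 : 0 <= (q' - t) / (q' - q) by rewrite divr_ge0//; lra.
  have h1 : (q' - t) / (q' - q) <= 1 by rewrite ler_pdivrMr//; lra.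
  rewrite (min_idPr h1) (max_idPr h0) ger0_norm// divfK; [lra|by rewrite gt_eqF].
have [t3|t3] := lerP t' q.
  rewrite (cutoff1 qq' t3) (cutoff1 qq'); last lra.
  by rewrite subrr normr0 mul0r; lra.
have h0' : 0 <= (q' - t') / (q' - q) by rewrite divr_ge0//; lra.
have h1' : (q' - t') / (q' - q) <= 1 by rewrite ler_pdivrMr//; lra.
have -> : cutoff q q' t' = (q' - t') / (q' - q) by rewrite /cutoff (min_idPr h1') (max_idPr h0').
have [t2|t2] := lerP t q.
  rewrite (cutoff1 qq' t2) ger0_norm; last by rewrite subr_ge0.
  by rewrite mulrBl divfK ?gt_eqF//; lra.
have h0 : 0 <= (q' - t) / (q' - q) by rewrite divr_ge0//; lra.
have h1 : (q' - t) / (q' - q) <= 1 by rewrite ler_pdivrMr//; lra.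
have -> : cutoff q q' t = (q' - t) / (q' - q) by rewrite /cutoff (min_idPr h1) (max_idPr h0).
rewrite -mulrBl ger0_norm; last by rewrite divr_ge0//; lra.
by rewrite divfK ?gt_eqF//; lra.
Qed.

Lemma cutoff_perturbation_lipschitz q q' (E : C -> C) (eta s : R) :
  q < q' -> 0 <= eta -> 0 <= s ->
  (forall v v', nm v <= q' -> nm v' <= q' -> nm (E v - E v') <= eta * nm (v - v')) ->
  (forall v, nm v <= q' -> nm (E v) <= s) ->
  forall v v', nm (rC (cutoff q q' (nm v)) * E v - rC (cutoff q q' (nm v')) * E v') <=
    (eta + s / (q' - q)) * nm (v - v').
Proof.
move=> qq' eta0 s0 lip bd v v'; have d0 : 0 < q' - q by lra.
(* With [v] the inner point, the difference of the cutoffs multiplies [E v], which is controlled; if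
   [v'] is beyond [q'], its cutoff vanishes. *)
wlog vv' : v v' / nm v <= nm v'.
  move=> h; have [/h//|/h H] := orP (le_total (nm v) (nm v')).
  by rewrite [leLHS]nmC [in leRHS]nmC.
have dist := nm_dist v v'; have cl := cutoff_lipschitz (nm v) (nm v') qq'.
have n0 := nm_ge0 (v - v').
have sd : 0 <= s / (q' - q) by rewrite divr_ge0//; lra.
have [vq|vq] := lerP (nm v) q'; last first.
  rewrite (cutoff0 qq' (ltW vq)) (cutoff0 qq'); last lra.
  by rewrite rC0 !mul0r subrr nm0 mulr_ge0//; lra.
set c := cutoff q q' (nm v) in cl *; set c' := cutoff q q' (nm v') in cl *.
have cut : `|c - c'| * nm (E v) <= s / (q' - q) * nm (v - v').
  have -> : s / (q' - q) * nm (v - v') = nm (v - v') / (q' - q) * s by ring.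
  apply: ler_pM; rewrite ?nm_ge0//; last exact: bd.
  by rewrite ler_pdivlMr//; lra.
have -> : rC c * E v - rC c' * E v' = rC (c - c') * E v + rC c' * (E v - E v').
  by rewrite rCD rCN; ring.
apply: le_trans (nmD _ _) _; rewrite !nmM !nm_rC mulrDl [leRHS]addrC; apply: lerD => //.
have /andP[c0 c1] := cutoff_ge0 q q' (nm v'); rewrite -/c' in c0 c1.
rewrite ger0_norm//.
have [v'q|v'q] := lerP (nm v') q'.
  by rewrite -[leRHS]mul1r; apply: ler_pM; rewrite ?nm_ge0//; exact: lip.
by rewrite /c' (cutoff0 qq' (ltW v'q)) mul0r mulr_ge0.
Qed.

(* These multipliers form a semigroup containing a neighbourhood of 1 in the closed unit disk, hence the whole punctured unit disk; this avoids choosing an argument. *)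
Definition extendable k := exists F G, fibre_homeo J (2 * r) F G /\
  forall z v, J z -> nm v <= 6 / 5 * r -> F z v = k * v.

Lemma extendable1 : extendable 1.
Proof.
exists (fun _ v => v), (fun _ v => v); split; first exact: fibre_homeo_id.
by move=> z v _ _; rewrite mul1r.
Qed.

Lemma extendableM k k' : nm k' <= 1 -> extendable k -> extendable k' -> extendable (k * k').
Proof.
move=> k1 [F [G [fh FE]]] [F' [G' [fh' FE']]].
exists (fun z v => F z (F' z v)), (fun z v => G' z (G z v)); split.
  exact: fibre_homeo_comp.
move=> z v Jz vr; rewrite FE' // FE ?mulrA// nmM.
apply: le_trans vr; rewrite -[leRHS]mul1r; apply: ler_wpM2r => //; exact: nm_ge0.
Qed.

Lemma extendableX k n : nm k <= 1 -> extendable k -> extendable (k ^+ n).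
Proof.
move=> k1 ek; elim: n => [|n IH]; first exact: extendable1.
by rewrite exprSr; exact: extendableM.
Qed.

(** Cutting off [(k - 1) * v] between [6 / 5 * r] and [2 * r] gives the Lipschitz constant
    [nm (k - 1) * (1 + 5 / 2)], which [1 / 7] makes at most [1 / 2]. *)
Lemma extendable_near1 k : nm (k - 1) <= 1 / 7 -> extendable k.
Proof.
move=> k1; have r0 := r_gt0.
have qq' : 6 / 5 * r < 2 * r by lra.
pose D (z : C) v := rC (cutoff (6 / 5 * r) (2 * r) (nm v)) * ((k - 1) * v).
have k0 := nm_ge0 (k - 1).
have q0 : 0 < 2 * r - 6 / 5 * r by lra.
have s0 : 0 <= nm (k - 1) * (2 * r) by apply: mulr_ge0; lra.
have lip v v' : nm v <= 2 * r -> nm v' <= 2 * r ->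
    nm ((k - 1) * v - (k - 1) * v') <= nm (k - 1) * nm (v - v').
  by move=> _ _; rewrite -mulrBr nmM.
have bd v : nm v <= 2 * r -> nm ((k - 1) * v) <= nm (k - 1) * (2 * r).
  by move=> vr; rewrite nmM; apply: ler_wpM2l.
have [||||G GP] := @fibre_homeo_perturbation (2 * r) D (nm (k - 1) * (2 * r)).
- apply: contJ_mul; last by apply: contJ_mul; [exact: contJ_cst|exact: contJ_snd].
  by apply: (contJ_radial q0) => t t'; exact: cutoff_lipschitz.
- move=> z v v' _.
  apply: le_trans (cutoff_perturbation_lipschitz qq' k0 s0 lip bd v v') _.
  rewrite mulrC; apply: ler_wpM2l; first exact: nm_ge0.
  have -> : nm (k - 1) * (2 * r) / (2 * r - 6 / 5 * r) = nm (k - 1) * (5 / 2).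
    by field; rewrite gt_eqF//; lra.
  lra.
- move=> z v _; rewrite /D nmM nm_rC.
  have /andP[c0 c1] := cutoff_ge0 (6 / 5 * r) (2 * r) (nm v).
  have [vr|vr] := lerP (nm v) (2 * r).
    rewrite ger0_norm// -[leRHS]mul1r; apply: ler_pM; rewrite ?nm_ge0//; exact: bd.
  by rewrite (cutoff0 qq' (ltW vr)) normr0 mul0r.
- by move=> z v _ vr; rewrite /D (cutoff0 qq' vr) rC0 mul0r.
exists (fun z v => v + D z v), G; split; first exact: GP.
by move=> z v _ vr; rewrite /D (cutoff1 qq' vr) rC1 mul1r mulrBl mul1r addrC subrK.
Qed.

Lemma nm_sqr z : nm z ^+ 2 = complex.Re z ^+ 2 + complex.Im z ^+ 2.
Proof.
apply: rC_inj; transitivity (`|z| ^+ 2 : C).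
  by rewrite expr2 rCM rC_nm -expr2.
by symmetry; exact: (@add_Re2_Im2 R).
Qed.

Lemma sqrt_right_half z : nm z = 1 -> exists2 w, w ^+ 2 = z & nm w = 1 /\ 0 <= complex.Re w.
Proof.
move=> z1; have sq : sqrtC z ^+ 2 = z := sqrtCK z.
have n1 (w : C) : w ^+ 2 = z -> nm w = 1.
  move=> wz; have w0 := nm_ge0 w.
  have : nm w ^+ 2 = 1 by rewrite -nmX wz.
  by move/eqP; rewrite sqrf_eq1 => /orP[/eqP //|/eqP h]; lra.
have [re|re] := lerP 0 (complex.Re (sqrtC z)).
  by exists (sqrtC z) => //; split; [exact: n1|].
have sq' : (- sqrtC z) ^+ 2 = z by rewrite sqrrN.
exists (- sqrtC z) => //; split; first exact: n1.
have -> : complex.Re (- sqrtC z) = - complex.Re (sqrtC z) by case: (sqrtC z).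
lra.
Qed.

(* Square roots with nonnegative real part at least halve [nm (w - 1) ^+ 2]. *)
Lemma unit_root_near1 (u : C) n : nm u = 1 ->
  exists2 w, w ^+ (2 ^ n) = u & nm w = 1 /\ nm (w - 1) ^+ 2 <= 4 * (1 / 2) ^+ n.
Proof.
move=> u1; elim: n => [|n [w wu [w1 wn]]].
  exists u; first by rewrite expn0 expr1.
  split => //; rewrite expr0 mulr1.
  have := nmD u (-1); rewrite nmN nm1 u1 => h.
  have -> : 4 = (1 + 1) ^+ 2 :> R by lra.
  by apply: lerXn2r; rewrite ?nnegrE ?nm_ge0//; lra.
have [w' w'w [w'1 re]] := sqrt_right_half w1.
exists w'; first by rewrite expnS exprM w'w.
split => //.
have sqD : nm (w' + 1) ^+ 2 = 2 + 2 * complex.Re w'.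
  have := nm_sqr w'; rewrite w'1 nm_sqr.
  have -> : complex.Re (w' + 1) = complex.Re w' + 1 by case: (w').
  have -> : complex.Im (w' + 1) = complex.Im w' by case: (w') => a b /=; rewrite addr0.
  rewrite !expr2; lra.
have : nm (w - 1) ^+ 2 = nm (w' - 1) ^+ 2 * nm (w' + 1) ^+ 2.
  by rewrite -!nmX -nmM -w'w; congr nm; ring.
rewrite sqD [(1 / 2) ^+ n.+1]exprS => E.
have := nm_ge0 (w' - 1) => m0; have : 0 <= nm (w' - 1) ^+ 2 by apply: exprn_ge0.
move=> m1; have := mulr_ge0 m1 re; lra.
Qed.

Lemma extendable_unit (u : C) : nm u = 1 -> extendable u.
Proof.
move=> u1; have h01 : 0 <= (1 / 2 : R) < 1 by lra.
have e0 : 0 < (1 / 7 : R) ^+ 2 by rewrite exprn_gt0//; lra.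
have [n nP] := geometric_small 4 h01 e0.
have [w wu [w1 wn]] := unit_root_near1 n u1.
rewrite -wu; apply: extendableX; first by rewrite w1.
apply: extendable_near1.
have := nP n (leqnn _) => h.
have : nm (w - 1) ^+ 2 < (1 / 7) ^+ 2 by lra.
by rewrite ltr_pXn2r ?nnegrE ?nm_ge0//; exact: ltW.
Qed.

(** [t] is a power of [6 / 7] times a number between [6 / 7] and 1, a range covered by
    [extendable_near1]. *)
Lemma extendable_positive (t : R) : 0 < t <= 1 -> extendable (rC t).
Proof.
move=> /andP[t0 t1].
have near1 (c : R) : 6 / 7 <= c <= 1 -> extendable (rC c).
  move=> c1; apply: extendable_near1; rewrite -rC1 -rCN -rCD nm_rC ler_norml; lra.
have h01 : 0 <= (6 / 7 : R) < 1 by lra.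
have [n nP] := geometric_small 1 h01 t0.
have : (6 / 7) ^+ n < t by have := nP n (leqnn _); rewrite mulr1.
clear nP; elim: n t t0 t1 => [|n IH] t t0 t1 h; first by rewrite expr0 in h; lra.
have [tc|tc] := lerP (6 / 7) t; first by apply: near1; rewrite tc.
have -> : rC t = rC (6 / 7) * rC (t / (6 / 7)) by rewrite -rCM; congr rC; field.
have pos : 0 < t / (6 / 7) by lra.
have le1 : t / (6 / 7) <= 1 by lra.
apply: extendableM; first by rewrite nm_rC ger0_norm//; lra.
  by apply: near1; lra.
apply: IH => //; rewrite exprS in h; lra.
Qed.

Lemma extendable_all k : 0 < nm k <= 1 -> extendable k.
Proof.
move=> /andP[k0 k1].
have -> : k = k / rC (nm k) * rC (nm k).
  by rewrite divfK// -nm_gt0 nm_rC ger0_norm// ltW.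
apply: extendableM; first by rewrite nm_rC ger0_norm// ltW.
  apply: extendable_unit; rewrite nmM nmV nm_rC ger0_norm ?(ltW k0)// divff//.
  by rewrite gt_eqF.
by apply: extendable_positive; rewrite k0.
Qed.

(** Write [T z v = k * (v + E z v)]. As [E] is at most [r / 5], the disc of radius [r] goes into
    that of radius [6 / 5 * r], where multiplication by [k] has been extended; the cut-off of [E]
    has Lipschitz constant at most [1 / 20 + 1 / 5]. *)
Lemma extend_perturbed_linear (T : C -> C -> C) k (eta : R) : 0 < nm k <= 1 -> 0 <= eta <= 1 / 20 ->
  contJ J T ->
  (forall z v v', J z -> nm v <= 2 * r -> nm v' <= 2 * r ->
     nm (T z v - T z v' - k * (v - v')) <= eta * nm k * nm (v - v')) ->
  (forall z, J z -> nm (T z 0) <= nm k * (r / 10)) ->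
  exists F G, fibre_homeo J (2 * r) F G /\ forall z v, J z -> nm v <= r -> F z v = T z v.
Proof.
move=> k01 /andP[eta0 eta1] cT lip T0; have r0 := r_gt0; case/andP: (k01) => k0 k1.
have kn0 : k != 0 by rewrite -nm_gt0.
have qq' : r < 2 * r by lra.
pose E z v := T z v / k - v.
have Elip z v v' : J z -> nm v <= 2 * r -> nm v' <= 2 * r ->
    nm (E z v - E z v') <= eta * nm (v - v').
  move=> Jz vr v'r; rewrite -(ler_pM2l k0) -nmM.
  have -> : k * (E z v - E z v') = T z v - T z v' - k * (v - v') by rewrite /E; field.
  by apply: le_trans (lip z v v' Jz vr v'r) _; rewrite mulrA (mulrC eta).
have Ebd z v : J z -> nm v <= 2 * r -> nm (E z v) <= r / 5.
  move=> Jz vr; have zr : nm (0 : C) <= 2 * r by rewrite nm0; lra.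
  have := Elip z v 0 Jz vr zr; rewrite subr0 => h1.
  have h2 : nm (E z 0) <= r / 10.
    by rewrite /E subr0 nmM nmV ler_pdivrMr// mulrC; exact: T0.
  have h3 : eta * nm v <= 1 / 20 * (2 * r) by apply: ler_pM; rewrite ?nm_ge0.
  have := nm_le_dist (E z v) (E z 0); lra.
pose D z v := rC (cutoff r (2 * r) (nm v)) * E z v.
have s0 : 0 <= r / 5 by lra.
have q0 : 0 < 2 * r - r by lra.
have [||||G GP] := @fibre_homeo_perturbation (2 * r) D (r / 5).
- apply: contJ_mul.
    by apply: (contJ_radial q0) => t t'; exact: cutoff_lipschitz.
  apply: contJ_add; last by apply: contJ_opp; exact: contJ_snd.
  by apply: contJ_mul => //; exact: contJ_cst.
- move=> z v v' Jz.
  apply: le_trans (cutoff_perturbation_lipschitz qq' eta0 s0 (fun v v' => @Elip z v v' Jz) (fun v => @Ebd z v Jz) v v') _.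
  rewrite mulrC; apply: ler_wpM2l; first exact: nm_ge0.
  have -> : r / 5 / (2 * r - r) = 1 / 5 by field; rewrite gt_eqF//; lra.
  lra.
- move=> z v Jz; rewrite /D nmM nm_rC.
  have /andP[c0 c1] := cutoff_ge0 r (2 * r) (nm v).
  have [vr|vr] := lerP (nm v) (2 * r).
    rewrite ger0_norm// -[leRHS]mul1r; apply: ler_pM; rewrite ?nm_ge0//; exact: Ebd.
  by rewrite (cutoff0 qq' (ltW vr)) normr0 mul0r.
- by move=> z v _ vr; rewrite /D (cutoff0 qq' vr) rC0 mul0r.
have [F [G' [fh FE]]] := extendable_all k01.
exists (fun z v => F z (v + D z v)), (fun z v => G z (G' z v)); split.
  exact: (fibre_homeo_comp fh GP).
move=> z v Jz vr.
have DE : v + D z v = T z v / k.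
  by rewrite /D (cutoff1 qq' vr) rC1 mul1r /E addrC subrK.
rewrite FE //; first by rewrite DE mulrC divfK.
rewrite /D (cutoff1 qq' vr) rC1 mul1r; apply: le_trans (nmD _ _) _.
have vr2 : nm v <= 2 * r by lra.
have := Ebd z v Jz vr2; lra.
Qed.

End Twists.

(** * The local model of the Hénon map *)

Section LocalModel.
Variable R : realType.
Local Notation C := (Cplx R).
Variables (p : {poly C}) (d : nat) (rho : C -> R) (M lam del s R1 L r R0 t : R).
Hypotheses (fr : frame p d rho M lam del s R1 L r) (ef : escape_frame p d lam del s R1 r R0 t).
Variables (eps D : R).
Local Notation J := (julia p).
Local Notation H := (henon p).
Local Notation sh := (shadow p s).
Local Notation cst := (2 * M / (lam - 1)).
Local Notation m := (model_fibre p eps).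
Implicit Types (z v y : C) (w x : C * C) (e : R).
Hypotheses (sf : sheet_frame p eps r) (DP : forall z, J z -> nm p^`().[z] <= D)
  (epsR1 : eps * R1 < r) (epsD : D * (cst * R1) * eps <= r / 10).

(** [mp_eps] gives [nm (a / eps) <= 1 / 2], so that the disc of radius [2 * r] is rescaled into the
    domain of [graph]; [mp_lin] turns the error of [graph_linear] into the relative error [1 / 20]
    allowed above. *)
Record model_param (a : C) : Prop := ModelParam {
  mp_small : small_param M lam s R1 r a;
  mp_escape : escape_param p rho M lam s r R0 t a;
  mp_eps : nm a <= eps / 2;
  mp_lin : (2 * L * r + 1) * cst ^+ 2 * nm a <= 1 / 20 }.

(* [graph z] is only controlled on the disk of radius [r]; precomposing it with [clamp] gives a map continuous over all of J x C. *)
Definition clamp y : C := y * (rC r * (rC (Num.max r (nm y)))^-1).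

Lemma clamp_id y : nm y <= r -> clamp y = y.
Proof.
move=> yr; have r0 := fr_r fr; rewrite /clamp (max_idPl yr) mulfV ?mulr1//.
by rewrite -nm_gt0 nm_rC ger0_norm ?ltW.
Qed.

Lemma clamp_le y : nm (clamp y) <= r.
Proof.
have r0 := fr_r fr; have mr : r <= Num.max r (nm y) by rewrite le_max lexx.
have m0 : 0 < Num.max r (nm y) by lra.
rewrite /clamp !nmM nmV !nm_rC !ger0_norm; [|lra|lra].
rewrite mulrA ler_pdivrMr// mulrC; apply: ler_wpM2l; first lra.
by rewrite le_max lexx orbT.
Qed.

Lemma contJ_clamp : contJ J (fun _ v => clamp v).
Proof.
have r0 := fr_r fr.
apply: contJ_mul; first exact: contJ_snd.
apply: contJ_mul; first exact: contJ_cst.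
apply: contJ_inv => [|z v _]; last first.
  rewrite -nm_gt0 nm_rC ger0_norm; last by rewrite le_max ltW.
  by rewrite lt_max r0.
apply: (@contJ_radial _ _ (fun u => Num.max r u) 1) => // u u'; rewrite mul1r.
by rewrite !maxEle; case: ifP => h; case: ifP => h'; rewrite ?subrr ?normr0 // ler_norml; 
  apply/andP; split; have := ler_norm (u - u'); have := ler_norm (u' - u); rewrite ?(distrC u' u); lra.
Qed.

Section FixedParameter.
Variable a : C.
Hypothesis mp : model_param a.
Let sm := mp_small mp.
Let ep := mp_escape mp.
Local Notation q := (a / rC eps).
Local Notation gr := (graph p s a).

Lemma q_neq0 : q != 0.
Proof.
by rewrite mulf_neq0 ?(ep_neq0 ep)// invr_eq0 (rC_eps_neq0 sf).
Qed.

Lemma nm_q : nm q = nm a / eps.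
Proof. by rewrite nmM nmV nm_rC ger0_norm// ltW// (sf_eps sf). Qed.

Lemma nm_q_half : nm q <= 1 / 2.
Proof.
have e0 := sf_eps sf; have := mp_eps mp.
by rewrite nm_q ler_pdivrMr//; lra.
Qed.

Lemma nm_q_gt0 : 0 < nm q.
Proof. by rewrite nm_gt0 q_neq0. Qed.

(* In the coordinate [y = q v] the Henon map sends [v] to [eps * graph z (q * v)] in the next fibre, and this is [m z (inner_map z v)]. *)
Definition inner_map z v : C := - (p^`().[z] / rC eps) * (gr z (clamp (q * v)) - z).

Lemma nm_qM v : nm v <= 2 * r -> nm (q * v) <= r.
Proof.
move=> vr; rewrite nmM; have := nm_q_half; have := nm_q_gt0; have := nm_ge0 v => h1 h2 h3.
have : nm q * nm v <= 1 / 2 * (2 * r) by apply: ler_pM; lra.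
lra.
Qed.

Lemma contJ_graph_clamp : contJ J (fun z v => gr z (clamp v)).
Proof.
move=> z v e Jz e0.
have [u u0 uP] := graph_continuous fr sm Jz (clamp_le v) e0.
have [u' u'0 u'P] := contJ_clamp v Jz u0.
exists (Num.min u u') => [|z' v' Jz']; first by rewrite lt_min u0.
rewrite !lt_min => /andP[h1 h2] /andP[h3 h4].
exact: (uP _ _ Jz' (clamp_le _) h1 (u'P _ _ Jz' h2 h4)).
Qed.

Lemma contJ_inner_map : contJ J inner_map.
Proof.
apply: contJ_mul.
  by apply: contJ_opp; apply: contJ_mul; [exact: contJ_horner|exact: contJ_cst].
apply: contJ_add; last by apply: contJ_opp; exact: contJ_fst.
apply: (contJ_comp contJ_graph_clamp).
by apply: contJ_mul; [exact: contJ_cst|exact: contJ_snd].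
Qed.

Lemma inner_map_linear z v v' : J z -> nm v <= 2 * r -> nm v' <= 2 * r ->
  nm (inner_map z v - inner_map z v' - q ^+ 2 * (v - v')) <= 1 / 20 * nm (q ^+ 2) * nm (v - v').
Proof.
move=> Jz vr v'r; have e0 := sf_eps sf; have En := rC_eps_neq0 sf.
rewrite /inner_map !clamp_id; try exact: nm_qM.
have := graph_linear fr sm Jz (nm_qM vr) (nm_qM v'r).
set X := gr z (q * v); set X' := gr z (q * v') => h.
have -> : - (p^`().[z] / rC eps) * (X - z) - - (p^`().[z] / rC eps) * (X' - z) - q ^+ 2 * (v - v')
  = - ((p^`().[z] * (X - X') + a * (q * v - q * v')) / rC eps).
  by field.
rewrite nmN nmM nmV nm_rC ger0_norm; last exact: ltW.
rewrite ler_pdivrMr//; apply: le_trans h _.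
rewrite -mulrBr nmM nmX.
have aq : nm a = nm q * eps by rewrite nm_q divfK// gt_eqF.
have -> : 1 / 20 * nm q ^+ 2 * nm (v - v') * eps = 1 / 20 * (nm a * nm q * nm (v - v')).
  by rewrite [in RHS]aq; ring.
have -> : (2 * L * r + 1) * cst ^+ 2 * nm a ^+ 2 * (nm q * nm (v - v')) =
   ((2 * L * r + 1) * cst ^+ 2 * nm a) * (nm a * nm q * nm (v - v')) by ring.
apply: ler_wpM2r; last exact: mp_lin mp.
by apply: mulr_ge0; rewrite ?nm_ge0//; apply: mulr_ge0; rewrite nm_ge0.
Qed.

Lemma inner_map0 z : J z -> nm (inner_map z 0) <= nm (q ^+ 2) * (r / 10).
Proof.
move=> Jz; have e0 := sf_eps sf; have r0 := fr_r fr; have c0 := cst_ge0 fr.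
have R10 := fr_R1_ge0 fr.
rewrite /inner_map mulr0 clamp_id; last by rewrite nm0 ltW.
rewrite nmM nmN nmM nmV nm_rC (ger0_norm (ltW e0)).
have h1 := graph_close0 fr sm Jz; have h2 := DP Jz.
have D0 : 0 <= D := le_trans (nm_ge0 _) h2.
rewrite mulrAC ler_pdivrMr//.
apply: le_trans (ler_pM (nm_ge0 _) (nm_ge0 _) h2 h1) _.
have aq : nm a = nm q * eps by rewrite nm_q divfK// gt_eqF.
rewrite nmX aq.
have -> : D * (cst * (nm q * eps * (nm q * eps * R1))) = (nm q ^+ 2 * eps) * (D * (cst * R1) * eps).
  by ring.
have -> : nm q ^+ 2 * (r / 10) * eps = (nm q ^+ 2 * eps) * (r / 10) by ring.
apply: ler_wpM2l => //; apply: mulr_ge0; last exact: ltW.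
by apply: exprn_ge0; exact: nm_ge0.
Qed.

Lemma inner_conjugacy : exists h g, fibre_homeo J r h g /\ (forall z v, J z -> nm v < r ->
  h p.[z] (m z v) = rC eps * gr z (q * h z v)).
Proof.
have r0 := fr_r fr; have e0 := sf_eps sf; have qh := nm_q_half; have q0 := nm_q_gt0.
have pm := fr_monic fr; have sp := fr_size fr; have d2 := fr_deg fr.
have k1 : 0 < nm (q ^+ 2) <= 1 / 4.
  rewrite nmX exprn_gt0//= (_ : 1 / 4 = (1 / 2) ^+ 2); last by lra.
  by apply: lerXn2r; rewrite ?nnegrE; lra.
have k01 : 0 < nm (q ^+ 2) <= 1 by lra.
have eta01 : 0 <= (1 / 20 : R) <= 1 / 20 by lra.
have [T [S [TS TE]]] := extend_perturbed_linear r0 k01 eta01 contJ_inner_map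
  (fun z v v' Jz vr v'r => inner_map_linear Jz vr v'r) (fun z Jz => inner_map0 Jz).
(* The multiplier is at most [1 / 4] and the error at most [1 / 20] of it. *)
have Tlip z v v' : J z -> nm v < r -> nm v' < r -> nm (T z v - T z v') <= nm (v - v').
  move=> Jz vr v'r; rewrite !TE //; try exact: ltW.
  have vr2 : nm v <= 2 * r by lra.
  have v'r2 : nm v' <= 2 * r by lra.
  have h1 := inner_map_linear Jz vr2 v'r2.
  have h2 := nm_le_dist (inner_map z v - inner_map z v') (q ^+ 2 * (v - v')).
  rewrite nmM in h2.
  have v0 := nm_ge0 (v - v').
  have h3 : nm (q ^+ 2) * nm (v - v') <= 1 / 4 * nm (v - v').
    by apply: ler_wpM2r => //; case/andP: k1.
  lra.
have [h [g [hg hE]]] := model_conjugacy pm sp d2 sf TS Tlip.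
exists h, g; split; first exact: hg.
move=> z v Jz vr; rewrite hE//; last lra.
have hr := fibre_homeo_lt hg (lexx r) Jz vr.
rewrite TE //; last exact: ltW.
rewrite /inner_map clamp_id; last by apply: nm_qM; lra.
rewrite /model_fibre /model_map /=.
by field; rewrite (sf_deriv sf Jz) (rC_eps_neq0 sf).
Qed.

(** The interface between the local dynamics and the inductive limit: [lm_open] is openness onto the
    image relative to [Jplus], with a continuous local inverse. *)
Record local_model (Th : C * C -> C * C) : Prop := LocalModel {
  lm_J : forall w, model_domain p r w -> Jplus p a (Th w);
  lm_conj : forall w, model_domain p r w -> H a (Th w) = Th (model_map p eps w);
  lm_cont : forall w e, model_domain p r w -> 0 < e -> exists2 u : R, 0 < u &
    forall w', model_domain p r w' -> nm (w.1 - w'.1) < u -> nm (w.2 - w'.2) < u ->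
      nm ((Th w).1 - (Th w').1) < e /\ nm ((Th w).2 - (Th w').2) < e;
  lm_open : forall w e, model_domain p r w -> 0 < e -> exists2 u : R, 0 < u &
    forall x, Jplus p a x -> nm ((Th w).1 - x.1) < u -> nm ((Th w).2 - x.2) < u ->
      exists w', [/\ model_domain p r w', Th w' = x, nm (w.1 - w'.1) < e & nm (w.2 - w'.2) < e];
  lm_inj : forall w w', model_domain p r w -> model_domain p r w' -> Th w = Th w' -> w = w';
  lm_exhaust : forall x, Jplus p a x -> exists n w, model_domain p r w /\ iter n (H a) x = Th w }.

Lemma model_domainP w : model_domain p r w <-> J w.1 /\ nm w.2 < r.
Proof. by rewrite /model_domain /disk /setX /= -rC_nm rC_lt. Qed.

Lemma local_model_exists : exists Th, local_model Th.
Proof.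
have [h [g [hg hE]]] := inner_conjugacy.
have gh := fibre_homeo_sym hg.
have r0 := fr_r fr; have e0 := sf_eps sf; have q0 := nm_q_gt0; have qn := q_neq0.
have R0R1 := ef_R1 ef; have rR := ef_r ef; have qh := nm_q_half.
pose Th w := (gr w.1 (q * h w.1 w.2), q * h w.1 w.2).
have qr v : nm v < r -> nm (q * v) < nm q * r by move=> vr; rewrite nmM ltr_pM2l.
have qrr : nm q * r <= r.
  by rewrite -[leRHS]mul1r; apply: ler_wpM2r; lra.
have hr z v : J z -> nm v < r -> nm (q * h z v) < nm q * r.
  by move=> Jz vr; apply: qr; exact: (fibre_homeo_lt hg (lexx r) Jz vr).
have hr' z v : J z -> nm v < r -> nm (q * h z v) <= r.
  by move=> Jz vr; have := hr z v Jz vr; lra.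
have Thsh w : J w.1 -> nm w.2 < r -> sh a w.1 (Th w).
  by move=> Jw wr; apply: (graphP fr sm Jw); exact: hr'.
have surj z x : J z -> sh a z x -> nm x.2 < nm q * r ->
    nm (g z (x.2 / q)) < r /\ Th (z, g z (x.2 / q)) = x.
  move=> Jz sx xr.
  have ur : nm (x.2 / q) < r by rewrite nmM nmV ltr_pdivrMr// mulrC.
  split; first exact: (fibre_homeo_lt gh (lexx r) Jz ur).
  rewrite /Th /= (fh_VK hg)// mulrC divfK// -(graph_unique fr sm Jz _ sx); last by lra.
  by rewrite -surjective_pairing.
exists Th; split.
- move=> w /model_domainP[Jw wr].
  by apply: (shadow_Jplus fr ef sm ep Jw (Thsh w Jw wr)); exact: hr'.
- move=> [z v] /model_domainP[/= Jz vr].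
  rewrite /henon /Th /=.
  have hE' := hE z v Jz vr; rewrite /model_fibre /model_map /= in hE'.
  rewrite hE' (graph_henon fr sm Jz (hr' z v Jz vr)).
  have -> : q * (rC eps * gr z (q * h z v)) = a * gr z (q * h z v).
    by rewrite mulrA divfK// (rC_eps_neq0 sf).
  by [].
- move=> [z v] e /model_domainP[/= Jz vr] e'0.
  have cq : contJ J (fun z v => q * h z v).
    by apply: contJ_mul; [exact: contJ_cst|exact: (fh_cont hg)].
  have [u u0 uP] := contJ_comp contJ_graph_clamp cq v Jz e'0.
  have [u' u'0 u'P] := cq z v e Jz e'0.
  exists (Num.min u u'); first by rewrite lt_min u0.
  move=> [z' v'] /model_domainP[/= Jz' v'r]; rewrite !lt_min => /andP[h1 h2] /andP[h3 h4].
  split; last exact: u'P.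
  have := uP z' v' Jz' h1 h3; rewrite !clamp_id //; exact: hr'.
- move=> [z v] e /model_domainP[/= Jz vr] e'0.
  have sw := Thsh (z, v) Jz vr.
  have cg : contJ J (fun z y => g z (y / q)).
    apply: (contJ_comp (fh_inv_cont hg)).
    by apply: contJ_mul; [exact: contJ_snd|exact: contJ_cst].
  have [u u0 uP] := cg z (q * h z v) e Jz e'0.
  have ue0 : 0 < Num.min u e by rewrite lt_min u0.
  have [u' u'0 u'P] := shadow_base_continuous fr sm Jz sw ue0.
  have slack : 0 < nm q * r - nm (q * h z v) by have := hr z v Jz vr; lra.
  (* The bound 1 keeps the first coordinate of [x] below [R0], as [R1 + 1 <= R0]; the slack keeps
     the second one in the image disc. *)
  exists (Num.min (Num.min u u') (Num.min 1 (nm q * r - nm (q * h z v)))).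
    by rewrite !lt_min u0 u'0 ltr01.
  move=> x Jx; rewrite !lt_min => /andP[/andP[_ h1] /andP[h2 _]] /andP[/andP[h3 h4] /andP[_ h5]].
  have x2 : nm x.2 < nm q * r by have := nm_le_dist x.2 (q * h z v); rewrite nmC; lra.
  have x1 : nm x.1 <= R0.
    have := shadow_fst_R1 fr Jz sw; have := nm_le_dist x.1 (gr z (q * h z v)).
    rewrite nmC /= => i1 i2; rewrite /= in h2; lra.
  have [z' Jz' sx] := Jplus_shadow fr ef sm ep Jx x1 (le_trans (ltW x2) qrr).
  have [v'r ThE] := surj z' x Jz' sx x2.
  have := u'P z' x Jz' sx h1 h4; rewrite lt_min => /andP[i1 i2].
  exists (z', g z' (x.2 / q)); split => //=.
    by apply/model_domainP.
  have := uP z' x.2 Jz' i1 h3.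
  by rewrite [q * _ / q]mulrC mulKf// (fh_K hg).
- move=> [z v] [z' v'] /model_domainP[/= Jz vr] /model_domainP[/= Jz' v'r] E.
  have s1 := Thsh (z, v) Jz vr; have s2 := Thsh (z', v') Jz' v'r.
  rewrite -E in s2; have zz := shadow_base_unique fr Jz Jz' s1 s2.
  move: E => [_ /(mulfI qn)]; rewrite -zz => hh; congr pair.
  by rewrite -(fh_K hg v Jz) hh (fh_K hg).
- move=> x Jx.
  have [n [z Jz [sx x2]]] := Jplus_eventually_shadow fr ef sm ep Jx.
  (* This is where [eps * R1 < r] makes the local model absorb all of [Jplus]. *)
  have x2' : nm (iter n (H a) x).2 < nm q * r.
    apply: le_lt_trans x2 _.
    have -> : nm a * R1 = nm q * (eps * R1) by rewrite nm_q mulrA divfK// gt_eqF.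
    by rewrite ltr_pM2l.
  have [vr ThE] := surj z _ Jz sx x2'.
  exists n, (z, g z ((iter n (H a) x).2 / q)); split; last exact: esym ThE.
  by apply/model_domainP.
Qed.

End FixedParameter.
End LocalModel.

(** * The inductive limit *)

Section Assembly.
Variables (R : realType) (p : {poly Cplx R}) (r eps : R) (a : Cplx R).
Local Notation C := (Cplx R).
Local Notation H := (henon p a).
Local Notation Hinv := (henon_inv p a).
Local Notation dom := (model_domain p r).
Variables (hpsi : set_fun dom dom (model_map p eps)) (Th : C * C -> C * C).
Hypotheses (a0 : a != 0) (lm : local_model p r eps a Th)
  (JplusH : forall x, Jplus p a (H x) <-> Jplus p a x).
Implicit Types (x w : C * C) (n : nat).

Local Notation psi := (restrict_self hpsi).
Local Notation T := (set_type dom).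

Definition near2 (e : R) x w := nm (x.1 - w.1) < e /\ nm (x.2 - w.2) < e.

Lemma set_type_nbhsP (A : set (C * C)) (u : set_type A) (U : set (set_type A)) :
  nbhs u U <-> exists2 e : R, 0 < e & forall v : set_type A, near2 e (\val u) (\val v) -> U v.
Proof.
split.
  case=> _ [[W oW <-] Wu] WU.
  have : nbhs ((\val u).1, (\val u).2) W.
    by rewrite -surjective_pairing; apply: open_nbhs_nbhs.
  move=> /nbhs2_nmP[e e0 eW]; exists e => // v [h1 h2]; apply: WU => /=.
  by have := eW _ _ h1 h2; rewrite -surjective_pairing.
move=> [e e0 eU].
have : nbhs (set_val u) [set w : C * C | near2 e (\val u) w].
  rewrite [set_val u]surjective_pairing; apply/nbhs2_nmP.
  by exists e => // x' y' h1 h2; split.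
move=> /(@initial_continuous _ _ (@set_val _ A) u) h.
apply: (@filterS _ (nbhs u) (nbhs_filter u) _ _ _ h) => v /=.
exact: eU.
Qed.

Lemma Hinv_iter_continuous n w (e : R) : 0 < e -> exists2 t : R, 0 < t & forall w',
  near2 t w w' -> near2 e (iter n Hinv w) (iter n Hinv w').
Proof.
elim: n e => [|n IH] e e0; first by exists e.
have [t t0 tP] := henon_inv_continuous p a0 (iter n Hinv w) e0.
have [u u0 uP] := IH t t0; exists u => // w' /uP[h1 h2].
exact: tP.
Qed.

Lemma iter_henonK n : cancel (iter n H) (iter n Hinv).
Proof. by move=> x; elim: n => // n IH; rewrite iterSr [iter n.+1 H x]iterS (henonK p a0). Qed.

Lemma iter_henon_invK n : cancel (iter n Hinv) (iter n H).
Proof. by move=> x; elim: n => // n IH; rewrite iterSr [iter n.+1 Hinv x]iterS (henon_invK p a0). Qed.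

Lemma Jplus_Hinv_iter n x : Jplus p a (iter n Hinv x) <-> Jplus p a x.
Proof.
elim: n => [|n IH]; first by split.
have := JplusH (Hinv (iter n Hinv x)); rewrite (henon_invK p a0) iterS => E.
exact: iff_trans (iff_sym E) IH.
Qed.

Lemma val_dom (u : T) : dom (\val u).
Proof. exact: set_mem (valP u). Qed.

Definition unfold (u : T * nat) : C * C := iter u.2 Hinv (Th (\val u.1)).

Lemma unfold_Jplus u : Jplus p a (unfold u).
Proof. exact: (Jplus_Hinv_iter _ _).2 (lm_J lm (val_dom _)). Qed.

Definition unfoldJ (u : T * nat) : set_type (Jplus p a) := SigSub (mem_set (unfold_Jplus u)).

Lemma val_psi (u : T) : \val (psi u) = model_map p eps (\val u).
Proof. by []. Qed.

Lemma Th_psi_iter k (u : T) : Th (\val (iter k psi u)) = iter k H (Th (\val u)).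
Proof.
elim: k => [//|k IH]; rewrite iterS val_psi -(lm_conj lm); last exact: val_dom.
by rewrite IH.
Qed.

Lemma indlim_in_iter k n (u : T) : indlim_in psi (iter k psi u, (n + k)%N) = indlim_in psi (u, n).
Proof.
elim: k => [|k IH]; first by rewrite addn0.
by rewrite iterS addnS indlim_in_succ.
Qed.

(** Iterating [H] up to the later of the two levels gives two values of [Th], whose injectivity
    shows that one base point is an iterate of the other under [psi]. *)
Lemma unfold_inj u v : unfold u = unfold v -> indlim_in psi u = indlim_in psi v.
Proof.
case: u v => [u n] [v n'].
wlog nn' : u v n n' / (n <= n')%N.
  by move=> h E; have [/h|/h h'] := orP (leq_total n n'); [exact|symmetry; exact: h'].
rewrite -(subnKC nn'); move: (n' - n)%N => k {nn' n'}.
rewrite /unfold /= => /(congr1 (iter (n + k) H)).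
rewrite [(n + k)%N]addnC iterD iter_henon_invK -Th_psi_iter [(k + n)%N]addnC iter_henon_invK.
move=> /(lm_inj lm (val_dom _) (val_dom _))/val_inj <-.
by rewrite indlim_in_iter.
Qed.

Lemma unfold_step (u : T) n : unfold (psi u, n.+1) = unfold (u, n).
Proof.
rewrite /unfold /= -iterS iterSr -(lm_conj lm (val_dom u)) ?val_psi.
by rewrite (henonK p a0).
Qed.

Lemma unfold_eqv u v : indlim_in psi u = indlim_in psi v -> unfold u = unfold v.
Proof.
move=> /indlim_inP; elim=> {u v} [[u n] _ ->|//|//|u v w _ -> _ //] /=.
by rewrite unfold_step.
Qed.

Definition unfold_lim (q : indlim psi) : set_type (Jplus p a) := unfoldJ (repr q).

Lemma unfold_limE u : unfold_lim (indlim_in psi u) = unfoldJ u.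
Proof.
apply: val_inj; rewrite /unfold_lim /=; apply: unfold_eqv.
exact: reprK.
Qed.

Lemma indlim_inS (q : indlim psi) : exists u, q = indlim_in psi u.
Proof. by exists (repr q); symmetry; exact: reprK. Qed.

Lemma unfoldJ_continuous : continuous unfoldJ.
Proof.
move=> [u n] U /set_type_nbhsP[e e0 eU].
have [t t0 tP] := Hinv_iter_continuous n (Th (\val u)) e0.
have [s s0 sP] := lm_cont lm (val_dom u) t0.
exists ([set v : T | near2 s (\val u) (\val v)], [set n]) => /=.
  by split; [apply/set_type_nbhsP; exists s|exact: discrete_set1].
move=> [v k] [/= [h1 h2] ->]; apply: eU => /=; apply: tP.
exact: (sP _ (val_dom v) h1 h2).
Qed.

Lemma unfold_lim_continuous : continuous unfold_lim.
Proof.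
apply: repr_comp_continuous; first exact: unfoldJ_continuous.
move=> u v /eqP E; apply/eqP/val_inj => /=; exact: unfold_eqv E.
Qed.

Lemma unfold_lim_inj : injective unfold_lim.
Proof.
move=> q q'; have [u ->] := indlim_inS q; have [v ->] := indlim_inS q'.
by rewrite !unfold_limE => /(congr1 val) /unfold_inj.
Qed.

Lemma unfold_lim_onto (y : set_type (Jplus p a)) : exists (u : T) n,
  iter n H (\val y) = Th (\val u) /\ unfold_lim (indlim_in psi (u, n)) = y.
Proof.
have [n [w [dw E]]] := lm_exhaust lm (set_mem (valP y)).
pose u : T := SigSub (mem_set dw); exists u, n; split; first exact: E.
by rewrite unfold_limE; apply: val_inj; rewrite /= /unfold /= -E iter_henonK.
Qed.

Lemma unfold_lim_homeomorphism : is_homeomorphism unfold_lim.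
Proof.
split; first exact: unfold_lim_continuous.
have /choice[g gP] : forall y, exists q, unfold_lim q = y.
  by move=> y; have [u [n [_ E]]] := unfold_lim_onto y; exists (indlim_in psi (u, n)).
have gK : cancel unfold_lim g by move=> q; apply: unfold_lim_inj; rewrite gP.
exists g; split; [|exact: gK|exact: gP].
(* By [lm_open] all points near [y] have representatives at the same level [n], so a neighbourhood
   in the quotient is tested at that level only. *)
move=> y U; have [u [n [E yE]]] := unfold_lim_onto y.
rewrite -{1}yE gK => /(@pi_continuous _ _ (u, n)) [[V V'] /= [/set_type_nbhsP[e e0 eV] V'n] VU].
have [t t0 tP] := lm_open lm (val_dom u) e0.
have [s s0 sP] := henon_iter_continuous p a n (\val y) t0.
apply/set_type_nbhsP; exists s => // y' [h1 h2].
have [q1 q2] := sP _ h1 h2; rewrite E in q1 q2.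
have Jy' : Jplus p a (iter n H (\val y')).
  elim: (n) => [|k IH]; first exact: set_mem (valP y').
  rewrite iterS; exact: (JplusH _).2 IH.
have [w [dw ThE w1 w2]] := tP _ Jy' q1 q2.
pose v : T := SigSub (mem_set dw).
have -> : y' = unfold_lim (indlim_in psi (v, n)).
  rewrite unfold_limE; apply: val_inj; rewrite /= /unfold /=.
  by rewrite ThE iter_henonK.
rewrite /= gK; apply: (VU (v, n)); split => /=; last exact: (nbhs_singleton V'n).
by apply: eV; split.
Qed.

Lemma unfold_lim_conj q : H (set_val (unfold_lim q)) = set_val (unfold_lim (indlim_map q)).
Proof.
have [[u n] ->] := indlim_inS q.
rewrite indlim_mapE !unfold_limE.
change (H (unfold (u, n)) = unfold (psi u, n)).
rewrite /unfold /= -(lm_conj lm (val_dom u)).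
by elim: n => [//|n IH]; rewrite !iterS -IH (henonK p a0) (henon_invK p a0).
Qed.

End Assembly.

(** * Choice of the constants *)

Lemma small_mul (R : realType) (c b : R) : 0 <= c -> 0 < b ->
  exists2 u : R, 0 < u & forall x, 0 <= x < u -> c * x < b.
Proof.
move=> c0 b0; exists (b / (c + 1)); first by rewrite divr_gt0//; lra.
move=> x /andP[x0]; rewrite ltr_pdivlMr; last lra.
by move=> h; lra.
Qed.

Section Constants.
Variables (R : realType) (p : {poly Cplx R}) (d : nat) (r : R).
Local Notation C := (Cplx R).
Local Notation J := (julia p).
Local Notation H := (henon p).
Hypotheses (pm : p \is monic) (sp : size p = d.+1) (d2 : (2 <= d)%N) (r_gt0 : 0 < r).
Implicit Types (z v : C).

Lemma frame_exists : hyperbolic p -> exists (rho : C -> R) (M lam del s R1 L R0 t : R),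
  frame p d rho M lam del s R1 L r /\ escape_frame p d lam del s R1 r R0 t.
Proof.
move=> hyp; have r0 := r_gt0.
have [rho [M0 [lam [del [l1 d0 rhoP dP eP]]]]] := hyperbolic_expansion pm sp d2 hyp.
have [B B0 JB] := julia_bounded pm sp d2.
(* The expansion bounds [M0] from below only through points of [J]; the maximum gives [1 <= M]
   directly. *)
pose M := Num.max 1 M0.
have M1 : 1 <= M by rewrite le_max lexx.
have MM0 : M0 <= M by rewrite le_max lexx orbT.
pose R1 := B + del; have R10 : 0 <= R1 by rewrite /R1; lra.
have [L L0 LP] := horner_C1 p R1.
pose s := Num.min (del / 4) ((lam - 1) / (8 * M * L + 1)).
have ML : 0 <= 8 * M * L by apply: mulr_ge0 => //; lra.
have s0 : 0 < s by rewrite lt_min !divr_gt0//; lra.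
have sd : s <= del / 4 by rewrite ge_min lexx.
have sL : s * (8 * M * L + 1) <= lam - 1.
  by rewrite -ler_pdivlMr ?ge_min ?lexx ?orbT//; lra.
(* The margin provides [1 <= R0], [R1 + 1 <= R0] and [r < R0] at once. *)
have [R0 R0P growth] := monic_growth (R1 + r + 2) pm sp d2.
have dd0 : 0 < del ^+ d by rewrite exprn_gt0.
pose t := Num.min s (del ^+ d / lam).
have t0 : 0 < t by rewrite lt_min s0 divr_gt0//; lra.
have ts : t <= s by rewrite ge_min lexx.
have td : t * lam <= del ^+ d by rewrite -ler_pdivlMr ?ge_min ?lexx ?orbT//; lra.
clearbody M s t.
exists rho, M, lam, del, s, R1, L, R0, t; split; split.
- exact: pm.
- exact: sp.
- exact: d2.
- split; [exact: l1|exact: d0| |exact: dP|exact: eP].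
  by move=> z /rhoP /andP[-> h]; lra.
- exact: M1.
- exact: s0.
- lra.
- by move=> z /JB; rewrite /R1; lra.
- exact: R10.
- exact: L0.
- exact: LP.
- lra.
- exact: r0.
- lra.
- exact: growth.
- lra.
- lra.
- by rewrite t0.
- by rewrite mulrC.
Qed.

Variables (rho : C -> R) (M lam del s R1 L R0 t : R).
Hypotheses (fr : frame p d rho M lam del s R1 L r) (ef : escape_frame p d lam del s R1 r R0 t).
Local Notation cst := (2 * M / (lam - 1)).

(** The sheet over [z] is a disc of radius of order [eps ^+ 2] around [eps * z]. If two sheets meet,
    [z] and [z'] are at distance of order [eps], below [del]; the expansion makes [p] injective at
    that scale. *)
Lemma sheet_frame_exists (D : R) : 0 <= D -> exists2 eps0 : R, 0 < eps0 & forall eps, 0 < eps < eps0 ->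
  [/\ sheet_frame p eps r, eps * R1 < r & D * (cst * R1) * eps <= r / 10].
Proof.
move=> D0; have r0 := r_gt0; have expn := fr_exp fr; have l1 := exp_lam expn.
have M1 := fr_M fr; have del0 := exp_del expn; have R10 := fr_R1_ge0 fr; have c0 := cst_ge0 fr.
have M0 : 0 < M by lra.
pose b := lam / M; have b0 : 0 < b by rewrite divr_gt0//; lra.
have Db z : J z -> b <= nm p^`().[z].
  move=> Jz; have := deriv_lower pm sp d2 expn Jz.
  by rewrite /b ler_pdivrMr// mulrC.
have [u1 u10 u1P] := small_mul R10 r0.
have [u2 u20 u2P] := small_mul (mulr_ge0 D0 (mulr_ge0 c0 R10)) (divr_gt0 r0 (ltr0n R 10)).
have k3 : 0 <= 6 * r / b by rewrite divr_ge0//; lra.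
have [u3 u30 u3P] := small_mul k3 del0.
have k4 : 0 <= R1 + 3 * r / b by rewrite addr_ge0// divr_ge0//; lra.
have [u4 u40 u4P] := small_mul k4 r0.
exists (Num.min (Num.min u1 u2) (Num.min (Num.min u3 u4) (Num.min 1 (b / 2)))).
  by rewrite !lt_min u10 u20 u30 u40 ltr01/= divr_gt0.
move=> eps /andP[e0]; rewrite !lt_min => /andP[/andP[e1 e2] /andP[/andP[e3 e4] /andP[e5 e6]]].
have e0' := ltW e0.
have q1 : R1 * eps < r by apply: u1P; rewrite e0'.
have q2 : D * (cst * R1) * eps < r / 10 by apply: u2P; rewrite e0'.
have q3 : 6 * r / b * eps < del by apply: u3P; rewrite e0'.
have q4 : (R1 + 3 * r / b) * eps < r by apply: u4P; rewrite e0'.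
split; [|lra|exact: ltW].
have En : nm (rC eps) = eps by rewrite nm_rC gtr0_norm.
have term z v (k : R) : J z -> nm v <= k -> nm (rC eps ^+ 2 * v / p^`().[z]) <= eps ^+ 2 * k / b.
  move=> Jz vk; have Dz := Db z Jz; have Dz0 : 0 < nm p^`().[z] by lra.
  rewrite nmM [nm (_ * v)]nmM nmX nmV En.
  have k0 : 0 <= k := le_trans (nm_ge0 v) vk.
  rewrite ler_pdivrMr// [leRHS]mulrAC ler_pdivlMr//.
  have ee0 : 0 <= eps ^+ 2 by apply: exprn_ge0.
  apply: ler_pM; [|exact: ltW| |exact: Dz].
    by apply: mulr_ge0 => //; exact: nm_ge0.
  exact: ler_wpM2l.
have ee : eps ^+ 2 <= eps by rewrite expr2 -[leRHS]mulr1; apply: ler_wpM2l; lra.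
split.
- exact: r0.
- exact: e0.
- by move=> z /Db bz; rewrite -nm_gt0; lra.
- move=> z z' v v' Jz Jz' pz vr v'r E.
  have h : rC eps * (z - z') = rC eps ^+ 2 * v / p^`().[z] - rC eps ^+ 2 * v' / p^`().[z'].
    rewrite /model_fibre /model_map /= in E.
    have -> : rC eps * (z - z') = rC eps * z - rC eps ^+ 2 * v / p^`().[z]
      + rC eps ^+ 2 * v / p^`().[z] - rC eps * z' by ring.
    by rewrite E; ring.
  have h2 : eps * nm (z - z') <= eps ^+ 2 * (3 * r) / b + eps ^+ 2 * (3 * r) / b.
    rewrite -En -nmM h En; apply: le_trans (nmD _ _) _; rewrite nmN.
    by apply: lerD; exact: term.
  have h3 : nm (z - z') <= del.
    rewrite -(ler_pM2l e0); apply: le_trans h2 _.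
    have -> : eps ^+ 2 * (3 * r) / b + eps ^+ 2 * (3 * r) / b = eps * (6 * r / b * eps) by ring.
    by rewrite ler_pM2l//; exact: ltW.
  have h4 : nm (z' - z') <= del by rewrite subrr nm0 ltW.
  have := exp_dist expn Jz' h3 h4; rewrite pz subrr nm0 mulr0 => h5.
  have /andP[r1 _] := exp_rho expn Jz'.
  have lr : 0 < lam * rho z' by apply: mulr_gt0; lra.
  apply/eqP; rewrite -subr_eq0; apply/eqP/nm0P/eqP; rewrite eq_le nm_ge0 andbT.
  by rewrite -(ler_pM2l lr) mulr0.
- move=> z v Jz vr; rewrite /model_fibre /model_map /=.
  apply: le_lt_trans (nmD _ _) _; rewrite nmN nmM En.
  have zR : nm z <= R1 by have := fr_R1 fr Jz; lra.
  have h1 := term z v _ Jz vr.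
  have h2 : eps * nm z <= eps * R1 by apply: ler_wpM2l.
  have h3 : eps ^+ 2 * (3 * r) / b <= eps * (3 * r) / b.
    by apply: ler_wpM2r; [rewrite invr_ge0 ltW|apply: ler_wpM2r => //; lra].
  lra.
- move=> z v v' Jz; rewrite /model_fibre /model_map /=.
  have -> : rC eps * z - rC eps ^+ 2 * v / p^`().[z] - (rC eps * z - rC eps ^+ 2 * v' / p^`().[z])
    = - (rC eps ^+ 2 * (v - v') / p^`().[z]) by ring.
  rewrite nmN; apply: le_trans (term z (v - v') _ Jz (lexx _)) _.
  rewrite ler_pdivrMr//.
  have v0 := nm_ge0 (v - v').
  have : eps ^+ 2 * nm (v - v') <= b / 2 * nm (v - v') by apply: ler_wpM2r => //; lra.
  lra.
Qed.

Lemma model_param_exists (eps : R) : 0 < eps -> exists2 a0 : R, 0 < a0 &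
  forall a : C, 0 < nm a < a0 -> model_param p rho M lam s R1 L r R0 t eps a.
Proof.
move=> e0; have r0 := r_gt0; have l1 := exp_lam (fr_exp fr); have s0 := fr_s fr.
have M1 := fr_M fr; have R10 := fr_R1_ge0 fr; have c0 := cst_ge0 fr; have L0 := fr_L0 fr.
have M0 : 0 <= M by lra.
have ls : 0 < (lam - 1) / 2 * s by apply: mulr_gt0; lra.
have l4 : 0 < Num.min (1 / 2) ((lam - 1) / 4) by rewrite lt_min; apply/andP; split; lra.
have C0 : 0 <= (2 * L * r + 1) * cst ^+ 2.
  apply: mulr_ge0; last exact: exprn_ge0.
  by have := mulr_ge0 L0 (ltW r0); lra.
have h20 : 0 < 1 / 20 :> R by lra.
have [u1 u10 u1P] := small_mul R10 r0.
have [u2 u20 u2P] := small_mul (mulr_ge0 M0 (ltW r0)) ls.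
have [u3 u30 u3P] := small_mul M0 l4.
have [u4 u40 u4P] := small_mul C0 h20.
have [u5 u50 u5P] := escape_param_exists fr ef.
exists (Num.min (Num.min u1 u2) (Num.min (Num.min u3 u4) (Num.min u5 (eps / 2)))).
  by rewrite !lt_min u10 u20 u30 u40 u50/= divr_gt0.
move=> a /andP[a0]; rewrite !lt_min => /andP[/andP[e1 e2] /andP[/andP[e3 e4] /andP[e5 e6]]].
have a0' := ltW a0.
have q1 : R1 * nm a < r by apply: u1P; rewrite a0'.
have q2 : M * r * nm a < (lam - 1) / 2 * s by apply: u2P; rewrite a0'.
have : M * nm a < Num.min (1 / 2) ((lam - 1) / 4) by apply: u3P; rewrite a0'.
rewrite lt_min => /andP[q3 q4].
have q5 : (2 * L * r + 1) * cst ^+ 2 * nm a < 1 / 20 by apply: u4P; rewrite a0'.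
split.
- by split; lra.
- by apply: u5P; rewrite a0.
- exact: ltW.
- exact: ltW.
Qed.

End Constants.

Theorem mainTheorem1 (R : realType) (d : nat) (p : {poly Cplx R}) (r : R) :
  (2 <= d)%N -> size p = d.+1 -> p \is monic ->
  hyperbolic p -> connected (julia p) ->
  admissible_radius p r ->
  exists2 eps0 : R, 0 < eps0 &
    forall eps : R, 0 < eps < eps0 ->
      exists hpsi : set_fun (model_domain p r) (model_domain p r)
                            (model_map p eps),
        let psi := restrict_self hpsi in
        injective psi /\
        exists2 a0 : R, 0 < a0 &
          forall a : Cplx R, 0 < `|a| < rC a0 ->
            exists Phi : indlim psi -> set_type (Jplus p a),
              is_homeomorphism Phi /\
              forall x : indlim psi,
                henon p a (set_val (Phi x)) = set_val (Phi (indlim_map x)).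
Proof.
move=> d2 sp pm hyp _ [r3 _ _].
have r0 : 0 < r by lra.
have [rho [M [lam [del [s [R1 [L [R0 [t [fr ef]]]]]]]]]] := frame_exists pm sp d2 r0 hyp.
have [D D0 DP] := horner_bounded p^`() R1.
have DJ z : julia p z -> nm p^`().[z] <= D.
  by move=> Jz; apply: DP; have := fr_R1 fr Jz; have := exp_del (fr_exp fr); lra.
(* So far all constants depend on [p] and [r] only; [a] is restricted later, in terms of [eps]. *)
have [eps0 eps00 epsP] := sheet_frame_exists pm sp d2 r0 fr D0.
exists eps0 => // eps epsE; have [sf e1 e2] := epsP eps epsE.
have hpsi : set_fun (model_domain p r) (model_domain p r) (model_map p eps).
  move=> w /model_domainP[Jw wr]; apply/model_domainP; split.
    exact: (julia_horner pm sp d2 w.1).2 Jw.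
  have wr3 : nm w.2 <= 3 * r by lra.
  have := sf_inside sf Jw wr3.
  by rewrite /model_fibre -surjective_pairing.
exists hpsi => psi; split.
  move=> u v /(congr1 val) uv.
  have [Ju ur] := (model_domainP p r (val u)).1 (set_mem (valP u)).
  have [Jv vr] := (model_domainP p r (val v)).1 (set_mem (valP v)).
  have ur3 : nm (val u).2 <= 3 * r by lra.
  have vr3 : nm (val v).2 <= 3 * r by lra.
  have uv2 : model_fibre p eps (val u).1 (val u).2 = model_fibre p eps (val v).1 (val v).2.
    by rewrite /model_fibre -!surjective_pairing; exact: (congr1 snd uv).
  have uv1 := sf_sep sf Ju Jv (congr1 fst uv) ur3 vr3 uv2.
  apply: val_inj; rewrite [LHS]surjective_pairing [RHS]surjective_pairing uv1; congr pair.
  rewrite uv1 in uv2.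
  by rewrite -(model_fibreK sf (val u).2 Jv) uv2 (model_fibreK sf).
have [a0 a00 aP] := model_param_exists r0 fr ef (sf_eps sf).
exists a0 => // a; rewrite -rC_nm (rC_lt 0) rC_lt => /aP mp.
have [Th lm] := local_model_exists fr ef sf DJ e1 e2 mp.
have an0 := ep_neq0 (mp_escape mp).
have R00 : 0 < R0 := lt_le_trans ltr01 (ef_R0 ef).
have JH := Jplus_henon R00 (ef_growth ef) an0 (param_half fr (mp_small mp)).
exists (@unfold_lim _ _ _ _ _ hpsi Th an0 lm JH); split; first exact: unfold_lim_homeomorphism.
exact: unfold_lim_conj.
Qed.
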